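(* Let $m,n\ge 1$, let $\Theta\in H^\infty(\mathbb{D},\mathcal{L}(\mathbb{C}^m,\mathbb{C}^m))$ be an inner multiplier and $\Phi=\Theta^*$ on $\mathbb{T}$, and let $\{G_i\}_{i=1}^n$ and $\{H_i\}_{i=1}^n$ be orthonormal sets in $H^2_{\mathbb{C}^m}(\mathbb{D})$. Define $T_n:H^2_{\mathbb{C}^m}(\mathbb{D})\to H^2_{\mathbb{C}^m}(\mathbb{D})$ by $T_n(F)=T_{\Theta^*}(F)+\sum_{i=1}^n\langle F,G_i\rangle H_i$. Then the following statements hold. (i) If $G_j\in\Theta H^2_{\mathbb{C}^m}(\mathbb{D})$ for all $j\in\{1,2,\ldots,n\}$, then the subspace $\operatorname{Ker}T_n$ is nearly $S^*$-invariant with defect at most $n$, and the defect space is $$\mathcal{F}=\bigvee\{\Theta S^*H_j: j=1,2,\ldots,n\}.$$ (ii) If $1\le l\le n$, $G_j\notin\Theta H^2_{\mathbb{C}^m}(\mathbb{D})$ for $j\in\{1,2,\ldots,l\}$, and $G_j\in\Theta H^2_{\mathbb{C}^m}(\mathbb{D})$ for the remaining indices $j\in\{l+1,\ldots,n\}$, then $\operatorname{Ker}T_n$ is a nearly $S^*$-invariant subspace of $H^2_{\mathbb{C}^m}(\mathbb{D})$ with defect at most $n+l$, and the defect space is $$\mathcal{F}=\bigvee\{\Theta S^*H_i,\;P_{\mathcal{K}_\Theta}G_j: i=1,2,\ldots,n\text{ and }j=1,2,\ldots,l\}.$$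
   Context: $\mathbb{D}$ is the open unit disc and $\mathbb{T}$ the unit circle. $H^2_{\mathbb{C}^m}(\mathbb{D})$ is the $\mathbb{C}^m$-valued Hardy space, identified via radial boundary values with a closed subspace of $L^2(\mathbb{T},\mathbb{C}^m)$; $P_m$ is the orthogonal projection of $L^2(\mathbb{T},\mathbb{C}^m)$ onto $H^2_{\mathbb{C}^m}(\mathbb{D})$. For $\Phi\in L^\infty(\mathbb{T},\mathcal{L}(\mathbb{C}^m,\mathbb{C}^m))$ the Toeplitz operator is $T_\Phi F=P_m(\Phi F)$, $F\in H^2_{\mathbb{C}^m}(\mathbb{D})$; $\Phi^*$ denotes the pointwise adjoint on $\mathbb{T}$. $H^\infty(\mathbb{D},\mathcal{L}(\mathbb{C}^m,\mathbb{C}^m))$ is the space of bounded analytic $\mathcal{L}(\mathbb{C}^m,\mathbb{C}^m)$-valued functions on $\mathbb{D}$, regarded as a subspace of $L^\infty(\mathbb{T},\mathcal{L}(\mathbb{C}^m,\mathbb{C}^m))$; an element $\Theta$ is an inner multiplier if $\Theta(e^{it})$ is an isometry for almost every $e^{it}\in\mathbb{T}$. $\mathcal{K}_\Theta=H^2_{\mathbb{C}^m}(\mathbb{D})\ominus\Theta H^2_{\mathbb{C}^m}(\mathbb{D})$ is the model space and $P_{\mathcal{K}_\Theta}$ is the orthogonal projection of $L^2(\mathbb{T},\mathbb{C}^m)$ onto $\mathcal{K}_\Theta$. $S$ is the forward shift $SF(z)=zF(z)$ on $H^2_{\mathbb{C}^m}(\mathbb{D})$ and $S^*$ is its adjoint,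 the backward shift $S^*F(z)=(F(z)-F(0))/z$. $\bigvee$ denotes the (closed) linear span. A closed subspace $\mathcal{M}\subset H^2_{\mathbb{C}^m}(\mathbb{D})$ is nearly $S^*$-invariant with defect $p$ if there is a $p$-dimensional subspace $\mathcal{F}\subset H^2_{\mathbb{C}^m}(\mathbb{D})$ (which may be taken to be orthogonal to $\mathcal{M}$) such that $F\in\mathcal{M}$ and $F(0)=0$ imply $S^*F\in\mathcal{M}+\mathcal{F}$; such an $\mathcal{F}$ is called the defect space. ''Defect at most $k$ with defect space $\mathcal{F}$'' means that $\dim\mathcal{F}\le k$ and this implication holds with $\mathcal{F}$. *)

(* Defs.v *)
From HB Require Import structures.
From mathcomp Require Import all_boot all_order all_algebra.
From mathcomp Require Import ring complex.
From mathcomp Require Import all_classical all_reals all_analysis.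
Import Order.TTheory GRing.Theory Num.Theory.
Import numFieldNormedType.Exports.

Set Implicit Arguments.
Unset Strict Implicit.
Unset Printing Implicit Defensive.

Local Open Scope classical_set_scope.
Local Open Scope ring_scope.

(* The topology of R[i] is the one that mathcomp-analysis puts on an abstract
   numFieldType; it is not inferred automatically for the concrete type R[i]. *)
HB.instance Definition _ (R : realType) :=
  NormedModule.copy R[i] (R[i] : numClosedFieldType)^o.

(* Inner product of C^m, linear in the first argument. *)
Definition dotv (R : realType) (m : nat) (u v : 'cV[R[i]]_m) : R[i] :=
  \sum_k u k 0 * (v k 0)^*.

Definition normsqv (R : realType) (m : nat) (u : 'cV[R[i]]_m) : R :=
  complex.Re (dotv u u).

(* The Hardy space H^2: F(z) = \sum_n A_n z^n on the unit disc with
   \sum_n |A_n|^2 < oo, represented by its Taylor coefficients A. *)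

Definition square_summable (R : realType) (m : nat) (a : nat -> 'cV[R[i]]_m) :
  Prop := cvgn (series (fun n => normsqv (a n))).

Definition l2seq (R : realType) (m : nat) : {pred (nat -> 'cV[R[i]]_m)} :=
  fun a => `[< square_summable a >].

Lemma normsqvE (R : realType) (m : nat) (u : 'cV[R[i]]_m) :
  normsqv u = \sum_k (complex.Re (u k 0) ^+ 2 + complex.Im (u k 0) ^+ 2).
Proof.
rewrite /normsqv /dotv raddf_sum; apply: eq_bigr => k _.
by case: (u k 0) => x y /=; rewrite mulrN opprK -!expr2.
Qed.

Lemma normsqv_ge0 (R : realType) (m : nat) (u : 'cV[R[i]]_m) : 0 <= normsqv u.
Proof. by rewrite normsqvE sumr_ge0// => k _; rewrite addr_ge0 ?sqr_ge0. Qed.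

Lemma normsqv_lin (R : realType) (m : nat) (c : R[i]) (u v : 'cV[R[i]]_m) :
  normsqv (c *: u + v) <=
  2 * (complex.Re c ^+ 2 + complex.Im c ^+ 2) * normsqv u + 2 * normsqv v.
Proof.
rewrite !normsqvE !mulr_sumr -big_split/=; apply: ler_sum => k _; rewrite !mxE.
case: c (u k 0) (v k 0) => [a b] [x y] [p q] /=.
rewrite -subr_ge0 (_ : _ - _ =
  (a * x - b * y - p) ^+ 2 + (a * y + b * x - q) ^+ 2); last by ring.
by rewrite addr_ge0 ?sqr_ge0.
Qed.

Lemma l2seq_submod_closed (R : realType) (m : nat) :
  GRing.submod_closed (@l2seq R m).
Proof.
split.
  apply/asboolP; rewrite /square_summable.
  rewrite (_ : (fun n => _) = fun=> 0); last first.
    by apply/funext => n; rewrite normsqvE big1// => k _; rewrite mxE/= expr0n addr0.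
  rewrite (_ : series _ = fun=> 0); first exact: is_cvg_cst.
  by apply/funext => n; rewrite seriesEnat/= big1.
move=> c a b /asboolP ha /asboolP hb; apply/asboolP.
pose K := 2 * (complex.Re c ^+ 2 + complex.Im c ^+ 2).
apply: (@series_le_cvg _ _ (fun n => K * normsqv (a n) + 2 * normsqv (b n))).
- by move=> n; exact: normsqv_ge0.
- move=> n; rewrite addr_ge0// mulr_ge0 ?normsqv_ge0// /K.
  by rewrite mulr_ge0// addr_ge0 ?sqr_ge0.
- by move=> n; exact: normsqv_lin.
- exact: (is_cvg_seriesD (is_cvg_seriesZ (k := K) ha)
    (is_cvg_seriesZ (k := 2) hb)).
Qed.

HB.instance Definition _ (R : realType) (m : nat) :=
  GRing.isSubmodClosed.Build R[i] (nat -> 'cV[R[i]]_m) (@l2seq R m)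
    (@l2seq_submod_closed R m).

Record hardy (R : realType) (m : nat) := Hardy {
  coef : nat -> 'cV[R[i]]_m;
  coefP : coef \in @l2seq R m }.

HB.instance Definition _ (R : realType) (m : nat) :=
  [isSub for @coef R m].
HB.instance Definition _ (R : realType) (m : nat) :=
  [Choice of hardy R m by <:].
HB.instance Definition _ (R : realType) (m : nat) :=
  [SubChoice_isSubLmodule of hardy R m by <:].

Definition power_series (R : realType) (m p : nat)
    (a : nat -> 'M[R[i]]_(m, p)) (z : R[i]) : nat -> 'M[R[i]]_(m, p) :=
  series (fun n => z ^+ n *: a n).

(* F(z), meaningful for `|z| < 1. *)
Definition heval (R : realType) (m : nat) (F : hardy R m) (z : R[i]) :
    'cV[R[i]]_m :=
  limn (power_series (coef F) z).

Lemma l2seq_shift (R : realType) (m : nat) (F : hardy R m) :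
  (fun n => coef F n.+1) \in @l2seq R m.
Proof.
have /asboolP := coefP F; rewrite /square_summable => hF; apply/asboolP.
rewrite /square_summable (_ : series _ =
    [sequence series (fun n => normsqv (coef F n)) n.+1 - normsqv (coef F 0%N)]_n);
  last first.
  by apply/funext => n; rewrite !seriesEord/= big_ord_recl/= addrAC subrr add0r.
apply: is_cvgB; last exact: is_cvg_cst.
move: hF => /cvg_ex[l hl]; apply/cvg_ex; exists l.
by rewrite (cvg_shiftS (series _)).
Qed.

(* The backward shift S^*: the Taylor coefficients of (F(z) - F(0)) / z;
   see heval_bshift below. *)
Definition bshift (R : realType) (m : nat) (F : hardy R m) : hardy R m :=
  Hardy (l2seq_shift F).

Lemma cvg_real_complex (R : realType) (u : nat -> R) (l : R) :
  u @ \oo --> l -> real_complex R (u n) @[n --> \oo] --> real_complex R l.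
Proof.
move=> ul; apply/cvgrPdist_lt => e e0.
have [e1 e2] : 0 < complex.Re e /\ e = real_complex R (complex.Re e).
  by case: e e0 => a b; rewrite ltcE/= => /andP[/eqP b0 a0]; split=> //; rewrite b0.
near=> n; rewrite e2 -rmorphB normc_def/= expr0n addr0 sqrtr_sqr ltcR.
near: n; move/cvgrPdist_lt : ul; apply.
Unshelve. all: by end_near. Qed.

Lemma cvg_mxP (R : realType) (m p : nat) (u : nat -> 'M[R[i]]_(m, p))
    (l : 'M[R[i]]_(m, p)) :
  (forall i j, u n i j @[n --> \oo] --> l i j) -> u @ \oo --> l.
Proof.
move=> h; apply/cvg_ballP => e e0.
have H i j : \forall n \near \oo, ball (l i j) e (u n i j).
  by move/cvg_ballP: (h i j); apply.
have : \forall n \near \oo, forall ij : 'I_m * 'I_p, ball (l ij.1 ij.2) e (u n ij.1 ij.2).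
  by apply: filter_forall => ij; exact: H.
apply: filterS => n Hn; split=> // i j; exact: (Hn (i, j)).
Qed.

Lemma cvg_Complex (R : realType) (u v : nat -> R) (a b : R) :
  u @ \oo --> a -> v @ \oo --> b ->
  Complex (u n) (v n) @[n --> \oo] --> Complex a b.
Proof.
move=> ua vb.
have E x y : Complex x y = real_complex R x + Complex 0 1 * real_complex R y.
  by apply/eqP; rewrite eq_complex/=; apply/andP; split; apply/eqP; ring.
rewrite E; under eq_fun do rewrite E.
apply: cvgD; first exact: cvg_real_complex.
by apply: cvgM; [exact: cvg_cst|exact: cvg_real_complex].
Qed.

Lemma complex_series_cvg (R : realType) (w : nat -> R[i]) (K q : R) :
  0 <= K -> 0 <= q < 1 ->
  (forall n, `|complex.Re (w n)| <= K * q ^+ n) ->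
  (forall n, `|complex.Im (w n)| <= K * q ^+ n) -> cvgn (series w).
Proof.
move=> K0 /andP[q0 q1] hr hi.
have g : cvgn (series (fun n => K * q ^+ n)).
  by apply: is_cvg_geometric_series; rewrite ger0_norm.
have Hc (v : nat -> R) : (forall n, `|v n| <= K * q ^+ n) -> cvgn (series v).
  move=> hv; apply: normed_cvg; apply: (series_le_cvg _ _ hv g) => n; first exact: normr_ge0.
  by apply: mulr_ge0 => //; exact: exprn_ge0.
have /cvg_ex[a ha] := Hc _ hr; have /cvg_ex[b hb] := Hc _ hi.
apply/cvg_ex; exists (Complex a b).
rewrite (_ : series w = fun n => Complex (series (fun n => complex.Re (w n)) n)
  (series (fun n => complex.Im (w n)) n)); first exact: cvg_Complex.
apply/funext => n; rewrite !seriesEord/= -!raddf_sum/=.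
by case: (\sum_(k < n) w k).
Qed.

Lemma power_series_cvg (R : realType) (m : nat) (F : hardy R m) (z : R[i]) :
  `|z| < 1 -> cvgn (power_series (coef F) z).
Proof.
move=> z1.
pose q := complex.Re `|z|.
have qE : `|z| = real_complex R q by rewrite /q normc_def.
have q01 : 0 <= q < 1.
  by move: z1 (normr_ge0 z); rewrite qE -[1]/(real_complex R 1) ltcR lecR => -> ->.
have [K K0 hK] : exists2 K : R, 0 <= K & forall n k, `|coef F n k 0| <= real_complex R K.
  have /asboolP/cvg_series_cvg_0 h := coefP F.
  have [M [_ hM]] := cvg_seq_bounded (cvgP _ h).
  have M1 := hM (`|M| + 1) (ltr_pwDr ltr01 (ler_norm _)).
  exists (Num.sqrt (`|M| + 1)); first exact: sqrtr_ge0.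
  move=> n k; rewrite normc_def lecR ler_sqrt; last by rewrite addr_ge0.
  apply: le_trans (ler_norm _) (le_trans _ (M1 n _)) => //.
  rewrite ger0_norm; last by rewrite addr_ge0 ?sqr_ge0.
  rewrite ger0_norm ?normsqv_ge0// normsqvE (bigD1 k)//= lerDl.
  by rewrite sumr_ge0// => i _; rewrite addr_ge0 ?sqr_ge0.
have H n k : `|(z ^+ n *: coef F n) k 0| <= real_complex R (K * q ^+ n).
  by rewrite mxE normrM normrX qE rmorphM rmorphXn mulrC ler_wpM2r// -rmorphXn lecR exprn_ge0//; case/andP: q01.
have Hc k : cvgn (series (fun n => (z ^+ n *: coef F n) k 0)).
  apply: (@complex_series_cvg _ _ K q) => // n.
  - rewrite -lecR; apply: le_trans (H n k); exact: normc_ge_Re.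
  - rewrite -lecR; apply: le_trans (H n k); by rewrite normc_def lecR -sqrtr_sqr
      ler_wsqrtr// lerDr sqr_ge0.
pose L := \col_k limn (series (fun n => (z ^+ n *: coef F n) k 0)).
apply/cvg_ex; exists L; apply: cvg_mxP => i j; rewrite (ord1 j) mxE.
rewrite (_ : (fun n => _) = series (fun n => (z ^+ n *: coef F n) i 0)); first exact: Hc.
by apply/funext => n; rewrite /power_series !seriesEord/= summxE.
Qed.

Lemma heval_bshift (R : realType) (m : nat) (F : hardy R m) (z : R[i]) :
  `|z| < 1 -> z *: heval (bshift F) z = heval F z - heval F 0.
Proof.
move=> z1.
have z0 : heval F 0 = coef F 0%N.
  apply/cvg_lim; first exact: norm_hausdorff.
  rewrite -(cvg_shiftS (power_series _ _)) (_ : [sequence _]_n = fun=> coef F 0%N); first exact: cvg_cst.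
  apply/funext => n; rewrite /power_series seriesEord/= big_ord_recl/= expr0 scale1r big1 ?addr0// => i _.
  by rewrite expr0n/= scale0r.
rewrite z0; apply/eqP; rewrite eq_sym subr_eq addrC; apply/eqP.
apply/cvg_lim; first exact: norm_hausdorff.
rewrite -(cvg_shiftS (power_series _ _)).
rewrite (_ : [sequence _]_n = fun n => coef F 0%N + z *: power_series (coef (bshift F)) z n).
  apply: cvgD; first exact: cvg_cst.
  by apply: cvgZ; [exact: cvg_cst|exact: power_series_cvg].
apply/funext => n; rewrite /power_series !seriesEord/= big_ord_recl/= expr0 scale1r scaler_sumr.
by congr (_ + _); apply: eq_bigr => i _; rewrite scalerA -exprS.
Qed.

(* Radial boundary values: F(e^{it}) = lim_{r -> 1^-} F(r e^{it}). *)
Definition expi (R : realType) (t : R) : R[i] := Complex (cos t) (sin t).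

Definition radial_limit (R : realType) (m p : nat)
    (F : R[i] -> 'M[R[i]]_(m, p)) (t : R) : 'M[R[i]]_(m, p) :=
  lim (F (real_complex R r * expi t) @[r --> (1 : R)^'-]).

Definition hboundary (R : realType) (m : nat) (F : hardy R m) :
    R -> 'cV[R[i]]_m := radial_limit (heval F).

(* The unit circle is parametrized by t in [0, 2 pi]; the inner product of
   L^2(T, C^m) is taken with respect to the normalized measure dt / (2 pi). *)
Definition circle (R : realType) : set R := `[0, 2 * pi]%classic.

Definition mean (R : realType) (f : R -> R[i]) : R[i] :=
  real_complex R (2 * pi)^-1 *
  Complex (\int[lebesgue_measure]_(t in @circle R) complex.Re (f t))
          (\int[lebesgue_measure]_(t in @circle R) complex.Im (f t)).

Definition L2dot (R : realType) (m : nat) (f g : R -> 'cV[R[i]]_m) : R[i] :=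
  mean (fun t => dotv (f t) (g t)).

Definition hdot (R : realType) (m : nat) (F G : hardy R m) : R[i] :=
  L2dot (hboundary F) (hboundary G).

Definition hnorm (R : realType) (m : nat) (F : hardy R m) : R :=
  Num.sqrt (complex.Re (hdot F F)).

Definition orthonormal_family (R : realType) (m n : nat)
    (G : 'I_n -> hardy R m) : Prop :=
  forall i j, hdot (G i) (G j) = (i == j)%:R.

Definition linear_subspace (R : realType) (m : nat) (M : set (hardy R m)) :
    Prop :=
  M 0 /\ forall (c : R[i]) F G, M F -> M G -> M (c *: F + G).

Definition closed_subspace (R : realType) (m : nat) (M : set (hardy R m)) :
    Prop :=
  linear_subspace M /\
  forall (F_ : nat -> hardy R m) (F : hardy R m),
    (forall k, M (F_ k)) -> hnorm (F_ k - F) @[k --> \oo] --> (0 : R) -> M F.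

(* The linear span of A.  It is only used for finite A, where it is closed. *)
Definition lspan (R : realType) (m : nat) (A : set (hardy R m)) :
    set (hardy R m) :=
  [set F | exists (k : nat) (c : 'I_k -> R[i]) (V : 'I_k -> hardy R m),
     (forall i, A (V i)) /\ F = \sum_i c i *: V i].

Definition dim_at_most (R : realType) (m : nat) (M : set (hardy R m))
    (k : nat) : Prop :=
  exists V : 'I_k -> hardy R m, M = lspan (range V).

(* Orthogonal projection of f in L^2(T, C^m) onto a closed subspace M of H^2,
   an element of M; M = setT gives the projection P_m onto H^2.  Here and in
   hmult, xget 0 returns the unique element of the set. *)
Definition oproj (R : realType) (m : nat) (M : set (hardy R m))
    (f : R -> 'cV[R[i]]_m) : hardy R m :=
  xget 0 [set G | M G /\
    forall K, M K -> L2dot (f \- hboundary G) (hboundary K) = 0].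

Definition toeplitz (R : realType) (m : nat) (Phi : R -> 'M[R[i]]_m)
    (F : hardy R m) : hardy R m :=
  oproj setT (fun t => Phi t *m hboundary F t).

(* Theta is analytic on the unit disc (sum of its Taylor series at 0) and
   bounded there. *)
Definition Hinfty (R : realType) (m : nat) (Theta : R[i] -> 'M[R[i]]_m) :
    Prop :=
  (exists A : nat -> 'M[R[i]]_m,
     forall z, `|z| < 1 -> power_series A z @ \oo --> Theta z) /\
  (exists B : R[i], forall z, `|z| < 1 -> `|Theta z| <= B).

Definition is_isometry (R : realType) (m : nat) (A : 'M[R[i]]_m) : Prop :=
  forall v : 'cV[R[i]]_m, normsqv (A *m v) = normsqv v.

Definition inner_multiplier (R : realType) (m : nat)
    (Theta : R[i] -> 'M[R[i]]_m) : Prop :=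
  Hinfty Theta /\
  {ae @lebesgue_measure R, forall t, @circle R t -> is_isometry (radial_limit Theta t)}.

Definition boundary_adjoint (R : realType) (m : nat)
    (Theta : R[i] -> 'M[R[i]]_m) (t : R) : 'M[R[i]]_m :=
  (map_mx Num.conj (radial_limit Theta t))^T.

(* G = Theta F, as functions on the unit disc. *)
Definition is_mult (R : realType) (m : nat) (Theta : R[i] -> 'M[R[i]]_m)
    (F G : hardy R m) : Prop :=
  forall z, `|z| < 1 -> heval G z = Theta z *m heval F z.

Definition hmult (R : realType) (m : nat) (Theta : R[i] -> 'M[R[i]]_m)
    (F : hardy R m) : hardy R m :=
  xget 0 [set G | is_mult Theta F G].

Definition mult_range (R : realType) (m : nat) (Theta : R[i] -> 'M[R[i]]_m) :
    set (hardy R m) :=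
  [set G | exists F, is_mult Theta F G].

Definition model_space (R : realType) (m : nat) (Theta : R[i] -> 'M[R[i]]_m) :
    set (hardy R m) :=
  [set F | forall G, mult_range Theta G -> hdot F G = 0].

Definition perturbed (R : realType) (m n : nat) (Theta : R[i] -> 'M[R[i]]_m)
    (G H : 'I_n -> hardy R m) (F : hardy R m) : hardy R m :=
  toeplitz (boundary_adjoint Theta) F + \sum_i hdot F (G i) *: H i.

Definition kernel_set (R : realType) (m : nat)
    (T : hardy R m -> hardy R m) : set (hardy R m) :=
  [set F | T F = 0].

(* M is nearly S^*-invariant with defect at most k and defect space D. *)
Definition nearly_invariant (R : realType) (m : nat) (M D : set (hardy R m))
    (k : nat) : Prop :=
  [/\ closed_subspace M, linear_subspace D, dim_at_most D k &
      forall F, M F -> heval F 0 = 0 ->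
        exists F1 F2, [/\ M F1, D F2 & bshift F = F1 + F2]].

(* Main.v *)
(* A vector K of H^2 satisfies <T_n F, K> = <F, Theta K + sum_i <K, H_i> G_i>
   because T_{Theta^*} is the adjoint of multiplication by Theta.  If T_n F = 0,
   taking zK for K shows that F0 = S^*F + sum_i <F, G_i> Theta S^*H_i is
   orthogonal to Theta H^2.  Subtracting from F0 its projection X onto the span
   of the P_{K_Theta} G_j, j <= l, gives an element of the model space orthogonal
   to every G_j, hence an element of Ker T_n, so that S^*F lies in
   Ker T_n + span(Theta S^*H_i, P_{K_Theta} G_j).
   What this needs from the analysis is that <F, G> = sum_n <A_n, B_n> for the
   Taylor coefficients, that is, Fatou's theorem for H^2 together with the
   Riesz-Fischer theorem, and that Theta H^2 is contained in H^2. *)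
From mathcomp Require Import all_boot all_order all_algebra.
From mathcomp Require Import ring lra complex.
From mathcomp Require Import all_classical all_reals all_analysis.
From mathcomp Require Import measurable_realfun.
Require Import Defs.
Import Order.TTheory GRing.Theory Num.Theory.
Import numFieldNormedType.Exports.

Set Implicit Arguments.
Unset Strict Implicit.
Unset Printing Implicit Defensive.

Local Open Scope classical_set_scope.
Local Open Scope ring_scope.

(** * Integration over the circle *)

Import HBNNSimple.

(** The inner product [hdot] is an integral of radial limits taken by [lim], so not even its
    additivity is available before Fatou's theorem. Riesz-Fischer supplies an L^2 function f only as
    the limit of a subsequence of partial sums; the link with radial limits goes through the
    primitive of f. Integrating term by term divides the n-th coefficient by n, which makes the
    series absolutely convergent; the primitive has derivative f almost everywhere (up to the
    constant term), and at such a point the Abel means of the derived series converge to f. Parseval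
    then holds for norms, and polarization extends it to <F, G>. For Theta H^2 in H^2 the product is
    built on coefficients, since Theta times a polynomial has the norm of the polynomial. In the
    algebraic part, Theta S^*H_i appears because <H_i, zK> = <S^*H_i, K> = <Theta S^*H_i, Theta K>:
    the adjoint of the shift followed by the isometry turns a pairing with zK into one with Theta
    K. *)

Lemma ae_eq_integral_nonmeasurable d (T : measurableType d) (R : realType)
    (mu : {measure set T -> \bar R}) (D : set T) (f g : T -> \bar R) :
  {ae mu, forall x, D x -> f x = g x} ->
  (\int[mu]_(x in D) f x = \int[mu]_(x in D) g x)%E.
Proof.
(* No measurability is assumed, because boundary values are mere pointwise limits. The integral of a
   nonnegative function is the supremum over the simple functions below it, and cutting such a
   simple function to zero on the null set N keeps its integral and puts it below G. *)
have H F G : (forall x, 0 <= F x)%E -> (forall x, 0 <= G x)%E ->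
    {ae mu, forall x, F x = G x} ->
    (\int[mu]_x F x <= \int[mu]_x G x)%E.
  move=> F0 G0 [N [mN N0 subN]].
  rewrite !ge0_integralTE//; apply: ge_ereal_sup => /= _ [h hF <-].
  have mNC := measurableC mN.
  pose h' := proj_nnsfun h mNC.
  have E : (\int[mu]_x (h x)%:E = \int[mu]_x (h' x)%:E)%E.
    apply: ge0_ae_eq_integral => //.
    - exact/measurable_EFinP.
    - exact/measurable_EFinP.
    - by move=> x _; rewrite lee_fin.
    - by move=> x _; rewrite lee_fin.
    exists N; split => // x /= hx; apply: contrapT => xN; apply: hx => _.
    by rewrite mindicE mem_set//= mulr1.
  rewrite !integral_nnsfun// !patch_setT in E; rewrite E.
  apply: ereal_sup_ubound => /=; exists h' => // x.
  rewrite /= mindicE; have [xN|xN] := boolP (x \in ~` N).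
    rewrite mulr1 (le_trans (hF x))//.
    suff -> : F x = G x by [].
    by apply: contrapT => FG; move: xN; rewrite inE => /=; apply; apply: subN.
  by rewrite mulr0.
have H' F G : (forall x, 0 <= F x)%E -> (forall x, 0 <= G x)%E ->
    {ae mu, forall x, F x = G x} ->
    (\int[mu]_x F x = \int[mu]_x G x)%E.
  move=> F0 G0 FG; apply/eqP; rewrite eq_le !H//.
  by apply: filterS FG => x ->.
move=> fg; rewrite integral_mkcond [RHS]integral_mkcond integralE [RHS]integralE.
have fg' : {ae mu, forall x, (f \_ D) x = (g \_ D) x}.
  apply: filterS fg => x fg; rewrite /patch; case: ifPn => // xD.
  by apply: fg; rewrite inE in xD.
congr (_ - _)%E; apply: H' => //; apply: filterS fg' => x E.
  by rewrite !funeposE E.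
by rewrite !funenegE E.
Qed.

Lemma ae_eq_Rintegral d (T : measurableType d) (R : realType)
    (mu : {measure set T -> \bar R}) (D : set T) (f g : T -> R) :
  {ae mu, forall x, D x -> f x = g x} ->
  \int[mu]_(x in D) f x = \int[mu]_(x in D) g x.
Proof.
move=> fg; rewrite /Rintegral; congr fine; apply: ae_eq_integral_nonmeasurable.
by apply: filterS fg => x h /h ->.
Qed.

Lemma lebesgue_ae_imply (R : realType) (P Q : R -> Prop) :
  {ae @lebesgue_measure R, forall t, P t} -> (forall t, P t -> Q t) ->
  {ae @lebesgue_measure R, forall t, Q t}.
Proof.
move=> [N [mN N0 subN]] PQ; exists N; split => // t /= nQ.
by apply: subN => /= Pt; apply: nQ; exact: PQ.
Qed.

Lemma lebesgue_ae_and (R : realType) (P Q : R -> Prop) :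
  {ae @lebesgue_measure R, forall t, P t} ->
  {ae @lebesgue_measure R, forall t, Q t} ->
  {ae @lebesgue_measure R, forall t, P t /\ Q t}.
Proof.
move=> [N [mN N0 subN]] [M [mM M0 subM]]; exists (N `|` M); split.
- exact: measurableU.
- exact: null_set_setU.
move=> t /= nPQ; have [Pt|nP] := pselect (P t); last by left; apply: subN.
by right; apply: subM => /= Qt; exact: nPQ.
Qed.

Definition circle_int (R : realType) (f : R -> R) : R :=
  \int[@lebesgue_measure R]_(t in @circle R) f t.

Definition circle_integrable (R : realType) (f : R -> R) : Prop :=
  (@lebesgue_measure R).-integrable (@circle R) (EFin \o f).

Lemma measurable_circle (R : realType) :
  @measurable _ (measurableTypeR R) (@circle R).
Proof. exact: measurable_itv. Qed.

Lemma pi2_gt0 (R : realType) : 0 < 2 * pi :> R.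
Proof. by rewrite mulr_gt0// pi_gt0. Qed.

Lemma continuous_circle_integrable (R : realType) (f : R -> R) :
  continuous f -> circle_integrable f.
Proof.
move=> cf; apply: continuous_compact_integrable; first exact: segment_compact.
exact: continuous_subspaceT.
Qed.

Lemma circle_intD (R : realType) (f g : R -> R) :
  circle_integrable f -> circle_integrable g ->
  circle_int (fun t => f t + g t) = circle_int f + circle_int g.
Proof. by move=> ? ?; apply: RintegralD => //; exact: measurable_circle. Qed.

Lemma circle_intB (R : realType) (f g : R -> R) :
  circle_integrable f -> circle_integrable g ->
  circle_int (fun t => f t - g t) = circle_int f - circle_int g.
Proof. by move=> ? ?; apply: RintegralB => //; exact: measurable_circle. Qed.

Lemma circle_intZ (R : realType) (c : R) (f : R -> R) :
  circle_integrable f -> circle_int (fun t => c * f t) = c * circle_int f.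
Proof. by move=> ?; apply: RintegralZl => //; exact: measurable_circle. Qed.

Lemma circle_integrableD (R : realType) (f g : R -> R) :
  circle_integrable f -> circle_integrable g ->
  circle_integrable (fun t => f t + g t).
Proof.
move=> hf hg; have := integrableD (@measurable_circle R) hf hg.
by apply: eq_integrable => //; exact: measurable_circle.
Qed.

Lemma circle_integrableZ (R : realType) (c : R) (f : R -> R) :
  circle_integrable f -> circle_integrable (fun t => c * f t).
Proof.
move=> hf; have := integrableZl (@measurable_circle R) c hf.
by apply: eq_integrable => //; exact: measurable_circle.
Qed.

Lemma circle_integrable_sum (R : realType) (F : nat -> R -> R) N :
  (forall n, circle_integrable (F n)) ->
  circle_integrable (fun t => \sum_(n < N) F n t).
Proof.
move=> h; elim: N => [|N IH].
  apply: continuous_circle_integrable => t.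
  by under eq_fun do rewrite big_ord0; exact: cvg_cst.
under eq_fun do rewrite big_ord_recr/=.
exact: circle_integrableD.
Qed.

Lemma circle_int_sum (R : realType) (F : nat -> R -> R) N :
  (forall n, circle_integrable (F n)) ->
  circle_int (fun t => \sum_(n < N) F n t) = \sum_(n < N) circle_int (F n).
Proof.
move=> h; elim: N => [|N IH].
  under [in LHS]eq_fun do rewrite big_ord0.
  by rewrite big_ord0 /circle_int Rintegral_cst ?mul0r//; exact: measurable_circle.
under [in LHS]eq_fun do rewrite big_ord_recr/=.
rewrite circle_intD// ?IH ?big_ord_recr//; exact: circle_integrable_sum.
Qed.

Lemma circle_int_cst (R : realType) (c : R) : circle_int (fun=> c) = 2 * pi * c.
Proof.
rewrite /circle_int Rintegral_cst; last exact: measurable_circle.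
have := lebesgue_measure_itv `[0 : R, 2 * pi]; rewrite /= lte_fin pi2_gt0 => E.
by rewrite /circle [X in fine X]E /= oppr0 addr0 mulrC.
Qed.

Lemma le_circle_int (R : realType) (f g : R -> R) :
  circle_integrable f -> circle_integrable g ->
  (forall t, circle t -> f t <= g t) ->
  circle_int f <= circle_int g.
Proof.
by move=> hf hg fg; apply: le_Rintegral => //; exact: measurable_circle.
Qed.

Lemma normr_circle_int_le (R : realType) (f g : R -> R) :
  circle_integrable f -> circle_integrable g ->
  (forall t, circle t -> `|f t| <= g t) ->
  `|circle_int f| <= circle_int g.
Proof.
move=> hf hg fg; apply: le_trans (le_normr_Rintegral _ hf) _.
  exact: measurable_circle.
apply: le_circle_int => //.
exact: integrable_norm.
Qed.

(** * Trigonometric integrals over the circle *)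

Lemma is_derive_sin_mul (R : realType) (k x : R) :
  is_derive x 1 (fun t => sin (k * t)) (k * cos (k * x)).
Proof.
have h : is_derive x 1 ( *%R k) k.
  by have := is_deriveZ k (is_derive_id x 1); rewrite /GRing.scale/= mulr1.
have := is_derive1_comp (is_derive_sin (k * x)) h.
by rewrite [_ * k]mulrC.
Qed.

Lemma is_derive_cos_mul (R : realType) (k x : R) :
  is_derive x 1 (fun t => cos (k * t)) (- (k * sin (k * x))).
Proof.
have h : is_derive x 1 ( *%R k) k.
  by have := is_deriveZ k (is_derive_id x 1); rewrite /GRing.scale/= mulr1.
have := is_derive1_comp (is_derive_cos (k * x)) h.
by rewrite mulNr [_ * k]mulrC.
Qed.

Lemma continuous_sin_mul (R : realType) (k : R) :
  continuous (fun t : R => sin (k * t)).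
Proof.
move=> x; apply: differentiable_continuous.
by apply/derivable1_diffP; case: (is_derive_sin_mul k x).
Qed.

Lemma continuous_cos_mul (R : realType) (k : R) :
  continuous (fun t : R => cos (k * t)).
Proof.
move=> x; apply: differentiable_continuous.
by apply/derivable1_diffP; case: (is_derive_cos_mul k x).
Qed.

Lemma Rintegral_FTC2 (R : realType) (f F : R -> R) (b : R) : 0 <= b ->
  continuous f -> (forall x : R, is_derive x 1 F (f x)) ->
  \int[lebesgue_measure]_(t in `[0, b]) f t = F b - F 0.
Proof.
rewrite le_eqVlt => /predU1P[<-|b0] cf dF.
  by rewrite set_itv1 Rintegral_set1 subrr.
rewrite /Rintegral (@continuous_FTC2 _ f F)//.
- exact: continuous_subspaceT.
- have cF x : {for x, continuous F}.
    apply: differentiable_continuous; apply/derivable1_diffP.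
    by case: (dF x).
  split.
  + by move=> x _; case: (dF x).
  + exact: cvg_at_right_filter (cF 0).
  + exact: cvg_at_left_filter (cF b).
- by move=> x _; rewrite derive1E; case: (dF x).
Qed.

Lemma cos_sin_int2pi (R : realType) (k : int) (t : R) :
  cos (k%:~R * (t + 2 * pi)) = cos (k%:~R * t) /\
  sin (k%:~R * (t + 2 * pi)) = sin (k%:~R * t).
Proof.
have H (n : nat) (x : R) : cos (x + n%:R * (2 * pi)) = cos x /\
    sin (x + n%:R * (2 * pi)) = sin x.
  rewrite mulr_natl (_ : 2 * pi = pi *+ 2); last by rewrite mulr_natl.
  by rewrite (periodicn (@cosD2pi R)) (periodicn (@sinD2pi R)).
rewrite mulrDr; case: k => n; first exact: H.
rewrite NegzE mulrNz; set y := - _ * t.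
have [hc hs] := H n.+1 (y - n.+1%:R * (2 * pi)).
rewrite subrK in hc hs; rewrite mulNr.
by split; [exact: esym hc|exact: esym hs].
Qed.

Lemma circle_int_cos (R : realType) (k : int) : k != 0 ->
  circle_int (fun t : R => cos (k%:~R * t)) = 0.
Proof.
move=> k0; have kR : k%:~R != 0 :> R by rewrite intr_eq0.
rewrite [LHS](@Rintegral_FTC2 _ _ (fun t => k%:~R^-1 * sin (k%:~R * t))).
- have [_] := cos_sin_int2pi k (0 : R).
  by rewrite add0r => ->; rewrite subrr.
- by rewrite ltW// pi2_gt0.
- exact: continuous_cos_mul.
- move=> x; have := is_deriveZ k%:~R^-1 (is_derive_sin_mul k%:~R x).
  by rewrite /GRing.scale/= mulrA mulVf// mul1r.
Qed.

Lemma circle_int_sin (R : realType) (k : int) :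
  circle_int (fun t : R => sin (k%:~R * t)) = 0.
Proof.
have [->|k0] := eqVneq k 0.
  under [X in circle_int X]eq_fun do rewrite mul0r sin0.
  by rewrite circle_int_cst mulr0.
have kR : k%:~R != 0 :> R by rewrite intr_eq0.
rewrite [LHS](@Rintegral_FTC2 _ _ (fun t => - k%:~R^-1 * cos (k%:~R * t))).
- have [+ _] := cos_sin_int2pi k (0 : R).
  by rewrite add0r => ->; rewrite subrr.
- by rewrite ltW// pi2_gt0.
- exact: continuous_sin_mul.
- move=> x; have := is_deriveZ (- k%:~R^-1) (is_derive_cos_mul k%:~R x).
  by rewrite /GRing.scale/= mulrNN mulrA mulVf// mul1r.
Qed.

(** Real form of a Fourier term: for c_n = a_n + i b_n the real and imaginary parts of c_n e^{int}
    are the harmonics of (a, -b) and of (b, a). Everything up to Fatou's theorem is carried out on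
    such real series. *)
Definition trig (R : realType) (a b : nat -> R) (n : nat) (t : R) : R :=
  a n * cos (n%:R * t) + b n * sin (n%:R * t).

Lemma continuous_trig (R : realType) (a b : nat -> R) n :
  continuous (trig a b n).
Proof.
move=> x; apply: cvgD; apply: cvgM; try exact: cvg_cst.
  exact: continuous_cos_mul.
exact: continuous_sin_mul.
Qed.

Lemma circle_int_cosM (R : realType) (n k : nat) :
  circle_int (fun t : R => cos (n%:R * t) * cos (k%:R * t)) =
  if n == k then (if n == 0%N then 2 * pi else pi) else 0.
Proof.
have E t : cos (n%:R * t) * cos (k%:R * t) =
    2^-1 * cos ((n%:Z - k%:Z)%:~R * t) + 2^-1 * cos ((n + k)%N%:Z%:~R * t) :> R.
  by rewrite intrB -!pmulrn natrD mulrBl mulrDl cosB cosD; field.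
under eq_fun do rewrite E.
have ci (j : int) : circle_integrable (fun t : R => cos (j%:~R * t)).
  exact/continuous_circle_integrable/continuous_cos_mul.
have I0 : circle_int (fun t : R => cos (0%:~R * t)) = 2 * pi.
  under [X in circle_int X]eq_fun do rewrite mul0r cos0.
  by rewrite circle_int_cst mulr1.
rewrite circle_intD; do ?exact: circle_integrableZ.
rewrite !circle_intZ//; have [->|nk] := eqVneq n k.
  rewrite subrr I0; have [->|k0] := eqVneq k 0%N; first by rewrite I0; field.
  by rewrite circle_int_cos ?mulr0 ?addr0; [field|rewrite -lt0n in k0 *; rewrite eqz_nat addn_eq0 negb_and -lt0n k0].
rewrite circle_int_cos ?mulr0 ?add0r; last by rewrite subr_eq0 eqz_nat.
rewrite circle_int_cos ?mulr0// eqz_nat addn_eq0; apply/negP => /andP[/eqP n0 /eqP k0].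
by move: nk; rewrite n0 k0.
Qed.

Lemma circle_int_sinM (R : realType) (n k : nat) :
  circle_int (fun t : R => sin (n%:R * t) * sin (k%:R * t)) =
  if n == k then (if n == 0%N then 0 else pi) else 0.
Proof.
have E t : sin (n%:R * t) * sin (k%:R * t) =
    2^-1 * cos ((n%:Z - k%:Z)%:~R * t) + - 2^-1 * cos ((n + k)%N%:Z%:~R * t) :> R.
  by rewrite intrB -!pmulrn natrD mulrBl mulrDl cosB cosD; field.
under eq_fun do rewrite E.
have ci (j : int) : circle_integrable (fun t : R => cos (j%:~R * t)).
  exact/continuous_circle_integrable/continuous_cos_mul.
have I0 : circle_int (fun t : R => cos (0%:~R * t)) = 2 * pi.
  under [X in circle_int X]eq_fun do rewrite mul0r cos0.
  by rewrite circle_int_cst mulr1.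
rewrite circle_intD; do ?exact: circle_integrableZ.
rewrite !circle_intZ//; have [->|nk] := eqVneq n k.
  rewrite subrr I0; have [->|k0] := eqVneq k 0%N; first by rewrite I0; field.
  by rewrite circle_int_cos ?mulr0 ?addr0; [field|rewrite -lt0n in k0 *; rewrite eqz_nat addn_eq0 negb_and -lt0n k0].
rewrite circle_int_cos ?mulr0 ?add0r; last by rewrite subr_eq0 eqz_nat.
rewrite circle_int_cos ?mulr0// eqz_nat addn_eq0; apply/negP => /andP[/eqP n0 /eqP k0].
by move: nk; rewrite n0 k0.
Qed.

Lemma circle_int_cos_sin (R : realType) (n k : nat) :
  circle_int (fun t : R => cos (n%:R * t) * sin (k%:R * t)) = 0.
Proof.
have E t : cos (n%:R * t) * sin (k%:R * t) =
    2^-1 * sin ((k%:Z - n%:Z)%:~R * t) + 2^-1 * sin ((n + k)%N%:Z%:~R * t) :> R.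
  by rewrite intrB -!pmulrn natrD mulrBl mulrDl sinB sinD; field.
under eq_fun do rewrite E.
have ci (j : int) : circle_integrable (fun t : R => sin (j%:~R * t)).
  exact/continuous_circle_integrable/continuous_sin_mul.
rewrite circle_intD; do ?exact: circle_integrableZ.
by rewrite !circle_intZ// !circle_int_sin mulr0 addr0.
Qed.

(** * Riesz-Fischer for trigonometric series *)

Lemma cvg_EFin_seq (R : realType) (u : nat -> R) (l : R) :
  u @ \oo --> l -> (u n)%:E @[n --> \oo] --> l%:E.
Proof. by move=> ul; apply: cvg_EFin => //; near=> n. Unshelve. all: by end_near. Qed.

(** Cauchy-Schwarz with the weights 2^-k and 2^k; the factor 2 bounds the geometric sum of the 2^-k.
    The induction carries that sum as [c K] in place of 2. *)
Lemma sqr_sum_le_weighted (R : realType) (d : nat -> R) K :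
  (\sum_(k < K) d k) ^+ 2 <= 2 * \sum_(k < K) 2 ^+ k * d k ^+ 2.
Proof.
pose c K : R := \sum_(k < K) (2 ^+ k)^-1.
have c0 n : 0 <= c n by rewrite sumr_ge0// => i _; rewrite invr_ge0 exprn_ge0.
have c2 n : c n <= 2.
  suff : c n = 2 - 2 * (2 ^+ n)^-1.
    by move=> ->; rewrite gerBl mulr_ge0// invr_ge0 exprn_ge0.
  elim: n => [|n IH]; first by rewrite /c big_ord0 expr0 invr1 mulr1 subrr.
  rewrite /c big_ord_recr/= -/(c n) IH exprS invfM.
  by field; rewrite expf_neq0.
have B0 n : 0 <= \sum_(k < n) 2 ^+ k * d k ^+ 2.
  by rewrite sumr_ge0// => i _; rewrite mulr_ge0 ?sqr_ge0// exprn_ge0.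
apply: (@le_trans _ _ (c K * \sum_(k < K) 2 ^+ k * d k ^+ 2)); last first.
  exact: ler_wpM2r.
elim: K => [|K IH]; first by rewrite /c !big_ord0 expr0n mul0r.
rewrite /c !big_ord_recr/= -/(c K).
set s := \sum_(k < K) d k in IH *; set B := \sum_(k < K) _ in IH *.
have e0 : 0 < 2 ^+ K :> R by rewrite exprn_gt0.
set e := 2 ^+ K in e0 *; set x := d K.
have c0K := c0 K; have BK : 0 <= B := B0 K.
set C := c K in IH c0K *.
(* The cross term of the new square, by the arithmetic-geometric mean inequality: s^2 <= C B gives
   (2 s x)^2 <= 4 (C e x^2) (B / e). *)
have key : 2 * (s * x) <= C * (e * x ^+ 2) + e^-1 * B.
  have h0 : 0 <= C * (e * x ^+ 2) + e^-1 * B.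
    apply: addr_ge0; apply: mulr_ge0 => //; last by rewrite invr_ge0 ltW.
    by rewrite mulr_ge0 ?sqr_ge0// ltW.
  apply: le_trans (ler_norm _) _.
  rewrite -(@ler_pXn2r _ 2) ?nnegrE// real_normK ?num_real//.
  apply: (@le_trans _ _ (4 * (C * (e * x ^+ 2)) * (e^-1 * B))).
    rewrite (_ : 4 * _ * _ = 4 * x ^+ 2 * (C * B)); last by field; rewrite gt_eqF.
    rewrite (_ : (2 * (s * x)) ^+ 2 = 4 * x ^+ 2 * s ^+ 2); last by ring.
    by rewrite ler_wpM2l// mulr_ge0// sqr_ge0.
  rewrite -subr_ge0 (_ : _ - _ = (C * (e * x ^+ 2) - e^-1 * B) ^+ 2); last by ring.
  exact: sqr_ge0.
rewrite -subr_ge0 (_ : _ - _ = (C * B - s ^+ 2) +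
  (C * (e * x ^+ 2) + e^-1 * B - 2 * (s * x))); last by field; rewrite gt_eqF.
by rewrite addr_ge0// subr_ge0.
Qed.

(** Termwise 2 |d_n| <= 2^-n + 2^n d_n^2, so |d_n| is dominated by a geometric series plus the given
    one. *)
Lemma cvg_series_weighted (R : realType) (d : nat -> R) :
  cvgn (series (fun k => 2 ^+ k * d k ^+ 2)) -> cvgn (series d).
Proof.
move=> h; apply: normed_cvg.
have g : cvgn (series (geometric (1 : R) 2^-1)).
  by apply: is_cvg_geometric_series; rewrite ger0_norm ?invr_ge0// invf_lt1// ltr1n.
apply: (@series_le_cvg _ _ (fun n => 1 * 2^-1 ^+ n + 2 ^+ n * d n ^+ 2) _ _ _
  (is_cvg_seriesD g h)) => n.
- exact: normr_ge0.
- by apply: addr_ge0; apply: mulr_ge0; rewrite ?sqr_ge0 ?exprn_ge0 ?invr_ge0.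
rewrite /= mul1r exprVn; set e := 2 ^+ n.
have e0 : 0 < e by rewrite exprn_gt0.
rewrite -(real_normK (num_real (d n))); set x := `|d n|.
have x0 : 0 <= x by exact: normr_ge0.
apply: (@le_trans _ _ (2 * x)); first by rewrite ler_peMl// ler1n.
rewrite -subr_ge0 (_ : _ - _ = e * (e^-1 - x) ^+ 2); last by field; rewrite gt_eqF.
by rewrite mulr_ge0 ?sqr_ge0// ltW.
Qed.

Lemma continuous_measurable_circle (R : realType) (f : R -> R) :
  continuous f -> @measurable_fun _ _ (measurableTypeR R) R (@circle R) f.
Proof.
move=> cf; apply: subspace_continuous_measurable_fun; first exact: measurable_circle.
exact: continuous_subspaceT.
Qed.

(* A subsequence of partial sums chosen so that consecutive squared distances
   decay like 4^-k converges a.e., and its squares are dominated by the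
   integrable function 2 * \sum_k 2^k d_k^2. *)
Lemma riesz_fischer_circle (R : realType) (u : nat -> R -> R) (C : R) :
  (forall k, continuous (u k)) -> (forall t, u 0%N t = 0) ->
  (forall k, circle_int (fun t => (u k.+1 t - u k t) ^+ 2) <= C * (4 ^+ k)^-1) ->
  exists (f : R -> R) (g : R -> \bar R),
  [/\ @measurable_fun _ _ (measurableTypeR R) R (@circle R) f,
      (@lebesgue_measure R).-integrable (@circle R) g,
      {ae @lebesgue_measure R, forall t, circle t -> u k t @[k --> \oo] --> f t} &
      forall k t, ((u k t ^+ 2)%:E <= g t)%E].
Proof.
move=> cu u0 hu.
pose d k t := u k.+1 t - u k t.
have dE K t : \sum_(k < K) d k t = u K t.
  elim: K => [|K IH]; first by rewrite big_ord0 u0.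
  by rewrite big_ord_recr/= IH /d addrC subrK.
have cd k : continuous (fun t => d k t ^+ 2).
  by move=> t; apply: (@continuousM _ _ (d k) (d k)); apply: cvgB; exact: cu.
pose w k t : R := 2 ^+ k * d k t ^+ 2.
have w0 k t : 0 <= w k t by rewrite mulr_ge0 ?sqr_ge0 ?exprn_ge0.
have cw k : continuous (w k).
  by move=> t; apply: cvgM; [exact: cvg_cst|exact: cd].
pose W t : \bar R := (\sum_(k <oo) (w k t)%:E)%E.
have mw k : @measurable_fun _ _ (measurableTypeR R) _ (@circle R) (fun t => (w k t)%:E).
  by apply/measurable_EFinP; exact: continuous_measurable_circle.
have W0 t : (0 <= W t)%E by apply: nneseries_ge0 => k _ _; rewrite lee_fin.
have iW : (@lebesgue_measure R).-integrable (@circle R) W.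
  apply/integrableP; split.
    by apply: ge0_emeasurable_sum => // k t _ _; rewrite lee_fin.
  under eq_integral do rewrite gee0_abs//.
  rewrite integral_nneseries//; last 2 first.
  - exact: measurable_circle.
  - by move=> k t _; rewrite lee_fin.
  have E k : (\int[lebesgue_measure]_(t in @circle R) (w k t)%:E)%E =
      (circle_int (w k))%:E.
    rewrite /circle_int /Rintegral fineK//; apply: integrable_fin_num.
      exact: measurable_circle.
    exact: continuous_circle_integrable.
  rewrite (eq_eseriesr (fun k _ => E k)).
  have wC k : circle_int (w k) <= `|C| * 2^-1 ^+ k.
    rewrite /w circle_intZ; last exact: continuous_circle_integrable.
    apply: le_trans (ler_wpM2l _ (hu k)) _; first by rewrite exprn_ge0.
    rewrite mulrCA (_ : 2 ^+ k * (4 ^+ k)^-1 = 2^-1 ^+ k); last first.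
      rewrite (_ : 4 = 2 * 2) ?exprMn ?invfM ?exprVn; last by ring.
      by rewrite mulrA divff ?mul1r// expf_neq0.
    by rewrite ler_wpM2r ?ler_norm// exprn_ge0// invr_ge0.
  apply: (@le_lt_trans _ _ (\sum_(k <oo) (`|C| * 2^-1 ^+ k)%:E)%E).
    by apply: lee_nneseries => k _; rewrite lee_fin// Rintegral_ge0.
  have g : series (geometric `|C| (2^-1 : R)) @ \oo --> `|C| / (1 - 2^-1).
    by apply: cvg_geometric_series; rewrite ger0_norm ?invr_ge0// invf_lt1// ltr1n.
  rewrite (_ : (\sum_(k <oo) _)%E = (`|C| / (1 - 2^-1))%:E) ?ltry//.
  apply/cvg_lim => //.
  under eq_fun do rewrite sumEFin.
  exact: cvg_EFin_seq g.
(* A limit superior of measurable functions is measurable everywhere, and it agrees with the limit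
   wherever the sequence converges. *)
pose f t := fine (limn_esup (fun k => (u k t)%:E)).
exists f, (fun t => 2%:E * W t)%E; split.
- apply: (measurableT_comp (fine_measurable _)) => //.
  apply: measurable_fun_limn_esup => k; apply/measurable_EFinP.
  exact: continuous_measurable_circle.
- by apply: integrableZl => //; exact: measurable_circle.
- have := integrable_ae (@measurable_circle R) iW.
  apply: filterS => t h /h Wt.
  have /cvg_series_weighted/cvg_ex[l hl] : cvgn (series (w ^~ t)).
    by apply: nnseries_is_cvg => //; rewrite -ge0_fin_numE// W0.
  have ul : u k t @[k --> \oo] --> l.
    move: hl; rewrite (_ : series _ = fun k => u k t)//.
    by apply/funext => k; rewrite seriesEord/= dE.
  rewrite /f (_ : limn_esup _ = l%:E)//.
  by apply: (cvg_limn_einf_sup _).2; exact: cvg_EFin_seq.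
- move=> k t; apply: (@le_trans _ _ (2 * \sum_(j < k) w j t)%:E).
    by rewrite lee_fin; have := sqr_sum_le_weighted (d ^~ t) k; rewrite dE.
  rewrite EFinM lee_pmul2l// -sumEFin -(big_mkord xpredT (fun j => (w j t)%:E)).
  by apply: nneseries_lim_ge => j _ _; rewrite lee_fin.
Qed.

(** Normalized so that pi times it is the integral of the squared n-th harmonic: at n = 0 the
    squared cosine integrates to 2 pi instead of pi and the sine vanishes, so b_0 drops out. *)
Definition energy (R : realType) (a b : nat -> R) (n : nat) : R :=
  if n == 0%N then 2 * a n ^+ 2 else a n ^+ 2 + b n ^+ 2.

Lemma energy_ge0 (R : realType) (a b : nat -> R) n : 0 <= energy a b n.
Proof.
rewrite /energy; case: ifP => _; first by rewrite mulr_ge0// sqr_ge0.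
by rewrite addr_ge0 ?sqr_ge0.
Qed.

Lemma circle_int_trigM (R : realType) (a b c d : nat -> R) n k :
  circle_int (fun t => trig a b n t * trig c d k t) =
  if n == k then pi * (if n == 0%N then 2 * (a n * c n) else a n * c n + b n * d n)
  else 0.
Proof.
rewrite /trig.
have E t : (a n * cos (n%:R * t) + b n * sin (n%:R * t)) *
    (c k * cos (k%:R * t) + d k * sin (k%:R * t)) =
    (a n * c k) * (cos (n%:R * t) * cos (k%:R * t)) +
    ((a n * d k) * (cos (n%:R * t) * sin (k%:R * t)) +
    ((b n * c k) * (cos (k%:R * t) * sin (n%:R * t)) +
     (b n * d k) * (sin (n%:R * t) * sin (k%:R * t)))) by ring.
under eq_fun do rewrite E.
have cc i j : circle_integrable (fun t : R => cos (i%:R * t) * cos (j%:R * t)).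
  apply: continuous_circle_integrable => t.
  by apply: cvgM; exact: continuous_cos_mul.
have cs i j : circle_integrable (fun t : R => cos (i%:R * t) * sin (j%:R * t)).
  apply: continuous_circle_integrable => t.
  by apply: cvgM; [exact: continuous_cos_mul|exact: continuous_sin_mul].
have ss i j : circle_integrable (fun t : R => sin (i%:R * t) * sin (j%:R * t)).
  apply: continuous_circle_integrable => t.
  by apply: cvgM; exact: continuous_sin_mul.
rewrite !circle_intD; do ?[exact: circle_integrableZ|apply: circle_integrableD].
rewrite !circle_intZ// !circle_int_cos_sin circle_int_cosM circle_int_sinM.
case: eqVneq => [->|_]; last by rewrite !mulr0 !addr0.
by case: ifP => _; ring.
Qed.

Definition trig_sum (R : realType) (a b : nat -> R) (N : nat) (t : R) : R :=
  \sum_(n < N) trig a b n t.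

Lemma continuous_trig_sum (R : realType) (a b : nat -> R) N :
  continuous (trig_sum a b N).
Proof.
rewrite /trig_sum; elim: N => [|N IH] t.
  by under eq_fun do rewrite big_ord0; exact: cvg_cst.
under eq_fun do rewrite big_ord_recr/=.
by apply: cvgD; [exact: IH|exact: continuous_trig].
Qed.

Lemma circle_int_sqr_trig_sum (R : realType) (a b : nat -> R) N :
  circle_int (fun t => trig_sum a b N t ^+ 2) = pi * \sum_(n < N) energy a b n.
Proof.
rewrite /trig_sum; elim: N => [|N IH].
  under eq_fun do rewrite big_ord0 expr0n/=.
  by rewrite big_ord0 circle_int_cst !mulr0.
have E t : (\sum_(n < N.+1) trig a b n t) ^+ 2 =
    (\sum_(n < N) trig a b n t) ^+ 2 +
    (2 * \sum_(n < N) (trig a b n t * trig a b N t) + trig a b N t * trig a b N t).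
  by rewrite big_ord_recr/= -mulr_suml; ring.
under eq_fun do rewrite E.
have i1 n k : circle_integrable (fun t => trig a b n t * trig a b k t).
  apply: continuous_circle_integrable => t.
  by apply: cvgM; exact: continuous_trig.
have i2 : circle_integrable (fun t => (\sum_(n < N) trig a b n t) ^+ 2).
  apply: continuous_circle_integrable => t.
  by apply: (@continuousM _ _ (trig_sum a b N) (trig_sum a b N)); exact: continuous_trig_sum.
have i3 : circle_integrable (fun t => \sum_(n < N) trig a b n t * trig a b N t).
  exact: (circle_integrable_sum (F := fun n t => trig a b n t * trig a b N t)).
rewrite circle_intD ?circle_intD ?circle_intZ//; last 2 first.
- exact: circle_integrableZ.
- by apply: circle_integrableD => //; exact: circle_integrableZ.
rewrite IH (circle_int_sum (F := fun n t => trig a b n t * trig a b N t))//.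
rewrite [X in 2 * X]big1 ?mulr0; last first.
  by move=> i _; rewrite circle_int_trigM ltn_eqF.
rewrite circle_int_trigM eqxx big_ord_recr/= mulrDr add0r; congr (_ + _ * _).
Qed.

(** For k >= 1 the index phi k lies beyond the point where the tail of the series drops below 4^-k.
    The start phi 0 = 0 makes the selected partial sums begin at 0, and C = 1 + l absorbs the first
    block, which is bounded only by the whole sum l. *)
Lemma fast_subsequence (R : realType) (e : nat -> R) :
  (forall n, 0 <= e n) -> cvgn (series e) ->
  exists phi : nat -> nat, exists C : R,
  [/\ phi 0%N = 0%N, (forall k, (k <= phi k)%N), (forall k, (phi k <= phi k.+1)%N) &
   forall k, \sum_(phi k <= n < phi k.+1) e n <= C * (4 ^+ k)^-1].
Proof.
move=> e0 he; set l := limn (series e).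
have nde : nondecreasing_seq (series e).
  by apply/nondecreasing_seqP => n; rewrite !seriesEnat/= big_nat_recr//= lerDl.
have el n : series e n <= l by exact: nondecreasing_cvgn_le.
have /choice[N hN] : forall k, exists N, forall n, (N <= n)%N ->
    l - series e n <= (4 ^+ k)^-1.
  move=> k; have k0 : 0 < (4 ^+ k)^-1 :> R by rewrite invr_gt0 exprn_gt0.
  move/cvgrPdist_le : he => /(_ _ k0)[N _ h]; exists N => n Nn.
  by apply: le_trans (h n Nn); exact: ler_norm.
pose phi := nat_rect (fun=> nat) 0%N (fun k p => maxn (maxn p (N k.+1)) k.+1).
have phiS k : phi k.+1 = maxn (maxn (phi k) (N k.+1)) k.+1 by [].
exists phi, (1 + l); split => //.
- by case=> [//|k]; rewrite phiS leq_maxr.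
- by move=> k; rewrite phiS -maxnA leq_maxl.
move=> k.
have h : (phi k <= phi k.+1)%N by rewrite phiS -maxnA leq_maxl.
have -> : \sum_(phi k <= n < phi k.+1) e n = series e (phi k.+1) - series e (phi k).
  by rewrite !seriesEnat/= (big_cat_nat (n := phi k) (m := 0))//= addrAC subrr add0r.
have l0 : 0 <= l by apply: le_trans (el 0%N); rewrite seriesEnat/= big_geq.
apply: (@le_trans _ _ (l - series e (phi k))); first by rewrite lerB.
case: k {h} => [|k].
  by rewrite expr0 invr1 mulr1 seriesEnat/= big_geq// subr0 lerDr.
have Nk : (N k.+1 <= phi k.+1)%N by rewrite phiS maxnAC leq_maxr.
apply: le_trans (hN _ _ Nk) _.
by rewrite ler_peMl ?invr_ge0 ?exprn_ge0// lerDl.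
Qed.

Lemma cvg_comp_subseq (T : topologicalType) (u : nat -> T) (l : T) (phi : nat -> nat) :
  (forall k, (k <= phi k)%N) -> u @ \oo --> l -> u (phi k) @[k --> \oo] --> l.
Proof.
move=> hphi ul; apply: (@cvg_comp _ _ _ phi u _ \oo _ _ ul) => A [N _ hN].
by exists N => // k /= Nk; apply: hN => /=; exact: leq_trans (hphi k).
Qed.

(** The convergence of the integrals over every [0, x] determines the primitive of f, although f
    itself comes from a subsequence. Dominated convergence is applied to the squares for Parseval's
    identity, to the sums for the integrability of f, and again on [0, x]. *)
Lemma trig_boundary (R : realType) (a b : nat -> R) :
  cvgn (series (energy a b)) ->
  exists f : R -> R, exists phi : nat -> nat,
  [/\ circle_integrable f, circle_integrable (fun t => f t ^+ 2),
      circle_int (fun t => f t ^+ 2) = pi * limn (series (energy a b)),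
      (forall k, (k <= phi k)%N) &
      forall x, 0 <= x <= 2 * pi ->
        \int[lebesgue_measure]_(t in `[0, x]) trig_sum a b (phi k) t @[k --> \oo]
        --> \int[lebesgue_measure]_(t in `[0, x]) f t].
Proof.
move=> h; have [phi [C [phi0 phik phiS phiC]]] := fast_subsequence (@energy_ge0 _ a b) h.
pose u k t := trig_sum a b (phi k) t.
have cu k : continuous (u k) by exact: continuous_trig_sum.
have [||k|f [g [mf ig uf ug]]] := @riesz_fischer_circle R u (pi * C).
- exact: cu.
- by move=> t; rewrite /u phi0 /trig_sum big_ord0.
- pose a' n := if (phi k <= n)%N then a n else 0.
  pose b' n := if (phi k <= n)%N then b n else 0.
  have E t : u k.+1 t - u k t = trig_sum a' b' (phi k.+1) t.
    rewrite /u /trig_sum -(big_mkord xpredT (trig a b ^~ t)).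
    rewrite -[X in _ - X](big_mkord xpredT (trig a b ^~ t)).
    rewrite -(big_mkord xpredT (trig a' b' ^~ t)).
    rewrite (big_cat_nat (n := phi k))//= [RHS](big_cat_nat (n := phi k))//=.
    rewrite addrAC subrr add0r [X in _ = X + _]big1_seq ?add0r.
      by apply: eq_big_nat => n /andP[kn _]; rewrite /trig /a' /b' kn.
    move=> n /andP[_]; rewrite mem_index_iota => /andP[_ nk].
    by rewrite /trig /a' /b' leqNgt nk/= !mul0r addr0.
  under eq_fun do rewrite E.
  rewrite circle_int_sqr_trig_sum -mulrA ler_wpM2l ?pi_ge0//.
  apply: le_trans (phiC k); rewrite -(big_mkord xpredT (energy a' b')).
  rewrite (big_cat_nat (n := phi k))//= [X in X + _]big1_seq ?add0r.
    by apply: ler_sum_nat => n /andP[kn _]; rewrite /energy /a' /b' kn.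
  move=> n /andP[_]; rewrite mem_index_iota => /andP[_ nk].
  by rewrite /energy /a' /b' leqNgt nk/= expr0n mulr0 addr0 if_same.
have mu2 k : @measurable_fun _ _ (measurableTypeR R) _ (@circle R) (fun t => (u k t ^+ 2)%:E).
  apply/measurable_EFinP; apply: measurable_funX.
  exact: continuous_measurable_circle.
have mf2 : @measurable_fun _ _ (measurableTypeR R) _ (@circle R) (fun t => (f t ^+ 2)%:E).
  by apply/measurable_EFinP; exact: measurable_funX.
have [] := dominated_convergence (@measurable_circle R) mu2 mf2 _ ig _.
- apply: (lebesgue_ae_imply uf) => t ut0 ct; have ut := ut0 ct.
  by apply: cvg_EFin_seq; under eq_fun do rewrite expr2; rewrite expr2; exact: cvgM.
- apply: aeW => t k _; rewrite gee0_abs ?lee_fin ?sqr_ge0//; exact: ug.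
move=> if2 _ cf2.
(* Since |y| <= 1 + y^2, the bound g on the squares yields the bound 1 + g on the sums themselves,
   integrable because the circle has finite measure. *)
pose g1 t : \bar R := (1 + g t)%E.
have ig1 : (@lebesgue_measure R).-integrable (@circle R) g1.
  apply: integrableD => //; first exact: measurable_circle.
  exact: (continuous_circle_integrable (f := fun=> 1) (fun=> cvg_cst _)).
have sq1 (y : R) : `|y| <= 1 + y ^+ 2.
  rewrite -(real_normK (num_real y)); set x := `|y|.
  rewrite -subr_ge0 (_ : _ - _ = (x - 2^-1) ^+ 2 + 3/4); last by field.
  by rewrite addr_ge0 ?sqr_ge0.
have mu1 k : @measurable_fun _ _ (measurableTypeR R) _ (@circle R) (fun t => (u k t)%:E).
  by apply/measurable_EFinP; exact: continuous_measurable_circle.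
have ug1 k t : (`|(u k t)%:E| <= g1 t)%E.
  apply: (@le_trans _ _ (1 + u k t ^+ 2)%:E); first by rewrite lee_fin.
  by rewrite EFinD leeD2l.
have [] := dominated_convergence (@measurable_circle R) mu1 (f := EFin \o f) _ _ ig1 _.
- by apply/measurable_EFinP.
- by apply: (lebesgue_ae_imply uf) => t ut0 ct; have ut := ut0 ct; exact: cvg_EFin_seq.
- by apply: aeW => t k _; exact: ug1.
move=> if1 _ _.
exists f, phi; split => //.
- have c1 : circle_int (fun t => u k t ^+ 2) @[k --> \oo] --> circle_int (fun t => f t ^+ 2).
    apply: fine_cvg; rewrite fineK; first exact: cf2.
    exact: (integrable_fin_num (@measurable_circle R) if2).
  apply: (cvg_unique _ c1) => //=.
  have E k : circle_int (fun t => u k t ^+ 2) = pi * series (energy a b) (phi k).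
    by rewrite circle_int_sqr_trig_sum seriesEord.
  under eq_fun do rewrite E.
  apply: cvgM; first exact: cvg_cst.
  exact: (cvg_comp_subseq phik).
move=> x /andP[x0 x2].
have sub : `[0, x]%classic `<=` @circle R.
  by move=> t; rewrite /circle /= !in_itv/= => /andP[-> tx]; exact: le_trans x2.
have mx : @measurable _ (measurableTypeR R) `[0, x]%classic by exact: measurable_itv.
have [] := dominated_convergence mx (f_ := fun k t => (u k t)%:E) (f := EFin \o f)
  (g := g1) (mu := @lebesgue_measure R).
- by move=> k; apply: measurable_funS (mu1 k) => //; exact: measurable_circle.
- apply/measurable_EFinP; apply: measurable_funS mf => //; exact: measurable_circle.
- by apply: (lebesgue_ae_imply uf) => t ut0 /sub ct; have ut := ut0 ct; exact: cvg_EFin_seq.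
- by apply: (integrableS _ mx sub ig1); exact: measurable_circle.
- by apply: aeW => t k _; exact: ug1.
move=> ifx _ cfx.
apply: fine_cvg; rewrite fineK; first exact: cfx.
exact: (integrable_fin_num mx ifx).
Qed.

(** * The differentiated Poisson kernel and Fatou's theorem *)

(** With q the square root of r, n q^n stays below 1 / (1 - q), and the remaining factor q^n tends
    to 0. *)
Lemma cvg_expr_mul_nat (R : realType) (r : R) : 0 <= r < 1 ->
  n%:R * r ^+ n @[n --> \oo] --> (0 : R).
Proof.
move=> /andP[r0 r1]; pose q := Num.sqrt r.
have q0 : 0 <= q by exact: sqrtr_ge0.
have q1 : q < 1 by rewrite -sqrtr1 ltr_sqrt.
have rq : r = q ^+ 2 by rewrite sqr_sqrtr.
have B n : n%:R * q ^+ n <= (1 - q)^-1.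
  rewrite -[leRHS]mul1r ler_pdivlMr ?subr_gt0//.
  apply: (@le_trans _ _ (1 - q ^+ n)); last by rewrite gerBl exprn_ge0.
  elim: n => [|n IH]; first by rewrite expr0 !mul0r subrr.
  have E : n.+1%:R * q ^+ n.+1 * (1 - q) = q * (n%:R * q ^+ n * (1 - q)) + q ^+ n.+1 * (1 - q).
    by rewrite -natr1 exprS; ring.
  rewrite E; apply: (@le_trans _ _ (q * (1 - q ^+ n) + q ^+ n.+1 * (1 - q))).
    by rewrite lerD2r ler_wpM2l.
  rewrite -subr_ge0 (_ : _ - _ = (1 - q) * (1 - q ^+ n.+1)); last by rewrite exprS; ring.
  by apply: mulr_ge0; rewrite subr_ge0; [exact: ltW|apply: exprn_ile1 => //; exact: ltW].
apply: (@squeeze_cvgr _ _ _ _ (fun=> 0) (fun n => (1 - q)^-1 * q ^+ n)).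
- near=> n; rewrite mulr_ge0 ?exprn_ge0//= rq -exprM mulnC mulnSr muln1 exprD mulrA.
  by rewrite ler_wpM2r ?exprn_ge0.
- exact: cvg_cst.
- rewrite -[X in _ --> X](mulr0 (1 - q)^-1); apply: cvgM; first exact: cvg_cst.
  by apply: cvg_expr; rewrite ger0_norm.
Unshelve. all: by end_near. Qed.

(** This is |1 - w|^2 at w = r e^{is}. *)
Definition poisson_den (R : realType) (r s : R) : R :=
  (1 - r * cos s) ^+ 2 + (r * sin s) ^+ 2.

(* Minus half the derivative of the Poisson kernel:
   \sum_n n r^n sin (n s), the imaginary part of w / (1 - w)^2 at w = r e^{is}. *)
Definition dpoisson (R : realType) (r s : R) : R :=
  r * (1 - r ^+ 2) * sin s / poisson_den r s ^+ 2.

Lemma poisson_denE (R : realType) (r s : R) :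
  poisson_den r s = (1 - r) ^+ 2 + 2 * r * (1 - cos s).
Proof.
rewrite /poisson_den exprMn sin2cos2; ring.
Qed.

Lemma poisson_den_ge (R : realType) (r s : R) : 0 <= r ->
  (1 - r) ^+ 2 <= poisson_den r s.
Proof.
by move=> r0; rewrite poisson_denE lerDl !mulr_ge0// subr_ge0 cos_le1.
Qed.

Lemma poisson_den_gt0 (R : realType) (r s : R) : 0 <= r < 1 -> 0 < poisson_den r s.
Proof.
move=> /andP[r0 r1]; apply: lt_le_trans (poisson_den_ge s r0).
by rewrite exprn_gt0// subr_gt0.
Qed.

(** At w = r e^{is} the sum of k w^k over k < n equals (w + w^n p) / (1 - w)^2 with p = -n + (n - 1)
    w. The imaginary part of the first summand is the kernel and the second is the error; its
    numerator is at most (13 + 14) n r^n, well below 36 n r^n. *)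
Lemma dpoisson_sum_bound (R : realType) (r s : R) (M : nat) : 0 <= r < 1 ->
  `|dpoisson r s - \sum_(n < M.+1) n%:R * r ^+ n * sin (n%:R * s)| <=
  (M.+1%:R * r ^+ M.+1) * (36 / (1 - r) ^+ 4).
Proof.
have : (0 < M.+1)%N by [].
move: M.+1 => {}M M0 /[dup] r01 /andP[r0 r1].
pose c := cos s; pose v := sin s; pose Cm n := cos (n%:R * s); pose Sm n := sin (n%:R * s).
have CS n : Cm n.+1 = Cm n * c - Sm n * v.
  by rewrite /Cm -natr1 mulrDl mul1r cosD.
have SS n : Sm n.+1 = Sm n * c + Cm n * v.
  by rewrite /Sm -natr1 mulrDl mul1r sinD.
(* q1 + i q2 is the square of the conjugate of 1 - w, p1 + i p2 is the factor p, and u1 + i u2 is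
   their product; multiplying by |1 - w|^4 clears the denominator, so that the closed form follows
   by induction with ring identities only. *)
pose q1 := (1 - r * c) ^+ 2 - (r * v) ^+ 2; pose q2 := 2 * (1 - r * c) * (r * v).
pose p1 (n : nat) := - n%:R + (n%:R - 1) * (r * c); pose p2 (n : nat) := (n%:R - 1) * (r * v).
pose u1 n := p1 n * q1 - p2 n * q2; pose u2 n := p1 n * q2 + p2 n * q1.
have key n : poisson_den r s ^+ 2 * \sum_(k < n) k%:R * r ^+ k * Sm k =
    r * v * (1 - (r * c) ^+ 2 - (r * v) ^+ 2) + r ^+ n * (Cm n * u2 n + Sm n * u1 n).
  rewrite /u1 /u2 /p1 /p2 /q1 /q2 /poisson_den -/c -/v; elim: n => [|n IH].
    by rewrite big_ord0 /Cm /Sm !mul0r cos0 sin0; ring.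
  by rewrite big_ord_recr/= mulrDr IH CS SS -natr1 (exprS r n); ring.
have cv1 : (r * c) ^+ 2 + (r * v) ^+ 2 = r ^+ 2.
  by rewrite !exprMn -mulrDr cos2Dsin2 mulr1.
have d0 := poisson_den_gt0 s r01.
have {}key : dpoisson r s - \sum_(n < M) n%:R * r ^+ n * Sm n =
    - (r ^+ M * (Cm M * u2 M + Sm M * u1 M)) / poisson_den r s ^+ 2.
  apply: (@mulfI _ (poisson_den r s ^+ 2)); first by rewrite expf_neq0// gt_eqF.
  rewrite mulrBr key /dpoisson -(mulrC (poisson_den _ _ ^+ 2)^-1) mulVKf ?expf_neq0 ?gt_eqF//.
  rewrite -(mulrC (poisson_den _ _ ^+ 2)^-1) mulVKf ?expf_neq0 ?gt_eqF//.
  by rewrite -cv1 -/v; ring.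
rewrite key normrM normrN normrM ger0_norm ?exprn_ge0// normfV.
rewrite (ger0_norm (sqr_ge0 _)).
have cb : `|c| <= 1 by exact: cos_max.
have vb : `|v| <= 1 by exact: sin_max.
have rcb : `|r * c| <= 1 by rewrite normrM mulr_ile1// ger0_norm// ltW.
have rvb : `|r * v| <= 1 by rewrite normrM mulr_ile1// ger0_norm// ltW.
have q1b : `|q1| <= 5.
  move: rcb rvb; rewrite !ler_norml => /andP[? ?] /andP[? ?].
  apply/andP; split; rewrite /q1; nra.
have q2b : `|q2| <= 4.
  move: rcb rvb; rewrite !ler_norml => /andP[? ?] /andP[? ?].
  apply/andP; split; rewrite /q2; nra.
have M1 : 1 <= M%:R :> R by rewrite ler1n.
have p1b : `|p1 M| <= 2 * M%:R.
  move: rcb; rewrite !ler_norml => /andP[? ?].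
  apply/andP; split; rewrite /p1; nra.
have p2b : `|p2 M| <= M%:R.
  move: rvb; rewrite !ler_norml => /andP[? ?].
  apply/andP; split; rewrite /p2; nra.
have u1b : `|u1 M| <= 14 * M%:R.
  apply: le_trans (ler_normB _ _) _.
  rewrite (_ : 14 * _ = 2 * M%:R * 5 + M%:R * 4); last by ring.
  by apply: lerD; rewrite normrM; exact: ler_pM.
have u2b : `|u2 M| <= 13 * M%:R.
  apply: le_trans (ler_normD _ _) _.
  rewrite (_ : 13 * _ = 2 * M%:R * 4 + M%:R * 5); last by ring.
  by apply: lerD; rewrite normrM; exact: ler_pM.
rewrite (mulrC M%:R) -!mulrA ler_wpM2l ?exprn_ge0//.
rewrite [leRHS]mulrA; apply: ler_pM => //.
- by rewrite invr_ge0 sqr_ge0.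
- apply: le_trans (ler_normD _ _) _; rewrite !normrM.
  have : `|Cm M| * `|u2 M| <= 1 * (13 * M%:R) by apply: ler_pM => //; exact: cos_max.
  have : `|Sm M| * `|u1 M| <= 1 * (14 * M%:R) by apply: ler_pM => //; exact: sin_max.
  lra.
- rewrite lef_pV2 ?posrE ?exprn_gt0 ?subr_gt0//.
  rewrite (_ : (1 - r) ^+ 4 = ((1 - r) ^+ 2) ^+ 2); last by rewrite -exprM.
  by rewrite lerXn2r ?nnegrE ?sqr_ge0 ?(ltW d0)// poisson_den_ge.
Qed.

Lemma continuous_dpoisson (R : realType) (r : R) : 0 <= r < 1 ->
  continuous (dpoisson r).
Proof.
move=> r01 s; rewrite /dpoisson; apply: cvgM.
  by apply: cvgM; [exact: cvg_cst|exact: continuous_sin].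
apply: cvgV; first by rewrite expf_neq0// gt_eqF// poisson_den_gt0.
have cd : {for s, continuous (poisson_den r)}.
  rewrite /poisson_den; have c1 : {for s, continuous (fun s => 1 - r * cos s)}.
    by apply: cvgB; [exact: cvg_cst|apply: cvgM; [exact: cvg_cst|exact: continuous_cos]].
  have c2 : {for s, continuous (fun s => r * sin s)}.
    by apply: cvgM; [exact: cvg_cst|exact: continuous_sin].
  by apply: cvgD; under eq_fun do rewrite expr2; rewrite expr2; exact: cvgM.
by under eq_fun do rewrite expr2; rewrite expr2; exact: cvgM.
Qed.

Lemma circle_int_unif_limit (R : realType) (u : nat -> R -> R) (f : R -> R)
    (e : nat -> R) :
  (forall n, circle_integrable (u n)) -> circle_integrable f ->
  (forall n t, `|f t - u n t| <= e n) -> e @ \oo --> (0 : R) ->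
  circle_int (u n) @[n --> \oo] --> circle_int f.
Proof.
move=> iu iF fu e0; apply/cvgrPdist_le => eps eps0.
have pe : 0 < eps / (2 * pi) by rewrite divr_gt0// pi2_gt0.
move/cvgrPdist_le : e0 => /(_ _ pe)[N _ hN]; exists N => // n Nn.
rewrite -circle_intB//.
have iB : circle_integrable (fun t => f t - u n t).
  have := circle_integrableD iF (circle_integrableZ (-1) (iu n)).
  by under eq_fun do rewrite mulN1r.
apply: le_trans (normr_circle_int_le (g := fun=> eps / (2 * pi)) iB _ _) _.
- exact: (continuous_circle_integrable (fun=> cvg_cst _)).
- move=> t _; apply: le_trans (fu n t) _.
  by have := hN n Nn; rewrite /= sub0r normrN; apply: le_trans; exact: ler_norm.
by rewrite circle_int_cst mulrC divfK// gt_eqF// pi2_gt0.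
Qed.

(** For fixed r the sine series converges uniformly to the kernel, so both integrals follow from
    orthogonality; with truncated series they are already constant once the truncation passes k. *)
Lemma circle_int_sin_dpoisson (R : realType) (r : R) (k : nat) : 0 <= r < 1 ->
  circle_int (fun s => sin (k%:R * s) * dpoisson r s) = pi * (k%:R * r ^+ k) /\
  circle_int (fun s => cos (k%:R * s) * dpoisson r s) = 0.
Proof.
move=> r01.
pose u M s : R := \sum_(n < M.+1) n%:R * r ^+ n * sin (n%:R * s).
pose e M : R := (M.+1%:R * r ^+ M.+1) * (36 / (1 - r) ^+ 4).
have e0 : e @ \oo --> (0 : R).
  rewrite -[X in _ --> X](mul0r (36 / (1 - r) ^+ 4)).
  apply: cvgM; last exact: cvg_cst.
  by rewrite (cvg_shiftS (fun n => n%:R * r ^+ n)); exact: cvg_expr_mul_nat.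
have cu M : continuous (u M).
  rewrite /u; elim: (M.+1) => [|K IH] s.
    by under eq_fun do rewrite big_ord0; exact: cvg_cst.
  under eq_fun do rewrite big_ord_recr/=.
  by apply: cvgD; [exact: IH|apply: cvgM; [exact: cvg_cst|exact: continuous_sin_mul]].
have H (w : R -> R) : continuous w -> (forall s, `|w s| <= 1) ->
    circle_int (fun s => w s * u M s) @[M --> \oo] -->
    circle_int (fun s => w s * dpoisson r s).
  move=> cw w1; apply: (circle_int_unif_limit (e := e)) => //.
  - by move=> M; apply: continuous_circle_integrable => s; apply: cvgM; [exact: cw|exact: cu].
  - apply: continuous_circle_integrable => s; apply: cvgM; first exact: cw.
    exact: continuous_dpoisson.
  - move=> M s; rewrite -mulrBr normrM; apply: le_trans (dpoisson_sum_bound s M r01).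
    by rewrite ler_piMl.
split.
- have Hk := H _ (@continuous_sin_mul R k%:R) (fun s => sin_max (k%:R * s)).
  apply: (cvg_unique _ Hk) => //=.
  apply: cvg_near_cst; exists k => // M /= kM.
  under eq_fun do rewrite /u mulr_sumr.
  rewrite (circle_int_sum (F := fun n s => sin (k%:R * s) * (n%:R * r ^+ n * sin (n%:R * s)))); last first.
    move=> n; apply: continuous_circle_integrable => s.
    by apply: cvgM; [|apply: cvgM; [exact: cvg_cst|]]; exact: continuous_sin_mul.
  have E n : circle_int (fun s => sin (k%:R * s) * (n%:R * r ^+ n * sin (n%:R * s))) =
      if n == k then pi * (k%:R * r ^+ k) else 0.
    under eq_fun do rewrite mulrCA.
    rewrite circle_intZ ?circle_int_sinM; last first.
      by apply: continuous_circle_integrable => s; apply: cvgM; exact: continuous_sin_mul.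
    rewrite eq_sym; case: eqVneq => [->|_]; last by rewrite mulr0.
    by case: ifP => [/eqP ->|_]; ring.
  under eq_bigr do rewrite E.
  have kM1 : (k < M.+1)%N by [].
  rewrite (bigD1 (Ordinal kM1))//= eqxx big1 ?addr0// => i.
  by rewrite -val_eqE/= => /negPf ->.
- have Hk := H _ (@continuous_cos_mul R k%:R) (fun s => cos_max (k%:R * s)).
  apply: (cvg_unique _ Hk) => //=.
  apply: cvg_near_cst; near=> M.
  under eq_fun do rewrite /u mulr_sumr.
  rewrite (circle_int_sum (F := fun n s => cos (k%:R * s) * (n%:R * r ^+ n * sin (n%:R * s)))); last first.
    move=> n; apply: continuous_circle_integrable => s.
    by apply: cvgM; [exact: continuous_cos_mul|apply: cvgM; [exact: cvg_cst|exact: continuous_sin_mul]].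
  rewrite big1// => n _; under eq_fun do rewrite mulrCA.
  rewrite circle_intZ ?circle_int_cos_sin ?mulr0//.
  by apply: continuous_circle_integrable => s; apply: cvgM; [exact: continuous_cos_mul|exact: continuous_sin_mul].
Unshelve. all: by end_near. Qed.

(** * Absolutely convergent primitives and their derivatives *)

Lemma cvg_series_inv_sqr (R : realType) :
  cvgn (series (fun n => (n%:R ^-1) ^+ 2 : R)).
Proof.
(* Telescoping, as 1/(k+1)^2 <= 1/k - 1/(k+1); the index 0 contributes nothing because 0^-1 = 0. *)
have B n : series (fun n => (n%:R ^-1) ^+ 2 : R) n.+1 <= 2 - n%:R^-1.
  elim: n => [|[|n] IH].
  - by rewrite seriesEord/= big_ord1 invr0 expr0n subr0.
  - by rewrite seriesEord/= !big_ord_recr big_ord0/= invr0 expr0n/= !add0r invr1 expr1n; lra.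
  have -> : series (fun n => (n%:R ^-1) ^+ 2 : R) n.+3 =
      series (fun n => (n%:R ^-1) ^+ 2 : R) n.+2 + n.+2%:R^-1 ^+ 2.
    by rewrite !seriesEord/= big_ord_recr.
  apply: le_trans (lerD IH (lexx _)) _.
  set x : R := n.+1%:R; have x0 : 0 < x by rewrite ltr0n.
  rewrite -[n.+2%:R]natr1 -/x -subr_ge0.
  rewrite (_ : _ - _ = x^-1 * (x + 1)^-1 ^+ 2); last by field; rewrite !gt_eqF// addr_gt0.
  by rewrite mulr_ge0 ?sqr_ge0// invr_ge0 ltW.
apply: nondecreasing_is_cvgn.
  by apply/nondecreasing_seqP => n; rewrite !seriesEnat/= big_nat_recr//= lerDl sqr_ge0.
exists 2 => _ [[|n] _ <-]; first by rewrite seriesEord/= big_ord0.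
by apply: le_trans (B n) _; rewrite gerBl invr_ge0.
Qed.

(** These are the coefficients of the termwise primitive. They are absolutely summable because |x /
    n| <= x^2 + 1/n^2; at n = 0 both quotients are 0. *)
Lemma cvg_primitive_coef (R : realType) (a b : nat -> R) :
  cvgn (series (energy a b)) ->
  cvgn (series (fun n => `|- (b n / n%:R)| + `|a n / n%:R|)).
Proof.
move=> h.
apply: (@series_le_cvg _ _ (fun n => energy a b n + 2 * (n%:R^-1) ^+ 2) _ _ _
  (is_cvg_seriesD h (is_cvg_seriesZ (k := 2) (@cvg_series_inv_sqr R)))).
- by move=> n; rewrite addr_ge0.
- by move=> n; rewrite addr_ge0 ?energy_ge0// mulr_ge0 ?sqr_ge0.
have K (x y : R) : `|x / y| <= x ^+ 2 + y^-1 ^+ 2.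
  rewrite normrM -(real_normK (num_real x)) -(real_normK (num_real y^-1)).
  have : 0 <= (`|x| - `|y^-1|) ^+ 2 by exact: sqr_ge0.
  have : 0 <= `|x| * `|y^-1| by rewrite mulr_ge0.
  by rewrite sqrrB; lra.
case=> [|n].
  by rewrite invr0 !mulr0 oppr0 normr0 addr0 addr_ge0 ?energy_ge0// mulr_ge0 ?sqr_ge0.
rewrite normrN /energy/=.
have := K (a n.+1) n.+1%:R; have := K (b n.+1) n.+1%:R.
move: (n.+1%:R : R) => y; lra.
Qed.

Definition trig_series (R : realType) (a b : nat -> R) (t : R) : R :=
  limn (fun N => trig_sum a b N t).

Lemma trig_le (R : realType) (a b : nat -> R) n t :
  `|trig a b n t| <= `|a n| + `|b n|.
Proof.
rewrite /trig; apply: le_trans (ler_normD _ _) _; rewrite !normrM.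
by apply: lerD; rewrite ler_piMr// ?cos_max ?sin_max.
Qed.

Lemma trig_series_cvg (R : realType) (a b : nat -> R) :
  let e := series (fun n => `|a n| + `|b n|) in cvgn e ->
  (forall t, trig_sum a b N t @[N --> \oo] --> trig_series a b t) /\
  (forall N t, `|trig_series a b t - trig_sum a b N t| <= limn e - e N).
Proof.
move=> e ce.
have ct t : cvgn (fun N => trig_sum a b N t).
  rewrite (_ : (fun N => _) = series (trig a b ^~ t)); last first.
    by apply/funext => N; rewrite seriesEord.
  apply: normed_cvg; apply: (series_le_cvg _ _ _ ce) => n.
  - exact: normr_ge0.
  - by rewrite addr_ge0.
  - exact: trig_le.
split => [t|N t]; first exact: ct.
have nde : nondecreasing_seq e.
  by apply/nondecreasing_seqP => n; rewrite /e !seriesEnat/= big_nat_recr//= lerDl addr_ge0.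
have cl : `|trig_sum a b M t - trig_sum a b N t| @[M --> \oo] -->
    `|trig_series a b t - trig_sum a b N t|.
  by apply: cvg_norm; apply: cvgB; [exact: ct|exact: cvg_cst].
rewrite -(cvg_lim _ cl)//; apply: limr_le; first by apply: cvgP cl.
exists N => // M /= NM.
apply: (@le_trans _ _ (e M - e N)); last first.
  by rewrite lerB//; exact: nondecreasing_cvgn_le.
rewrite /trig_sum /e !seriesEnat/= -!(big_mkord xpredT (trig a b ^~ t)).
rewrite (big_cat_nat (n := N))//= addrAC subrr add0r.
rewrite [X in _ <= X - _](big_cat_nat (n := N))//= addrAC subrr add0r.
apply: le_trans (ler_norm_sum _ _ _) _; apply: ler_sum => n _; exact: trig_le.
Qed.

Lemma is_derive_bound (R : realType) (f : R -> R) (t D e : R) :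
  is_derive t 1 f D -> 0 < e ->
  exists2 d, 0 < d & forall u, `|u| < d -> `|f (t + u) - f t - D * u| <= e * `|u|.
Proof.
move=> [df Df] e0.
have h : h^-1 *: ((f \o shift t) (h *: 1) - f t) @[h --> 0^'] --> D.
  by rewrite -Df; exact: df.
move/cvgrPdist_le : h => /(_ _ e0)[d /= d0 hd].
exists d => // u ud; have [->|u0] := eqVneq u 0.
  by rewrite addr0 subrr mulr0 subr0 normr0 mulr0.
have := hd u; rewrite /= sub0r normrN => /(_ ud u0).
rewrite /shift/= /GRing.scale/= mulr1 (addrC u) => H.
have -> : f (t + u) - f t - D * u = - (u * (D - u^-1 * (f (t + u) - f t))) by field.
by rewrite normrN normrM mulrC ler_wpM2r.
Qed.

Lemma trig_periodic (R : realType) (a b : nat -> R) n t :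
  trig a b n (t + 2 * pi) = trig a b n t.
Proof.
by rewrite /trig; have [] := cos_sin_int2pi n%:Z t; rewrite -!pmulrn => -> ->.
Qed.

Lemma trig_series_periodic (R : realType) (a b : nat -> R) t :
  trig_series a b (t + 2 * pi) = trig_series a b t.
Proof.
rewrite /trig_series; congr (limn _); apply/funext => N.
by apply: eq_bigr => n _; rewrite trig_periodic.
Qed.

(** Near s = 0 differentiability gives an error eps |sin s|; away from the multiples of 2 pi, 1 -
    cos s is bounded below and M (1 - cos s)^2 absorbs the bounded left-hand side. Comparing with
    sin s instead of s keeps everything periodic, so that s near 2 pi reduces to s near 0. Both
    error terms are chosen to be harmless against the kernel [dpoisson]. *)
Lemma trig_series_taylor (R : realType) (a b : nat -> R) (t D eps : R) :
  cvgn (series (fun n => `|a n| + `|b n|)) ->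
  is_derive t 1 (trig_series a b) D -> 0 < eps ->
  exists2 M, 0 <= M & forall s, circle s ->
  `|trig_series a b (t + s) - trig_series a b t - D * sin s| <=
  eps * `|sin s| + M * (1 - cos s) ^+ 2.
Proof.
move=> ce dT eps0; set T := trig_series a b in dT *.
have [_ Tb] := trig_series_cvg ce.
set L := limn _ in Tb; have {}Tb x : `|T x| <= L.
  by have := Tb 0%N x; rewrite /trig_sum big_ord0 seriesEord/= big_ord0 !subr0.
have L0 : 0 <= L by exact: le_trans (Tb 0).
(* The bound 1/2 gives |u| <= 2 |sin u|; the second bound gives (1 + |D|) eta |u| <= (eps / 2) |u|
   <= eps |sin u|. *)
pose eta := Num.min 2^-1 (eps / (2 * (1 + `|D|))).
have D1 : 0 < 1 + `|D| by rewrite ltr_pwDl.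
have eta0 : 0 < eta by rewrite lt_min invr_gt0 ltr0n divr_gt0// mulr_gt0.
have [d1 d10 h1] := is_derive_bound dT eta0.
have [d2 d20 h2] := is_derive_bound (is_derive_sin 0) eta0.
have near0 u : `|u| < Num.min d1 d2 -> `|T (t + u) - T t - D * sin u| <= eps * `|sin u|.
  rewrite lt_min => /andP[u1 u2].
  have k1 := h1 u u1; have := h2 u u2; rewrite sin0 cos0 add0r subr0 mul1r => k2.
  have u2s : `|u| <= 2 * `|sin u|.
    have e1 : eta <= 2^-1 by rewrite ge_min lexx.
    have := ler_wpM2r (normr_ge0 u) e1.
    have := ler_normB (sin u) (sin u - u); rewrite (_ : sin u - (sin u - u) = u); last by ring.
    by lra.
  have -> : T (t + u) - T t - D * sin u = (T (t + u) - T t - D * u) - D * (sin u - u) by ring.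
  apply: le_trans (ler_normB _ _) _; rewrite (normrM D).
  apply: (@le_trans _ _ (eta * `|u| + `|D| * (eta * `|u|))).
    by apply: lerD => //; exact: ler_wpM2l.
  rewrite (_ : _ + _ = (1 + `|D|) * eta * `|u|); last by ring.
  apply: (@le_trans _ _ (eps / 2 * `|u|)); last first.
    by rewrite -mulrA ler_pM2l// mulrC ler_pdivrMr// mulrC.
  rewrite ler_wpM2r//.
  have : eta <= eps / (2 * (1 + `|D|)) by rewrite ge_min lexx orbT.
  move=> /(ler_wpM2l (ltW D1)) /le_trans; apply.
  by rewrite le_eqVlt; apply/orP; left; apply/eqP; field; rewrite gt_eqF.
set d := Num.min d1 d2 in near0.
have d0 : 0 < d by rewrite lt_min d10.
(* Cosine decreases only up to pi, and M has to be fixed before s. In the case where M matters, d <=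
   s and d <= 2 pi - s force d <= pi, hence d' = d. *)
pose d' := Num.min d pi; have d'0 : 0 < d' by rewrite lt_min d0 pi_gt0.
have d'pi : d' <= pi by rewrite ge_min lexx orbT.
have kap0 : 0 < 1 - cos d'.
  by rewrite subr_gt0 -[ltRHS]cos0 ltr_cos ?in_itv/= ?lexx ?pi_ge0 ?(ltW d'0).
have M0 : 0 <= (2 * L + `|D|) / (1 - cos d') ^+ 2.
  by rewrite divr_ge0 ?sqr_ge0// addr_ge0// mulr_ge0.
exists ((2 * L + `|D|) / (1 - cos d') ^+ 2) => // s.
rewrite /circle/= in_itv/= => /andP[s0 s2].
have [sd|ds] := ltP s d.
  apply: le_trans (near0 s _) _; first by rewrite ger0_norm.
  by rewrite lerDl mulr_ge0// sqr_ge0.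
have [sd2|ds2] := ltP (2 * pi - s) d.
  have := near0 (s - 2 * pi); rewrite distrC ger0_norm ?subr_ge0// => /(_ sd2).
  have -> : t + (s - 2 * pi) = t + s - 2 * pi by ring.
  have -> : T (t + s - 2 * pi) = T (t + s).
    by rewrite /T -(trig_series_periodic a b (t + s - 2 * pi)) subrK.
  have -> : sin (s - 2 * pi) = sin s.
    have [_] := cos_sin_int2pi 1 (s - 2 * pi).
    by rewrite !mul1r subrK.
  by move=> /le_trans; apply; rewrite lerDl mulr_ge0// sqr_ge0.
have dpi : d <= pi by lra.
have d'd : d' = d by apply/min_idPl.
have cs : cos s <= cos d.
  have [spi|pis] := leP s pi.
    by rewrite leNgt ltr_cos ?in_itv/= ?spi ?s0 ?(ltW d0)// -leNgt.
  have -> : cos s = cos (2 * pi - s).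
    have [+ _] := cos_sin_int2pi 1 (- s).
    by rewrite !mul1r cosN addrC => ->.
  rewrite leNgt ltr_cos -?leNgt// in_itv/=; apply/andP; split; lra.
apply: (@le_trans _ _ (2 * L + `|D|)).
  apply: le_trans (ler_normB _ _) _; apply: lerD.
    by apply: le_trans (ler_normB _ _) _; rewrite mulr_natl mulr2n lerD.
  by rewrite normrM ler_piMr// sin_max.
apply: (@le_trans _ _ ((2 * L + `|D|) / (1 - cos d') ^+ 2 * (1 - cos s) ^+ 2)).
  rewrite -mulrA ler_peMr ?addr_ge0 ?mulr_ge0//.
  rewrite ler_pdivlMl ?exprn_gt0// mulr1.
  have c1 : 0 <= 1 - cos s by rewrite subr_ge0 cos_le1.
  by rewrite ler_pXn2r ?nnegrE ?(ltW kap0)// lerB// d'd.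
by rewrite lerDr mulr_ge0// ltW.
Qed.

(** The denominator is (1 - r)^2 + 2 r (1 - cos s). Keeping only the second summand gives the first
    bound, which vanishes as r tends to 1; keeping only the first gives the second bound, which
    serves for fixed r. *)
Lemma normr_dpoisson_le (R : realType) (r s : R) : 0 < r < 1 ->
  (1 - cos s) ^+ 2 * `|dpoisson r s| <= (1 - r ^+ 2) / (4 * r) /\
  `|dpoisson r s| <= r * (1 - r ^+ 2) / (1 - r) ^+ 4.
Proof.
move=> /andP[r0 r1]; have r01 : 0 <= r < 1 by rewrite (ltW r0).
have d0 := poisson_den_gt0 s r01.
have r2 : 0 <= r * (1 - r ^+ 2).
  by rewrite mulr_ge0 ?(ltW r0)// subr_ge0 expr_le1// ltW.
have K : `|dpoisson r s| <= r * (1 - r ^+ 2) / poisson_den r s ^+ 2.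
  rewrite /dpoisson !normrM normfV (ger0_norm (sqr_ge0 _)) ler_wpM2r ?invr_ge0 ?sqr_ge0//.
  by rewrite -normrM (ger0_norm r2) ler_piMr// sin_max.
have c1 : 0 <= 1 - cos s by rewrite subr_ge0 cos_le1.
split; last first.
  apply: le_trans K _; rewrite ler_wpM2l// lef_pV2 ?posrE ?exprn_gt0 ?subr_gt0//.
  rewrite (_ : (1 - r) ^+ 4 = ((1 - r) ^+ 2) ^+ 2); last by rewrite -exprM.
  by rewrite lerXn2r ?nnegrE ?sqr_ge0 ?(ltW d0)// poisson_den_ge// ltW.
apply: le_trans (ler_wpM2l (sqr_ge0 _) K) _.
rewrite mulrA ler_pdivrMr ?exprn_gt0//.
have D2 : (2 * r * (1 - cos s)) ^+ 2 <= poisson_den r s ^+ 2.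
  rewrite lerXn2r ?nnegrE ?(ltW d0)//; first by rewrite !mulr_ge0// ltW.
  by rewrite poisson_denE lerDr sqr_ge0.
have q0 : 0 <= (1 - r ^+ 2) / (4 * r).
  by rewrite divr_ge0 ?mulr_ge0 ?(ltW r0)// subr_ge0 expr_le1// ltW.
apply: le_trans (ler_wpM2l q0 D2).
by rewrite le_eqVlt; apply/orP; left; apply/eqP; field; rewrite gt_eqF.
Qed.

(** The kernel has the sign of sin s, so an error eps |sin s| integrates against its modulus to
    exactly eps pi r, uniformly controlled in r. *)
Lemma sin_dpoisson_ge0 (R : realType) (r s : R) : 0 < r < 1 ->
  `|sin s| * `|dpoisson r s| = sin s * dpoisson r s.
Proof.
move=> /andP[r0 r1]; rewrite -normrM ger0_norm// /dpoisson mulrA mulr_ge0//.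
  rewrite mulrCA mulr_ge0// -?expr2 ?sqr_ge0//.
  by rewrite mulr_ge0 ?(ltW r0)// subr_ge0 expr_le1// ltW.
by rewrite invr_ge0 sqr_ge0.
Qed.

Lemma circle_int_trig_shift_dpoisson (R : realType) (a b : nat -> R) (t r : R) N :
  0 <= r < 1 ->
  circle_int (fun s => trig_sum a b N (t + s) * dpoisson r s) =
  pi * \sum_(n < N) r ^+ n * (n%:R * (b n * cos (n%:R * t) - a n * sin (n%:R * t))).
Proof.
move=> r01.
have E n s : trig a b n (t + s) * dpoisson r s =
    trig a b n t * (cos (n%:R * s) * dpoisson r s) +
    (b n * cos (n%:R * t) - a n * sin (n%:R * t)) * (sin (n%:R * s) * dpoisson r s).
  by rewrite /trig mulrDr cosD sinD; ring.
have i1 n : circle_integrable (fun s => cos (n%:R * s) * dpoisson r s).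
  apply: continuous_circle_integrable => s.
  by apply: cvgM; [exact: continuous_cos_mul|exact: continuous_dpoisson].
have i2 n : circle_integrable (fun s => sin (n%:R * s) * dpoisson r s).
  apply: continuous_circle_integrable => s.
  by apply: cvgM; [exact: continuous_sin_mul|exact: continuous_dpoisson].
under eq_fun do rewrite /trig_sum mulr_suml.
rewrite (circle_int_sum (F := fun n s => trig a b n (t + s) * dpoisson r s)); last first.
  move=> n; under eq_fun do rewrite E.
  by apply: circle_integrableD; exact: circle_integrableZ.
rewrite mulr_sumr; apply: eq_bigr => n _; under eq_fun do rewrite E.
rewrite circle_intD; do ?exact: circle_integrableZ.
rewrite !circle_intZ//; have [-> ->] := circle_int_sin_dpoisson n r01.
by ring.
Qed.

(* The integral of g (t + s) [dpoisson r s] over s is pi times the Abel mean of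
   the derived series of g; g (t + s) is replaced by g t + D sin s, up to an
   error eps |sin s| + M (1 - cos s)^2 whose second part is killed by the kernel. *)
Lemma radial_cvg_derivative (R : realType) (a b : nat -> R) (t D : R) (v : R -> R) :
  cvgn (series (fun n => `|a n| + `|b n|)) ->
  is_derive t 1 (trig_series a b) D ->
  (forall r, 0 < r < 1 ->
    series (fun n => r ^+ n * (n%:R * (b n * cos (n%:R * t) - a n * sin (n%:R * t))))
    @ \oo --> v r) ->
  v r @[r --> (1 : R)^'-] --> D.
Proof.
move=> ce dT hv.
have [Tc Tb] := trig_series_cvg ce.
set e := series _ in ce Tc Tb.
have e0 : (limn e - e N) @[N --> \oo] --> (0 : R).
  rewrite -[X in _ --> X](subrr (limn e)).
  by apply: cvgB; [exact: cvg_cst|exact: ce].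
have key eps : 0 < eps -> exists2 M, 0 <= M & forall r, 0 < r < 1 ->
    `|v r - D * r| <= eps * r + 2 * (M * ((1 - r ^+ 2) / (4 * r))).
  move=> eps0; have [M M0 hM] := trig_series_taylor ce dT eps0.
  exists M => // r r01; have r01' : 0 <= r < 1 by case/andP: r01 => /ltW -> ->.
  set kap := (1 - r ^+ 2) / (4 * r); pose kr := r * (1 - r ^+ 2) / (1 - r) ^+ 4.
  set T := trig_series a b in dT Tc Tb hM.
  pose V N := \sum_(n < N) r ^+ n * (n%:R * (b n * cos (n%:R * t) - a n * sin (n%:R * t))).
  have cK := continuous_dpoisson r01'.
  have iK : circle_integrable (dpoisson r) by exact: continuous_circle_integrable.
  have iS : circle_integrable (fun s => sin s * dpoisson r s).
    apply: continuous_circle_integrable => s.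
    by apply: cvgM; [exact: continuous_sin|exact: cK].
  have i1 N : circle_integrable (fun s => trig_sum a b N (t + s) * dpoisson r s).
    apply: continuous_circle_integrable => s; apply: cvgM; last exact: cK.
    apply: (@continuous_comp _ _ _ (fun s => t + s) (trig_sum a b N)).
      by apply: cvgD; [exact: cvg_cst|exact: cvg_id].
    exact: continuous_trig_sum.
  have IS : circle_int (fun s => sin s * dpoisson r s) = pi * r.
    have [+ _] := circle_int_sin_dpoisson 1 r01'.
    rewrite expr1 mul1r => <-; congr circle_int.
    by apply/funext => s; rewrite mul1r.
  have IK : circle_int (dpoisson r) = 0.
    have [_ +] := circle_int_sin_dpoisson 0 r01'.
    by under [X in circle_int X = _ -> _]eq_fun do rewrite mul0r cos0 mul1r.
  (* The series is truncated at N because only finite sums are integrated term by term. N tends to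
     infinity for fixed r, which removes the term with kr before r tends to 1 and kr blows up. *)
  have H N : `|V N - D * r| <= eps * r + 2 * (M * kap + (limn e - e N) * kr).
    (* The constant T t may be subtracted because the kernel has mean zero, and sin s pairs with it
       to pi r. *)
    have E : pi * (V N - D * r) = circle_int (fun s =>
        trig_sum a b N (t + s) * dpoisson r s +
        (- T t * dpoisson r s + - D * (sin s * dpoisson r s))).
      rewrite circle_intD//; last by apply: circle_integrableD; exact: circle_integrableZ.
      rewrite circle_intD; do ?exact: circle_integrableZ.
      rewrite !circle_intZ// IS IK circle_int_trig_shift_dpoisson//.
      by rewrite /V mulr0 add0r; ring.
    have : `|pi * (V N - D * r)| <= circle_int (fun s =>
        eps * (sin s * dpoisson r s) + (M * kap + (limn e - e N) * kr)).
      have ic (c : R) : circle_integrable (fun=> c).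
        exact: (continuous_circle_integrable (fun=> cvg_cst _)).
      rewrite E; apply: normr_circle_int_le.
      - apply: circle_integrableD => //.
        by apply: circle_integrableD; exact: circle_integrableZ.
      - by apply: circle_integrableD => //; exact: circle_integrableZ.
      move=> s cs; have [K1 K2] := normr_dpoisson_le s r01.
      rewrite (_ : _ + _ = ((T (t + s) - T t - D * sin s) -
        (T (t + s) - trig_sum a b N (t + s))) * dpoisson r s); last by ring.
      rewrite normrM -(sin_dpoisson_ge0 s r01).
      apply: (@le_trans _ _ ((eps * `|sin s| + M * (1 - cos s) ^+ 2 +
          (limn e - e N)) * `|dpoisson r s|)).
        rewrite ler_wpM2r//; apply: le_trans (ler_normB _ _) _.
        by apply: lerD; [exact: hM|exact: Tb].
      have t1 := ler_wpM2l M0 K1.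
      have eN : 0 <= limn e - e N by apply: le_trans (Tb N 0).
      have t2 := ler_wpM2l eN K2.
      have E2 (x y z w k : R) : (eps * x + y * z + w) * k = eps * (x * k) + (y * (z * k) + w * k).
        by ring.
      by rewrite E2 lerD2l; exact: lerD.
    rewrite circle_intD; last 2 first.
    - exact: circle_integrableZ.
    - exact: (continuous_circle_integrable (fun=> cvg_cst _)).
    rewrite circle_intZ// IS circle_int_cst normrM (ger0_norm (pi_ge0 R)).
    rewrite (_ : eps * (pi * r) + 2 * pi * _ = pi * (eps * r + 2 * (M * kap + (limn e - e N) * kr))).
      by rewrite ler_pM2l// pi_gt0.
    by ring.
  have c1 : `|V N - D * r| @[N --> \oo] --> `|v r - D * r|.
    apply: cvg_norm; apply: cvgB; last exact: cvg_cst.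
    have := hv r r01; rewrite (_ : series _ = V)//.
    by apply/funext => N; rewrite seriesEord.
  have c2 : (eps * r + 2 * (M * kap + (limn e - e N) * kr)) @[N --> \oo] -->
      eps * r + 2 * (M * kap + 0 * kr).
    apply: cvgD; first exact: cvg_cst.
    apply: cvgM; first exact: cvg_cst.
    apply: cvgD; first exact: cvg_cst.
    by apply: cvgM; [exact: e0|exact: cvg_cst].
  rewrite mul0r addr0 in c2.
  by apply: ler_cvg_to c1 c2 _; near=> N; exact: H.
apply/cvgrPdist_le => eps eps0.
(* Half of eps leaves room for |D| (1 - r) and for the multiple of M (1 - r^2) / (4 r), both of
   which tend to 0 as r increases to 1. *)
have [|M M0 hM] := key (eps / 2); first by rewrite divr_gt0.
have cb : (`|D| * (1 - r) + (eps / 2 * r + 2 * (M * ((1 - r ^+ 2) / (4 * r)))))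
    @[r --> (1 : R)^'-] --> (`|D| * (1 - 1) + (eps / 2 * 1 +
     2 * (M * ((1 - 1 ^+ 2) / (4 * 1)))) : R).
  apply: cvg_at_left_filter.
  apply: cvgD.
    by apply: cvgM; [exact: cvg_cst|apply: cvgB; [exact: cvg_cst|exact: cvg_id]].
  apply: cvgD; first by apply: cvgM; [exact: cvg_cst|exact: cvg_id].
  apply: cvgM; first exact: cvg_cst.
  apply: cvgM; first exact: cvg_cst.
  apply: cvgM.
    by apply: cvgB; [exact: cvg_cst|under eq_fun do rewrite expr2; rewrite expr2; apply: cvgM; exact: cvg_id].
  apply: cvgV; first by rewrite mulr1.
  by apply: cvgM; [exact: cvg_cst|exact: cvg_id].
move: cb; rewrite subrr expr1n subrr mul0r !mulr0 !mulr1 add0r addr0.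
move=> /cvgr_lt /(_ eps) H; have {}H := H _; near=> r.
have r01 : 0 < r < 1.
  by apply/andP; split; near: r; [exact: nbhs_left_gt|exact: nbhs_left_lt].
rewrite distrC (_ : v r - D = v r - D * r - D * (1 - r)); last by ring.
apply: le_trans (ler_normB _ _) _; rewrite addrC normrM (ger0_norm (x := 1 - r)).
  apply: (@le_trans _ _ (`|D| * (1 - r) + (eps / 2 * r + 2 * (M * ((1 - r ^+ 2) / (4 * r)))))).
    by rewrite lerD2l hM.
  apply/ltW; near: r; apply: H.
  by rewrite ltr_pdivrMr// ltr_pMr// ltr1n.
by rewrite subr_ge0; case/andP: r01 => _ /ltW.
Unshelve. all: by end_near. Qed.

Lemma Rintegral_trig_sum (R : realType) (a b : nat -> R) N x : 0 <= x ->
  let A n := - (b n / n%:R) in let B n := a n / n%:R in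
  \int[lebesgue_measure]_(t in `[0, x]) trig_sum a b N.+1 t =
  a 0%N * x + (trig_sum A B N.+1 x - trig_sum A B N.+1 0).
Proof.
move=> x0 A B.
rewrite [LHS](@Rintegral_FTC2 _ _ (fun t => a 0%N * t + trig_sum A B N.+1 t))//.
- by rewrite mulr0 add0r addrA.
- exact: continuous_trig_sum.
have dtrig (n : nat) (y : R) : is_derive y 1 (trig A B n) (n%:R * (B n * cos (n%:R * y) - A n * sin (n%:R * y))).
  have h1 := is_deriveZ (A n) (is_derive_cos_mul n%:R y).
  have h2 := is_deriveZ (B n) (is_derive_sin_mul n%:R y).
  rewrite (_ : n%:R * _ = A n *: - (n%:R * sin (n%:R * y)) +
    B n *: (n%:R * cos (n%:R * y))); first exact: is_deriveD h1 h2.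
  by rewrite /GRing.scale/=; ring.
have dsum M (y : R) : is_derive y 1 (trig_sum A B M)
    (\sum_(n < M) n%:R * (B n * cos (n%:R * y) - A n * sin (n%:R * y))).
  rewrite /trig_sum; elim: M => [|M IH].
    rewrite big_ord0 (_ : (fun _ => _) = cst 0); first exact: is_derive_cst.
    by apply/funext => z; rewrite big_ord0.
  rewrite big_ord_recr/= (_ : (fun _ => _) = trig_sum A B M + trig A B M).
    exact: is_deriveD.
  by apply/funext => z; rewrite big_ord_recr.
move=> y; have h1 := is_deriveZ (a 0%N) (is_derive_id y 1).
rewrite (_ : trig_sum a b N.+1 y = a 0%N *: 1 +
  \sum_(n < N.+1) n%:R * (B n * cos (n%:R * y) - A n * sin (n%:R * y))).
  exact: is_deriveD h1 (dsum N.+1 y).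
rewrite /GRing.scale/= mulr1 /trig_sum !big_ord_recl/= !mul0r add0r.
rewrite {1}/trig mul0r cos0 sin0 mulr1 mulr0 addr0; congr (_ + _).
by apply: eq_bigr => n _; rewrite /A /B /trig; field; rewrite pnatr_eq0.
Qed.

(* A primitive of the boundary function is an absolutely convergent trigonometric
   series up to a linear term, and is differentiable almost everywhere. *)
Lemma fatou_trig (R : realType) (a b : nat -> R) :
  cvgn (series (energy a b)) ->
  exists f : R -> R,
  [/\ circle_integrable f, circle_integrable (fun t => f t ^+ 2),
      circle_int (fun t => f t ^+ 2) = pi * limn (series (energy a b)) &
      {ae @lebesgue_measure R, forall t, circle t -> forall v : R -> R,
        (forall r, 0 < r < 1 -> series (fun n => r ^+ n * trig a b n t) @ \oo --> v r) ->
        v r @[r --> (1 : R)^'-] --> f t}].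
Proof.
move=> h; have [f [phi [if1 if2 f2E phik hf]]] := trig_boundary h.
exists f; split => //.
pose A n := - (b n / n%:R); pose B n := a n / n%:R.
have cAB := cvg_primitive_coef h; have [Tc _] := trig_series_cvg cAB.
set T := trig_series _ _ in Tc.
(* Both sides are limits along phi of the integrated partial sums: the left by dominated
   convergence, the right by absolute convergence of the primitive. *)
have FT x : 0 <= x <= 2 * pi ->
    \int[lebesgue_measure]_(t in `[0, x]) f t = a 0%N * x + (T x - T 0).
  move=> x02; have cx := hf x x02; apply: (cvg_unique _ cx) => //=.
  have c2 : a 0%N * x + (trig_sum A B N x - trig_sum A B N 0) @[N --> \oo] -->
      a 0%N * x + (T x - T 0).
    by apply: cvgD; [exact: cvg_cst|apply: cvgB; exact: Tc].
  apply: cvg_trans (cvg_comp_subseq phik c2); apply: near_eq_cvg.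
  exists 1%N => // k /= k1; have := leq_trans k1 (phik k); case: (phi k) => // N _.
  by rewrite Rintegral_trig_sum//; case/andP: x02.
(* Extension by zero makes f integrable on the whole line, where Lebesgue differentiation is
   applied; the endpoints 0 and 2 pi are then discarded as a null set. *)
pose f0 := f \_ (@circle R).
have mc := @measurable_circle R.
have if0 : (@lebesgue_measure R).-integrable setT (EFin \o f0).
  by rewrite /f0 -restrict_EFin; apply/integrable_restrict => //; rewrite setTI.
have := @FTC1 R f0 (BLeft 0).
case.
- by move=> y; apply: integrableS if0 => //; exact: measurable_itv.
- exact: integrable_locally.
move=> N [mN N0 subN].
have ae02 : {ae @lebesgue_measure R, forall t, t != 0 /\ t != 2 * pi}.
  exists [set 0; 2 * pi]; split.
  - by apply: measurableU; exact: measurable_set1.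
  - apply: null_set_setU; first exact: measurable_set1.
    + exact: measurable_set1.
    + exact: lebesgue_measure_set1.
    + exact: lebesgue_measure_set1.
  move=> t /= nt; have [->|t0] := eqVneq t 0; first by left.
  by right; have [//|t2] := eqVneq t (2 * pi); exfalso; apply: nt.
have ae1 : {ae @lebesgue_measure R, forall t, 0 < t -> t < 2 * pi ->
    is_derive t 1 T (f t - a 0%N)}.
  exists N; split => // t /= nt; apply: subN => /= ht; apply: nt => t0 t2.
  have [] := ht; first by rewrite lte_fin.
  set F := fun x : R => _ => dF F't.
  have {}dF : is_derive t 1 F (f t).
    apply: DeriveDef => //; rewrite -derive1E F't /f0 patchE mem_set//.
    by rewrite /circle/= in_itv/= !ltW.
  have h1 := is_deriveZ (- a 0%N) (is_derive_id t 1).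
  have := is_deriveD (is_deriveD dF h1) (is_derive_cst (T 0) t 1).
  rewrite addr0 /GRing.scale/= mulr1; apply: near_eq_is_derive.
  have : t \in `]0, 2 * pi[ by rewrite in_itv/= t0.
  move=> /near_in_itvoo; apply: filterS => y; rewrite in_itv/= => /andP[y0 y2].
  change (F y + (- a 0%N * y) + T 0 = T y).
  have -> : F y = \int[lebesgue_measure]_(t in `[0, y]) f t.
    apply: eq_Rintegral => z; rewrite inE/= in_itv/= => /andP[z0 zy].
    by rewrite /f0 patchE mem_set// /circle/= in_itv/= z0 (le_trans zy)// ltW.
  by rewrite FT ?(ltW y0) ?(ltW y2)//; ring.
apply: (lebesgue_ae_imply (lebesgue_ae_and ae02 ae1)) => t [[t0 t2] dT].
rewrite /circle/= in_itv/= => /andP[t0' t2'] v hv.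
have {}dT : is_derive t 1 T (f t - a 0%N) by apply: dT; rewrite lt_neqAle ?t0' ?t2' ?andbT// eq_sym.
(* The derived series of T is the given series without its constant term a_0, which is why a_0 is
   subtracted from both v and f. *)
have := @radial_cvg_derivative R A B t (f t - a 0%N) (fun r => v r - a 0%N) cAB dT.
move=> H; have {}H : v r - a 0%N @[r --> (1 : R)^'-] --> f t - a 0%N.
  apply: H => r r01.
  have : series (fun n => r ^+ n * trig a b n t) N - a 0%N @[N --> \oo] --> v r - a 0%N.
    by apply: cvgB; [exact: hv|exact: cvg_cst].
  apply: cvg_trans; apply: near_eq_cvg; exists 1%N => // -[//|M] _.
  rewrite /= !seriesEord/= !big_ord_recl/= !mul0r mulr0 add0r.
  rewrite expr0 mul1r {1}/trig mul0r cos0 sin0 mulr1 mulr0 addr0 addrAC subrr add0r.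
  by apply: eq_bigr => n _; rewrite /A /B /trig; congr (_ * _); field; rewrite pnatr_eq0.
rewrite (_ : v = fun r => (v r - a 0%N) + a 0%N); last first.
  by apply/funext => r; rewrite subrK.
by rewrite -[f t](subrK (a 0%N)); apply: cvgD; [exact: H|exact: cvg_cst].
Qed.

(** * Boundary values and the inner product of H^2 *)

Lemma cvg_real_complex_filter (R : realType) (T : Type) (F : set_system T)
    {FF : Filter F} (u : T -> R) (l : R) :
  u x @[x --> F] --> l -> real_complex R (u x) @[x --> F] --> real_complex R l.
Proof.
move=> ul; apply/cvgrPdist_lt => e e0.
have [e1 e2] : 0 < complex.Re e /\ e = real_complex R (complex.Re e).
  by case: e e0 => a b; rewrite ltcE/= => /andP[/eqP b0 a0]; split=> //; rewrite b0.
near=> n; rewrite e2 -rmorphB normc_def/= expr0n addr0 sqrtr_sqr ltcR.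
near: n; move/cvgrPdist_lt : ul; exact.
Unshelve. all: by end_near. Qed.

Lemma Complex_realE (R : realType) (x y : R) :
  Complex x y = real_complex R x + Complex 0 1 * real_complex R y.
Proof. by apply/eqP; rewrite eq_complex/=; apply/andP; split; apply/eqP; ring. Qed.

Lemma cvg_Complex_filter (R : realType) (T : Type) (F : set_system T)
    {FF : Filter F} (u v : T -> R) (a b : R) :
  u x @[x --> F] --> a -> v x @[x --> F] --> b ->
  Complex (u x) (v x) @[x --> F] --> Complex a b.
Proof.
move=> ua vb; rewrite Complex_realE; under eq_fun do rewrite Complex_realE.
apply: cvgD; first exact: cvg_real_complex_filter.
by apply: cvgM; [exact: cvg_cst|exact: cvg_real_complex_filter].
Qed.

Lemma cvg_Re_Im (R : realType) (T : Type) (F : set_system T)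
    {FF : Filter F} (u : T -> R[i]) (l : R[i]) :
  u x @[x --> F] --> l ->
  complex.Re (u x) @[x --> F] --> complex.Re l /\
  complex.Im (u x) @[x --> F] --> complex.Im l.
Proof.
move=> /cvgrPdist_lt ul.
have H e : 0 < e -> \forall x \near F, `|l - u x| < real_complex R e.
  by move=> e0; apply: ul; rewrite -[0]/(real_complex R 0) ltcR.
split; apply/cvgrPdist_lt => e e0; apply: filterS (H e e0) => x; rewrite -ltcR;
  apply: le_lt_trans; rewrite -raddfB/=.
  exact: normc_ge_Re.
by rewrite normc_def lecR -sqrtr_sqr ler_wsqrtr// lerDr sqr_ge0.
Qed.

Lemma cvg_mx_filter (R : realType) (m p : nat) (T : Type) (F : set_system T)
    {FF : Filter F} (u : T -> 'M[R[i]]_(m, p)) (l : 'M[R[i]]_(m, p)) :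
  (forall i j, u x i j @[x --> F] --> l i j) <-> u x @[x --> F] --> l.
Proof.
split=> [h|/cvg_ballP h i j].
  apply/cvg_ballP => e e0.
  have H i j : \forall x \near F, ball (l i j) e (u x i j).
    by move/cvg_ballP: (h i j); exact.
  have : \forall x \near F, forall ij : 'I_m * 'I_p, ball (l ij.1 ij.2) e (u x ij.1 ij.2).
    by apply: filter_forall => ij; exact: H.
  apply: filterS => n Hn; split=> // i j; exact: (Hn (i, j)).
by apply/cvg_ballP => e e0; apply: filterS (h e e0) => x [_ /(_ i j)].
Qed.

Lemma expiX (R : realType) (t : R) n : expi t ^+ n = expi (n%:R * t).
Proof.
elim: n => [|n IH]; first by rewrite expr0 mul0r /expi cos0 sin0.
rewrite exprS IH -natr1 mulrDl mul1r (addrC _ t) /expi cosD sinD.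
by apply/eqP; rewrite eq_complex/=; apply/andP; split; apply/eqP; ring.
Qed.

Lemma normr_expi (R : realType) (r t : R) : `|real_complex R r * expi t| = real_complex R `|r|.
Proof.
rewrite normrM [X in _ * X]normc_def /= cos2Dsin2 sqrtr1 [X in X * _]normc_def/=.
by rewrite expr0n addr0 sqrtr_sqr mulr1.
Qed.

Lemma Re_Im_power_expi (R : realType) (r t : R) (c : nat -> R[i]) n :
  let a k := complex.Re (c k) in let b k := complex.Im (c k) in
  (real_complex R r * expi t) ^+ n * c n =
  Complex (r ^+ n * trig a (fun k => - b k) n t) (r ^+ n * trig b a n t).
Proof.
move=> a b; rewrite exprMn expiX -rmorphXn /a /b /trig; case: (c n) => x y.
by apply/eqP; rewrite eq_complex/=; apply/andP; split; apply/eqP; ring.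
Qed.

Lemma cvg_heval (R : realType) (m : nat) (F : hardy R m) (z : R[i]) :
  `|z| < 1 -> power_series (coef F) z @ \oo --> heval F z.
Proof. exact: power_series_cvg. Qed.

Lemma heval_eq (R : realType) (m : nat) (F : hardy R m) (z : R[i]) (l : 'cV[R[i]]_m) :
  power_series (coef F) z @ \oo --> l -> heval F z = l.
Proof. by move=> h; apply: cvg_lim h; exact: norm_hausdorff. Qed.

Lemma hevalP (R : realType) (m : nat) (c : R[i]) (F G : hardy R m) (z : R[i]) :
  `|z| < 1 -> heval (c *: F + G) z = c *: heval F z + heval G z.
Proof.
move=> z1; apply: heval_eq.
rewrite (_ : power_series _ z = fun n => c *: power_series (coef F) z n + power_series (coef G) z n).
  by apply: cvgD; [apply: cvgZ; [exact: cvg_cst|]|]; exact: cvg_heval.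
apply/funext => n; rewrite /power_series !seriesEord/= scaler_sumr -big_split/=.
by apply: eq_bigr => i _; rewrite scalerDr !scalerA mulrC.
Qed.

Lemma square_summable_entry (R : realType) (m : nat) (F : hardy R m) (k : 'I_m) :
  cvgn (series (fun n => complex.Re (coef F n k 0) ^+ 2 + complex.Im (coef F n k 0) ^+ 2)).
Proof.
have /asboolP h := coefP F; apply: (series_le_cvg _ _ _ h) => n.
- by rewrite addr_ge0 ?sqr_ge0.
- exact: normsqv_ge0.
- rewrite normsqvE (bigD1 k)//= lerDl sumr_ge0// => i _.
  by rewrite addr_ge0 ?sqr_ge0.
Qed.

(** Fatou's theorem for the real and the imaginary part of one coordinate. At every n, including 0,
    the energies of the two parts add up to 2 |c_n|^2, whence the factor 2 pi. *)
Lemma boundary_entry (R : realType) (m : nat) (F : hardy R m) (k : 'I_m) :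
  exists p q : R -> R,
  [/\ [/\ circle_integrable p, circle_integrable q,
      circle_integrable (fun t => p t ^+ 2) & circle_integrable (fun t => q t ^+ 2)],
      circle_int (fun t => p t ^+ 2) + circle_int (fun t => q t ^+ 2) =
        2 * pi * limn (series (fun n =>
          complex.Re (coef F n k 0) ^+ 2 + complex.Im (coef F n k 0) ^+ 2)) &
      {ae @lebesgue_measure R, forall t, circle t ->
        heval F (real_complex R r * expi t) k 0 @[r --> (1 : R)^'-] -->
        Complex (p t) (q t)}].
Proof.
have h := @square_summable_entry R m F k.
pose a n := complex.Re (coef F n k 0); pose b n := complex.Im (coef F n k 0).
have sab : cvgn (series (fun n => a n ^+ 2 + b n ^+ 2)) by exact: h.
have le2 (x y : nat -> R) : cvgn (series (fun n => x n ^+ 2 + y n ^+ 2)) ->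
    cvgn (series (energy x y)).
  move=> hxy; apply: (series_le_cvg _ _ _ (is_cvg_seriesZ (k := 2) hxy)) => n.
  - exact: energy_ge0.
  - by rewrite mulr_ge0// addr_ge0 ?sqr_ge0.
  - rewrite /= /GRing.scale/= /energy; case: ifP => _.
      by rewrite ler_pM2l// lerDl sqr_ge0.
    by rewrite ler_peMl ?addr_ge0 ?sqr_ge0// ler1n.
have s1 : cvgn (series (energy a (fun n => - b n))).
  by apply: le2; under eq_fun do rewrite sqrrN.
have s2 : cvgn (series (energy b a)).
  by apply: le2; under eq_fun do rewrite addrC.
have [p [ip ip2 pE hp]] := fatou_trig s1.
have [q [iq iq2 qE hq]] := fatou_trig s2.
exists p, q; split => //.
  rewrite pE qE -mulrDr -[RHS]mulrA mulrCA; congr (_ * _).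
  have c12 : series (energy a (fun n => - b n)) n + series (energy b a) n @[n --> \oo] -->
      limn (series (energy a (fun n => - b n))) + limn (series (energy b a)).
    by apply: cvgD; [exact: s1|exact: s2].
  apply: (cvg_unique _ c12) => //=.
  rewrite (_ : (fun n => _) = fun n => 2 * series (fun n => a n ^+ 2 + b n ^+ 2) n).
    by apply: cvgM; [exact: cvg_cst|exact: sab].
  apply/funext => n; rewrite !seriesEord/= mulr_sumr -big_split/=; apply: eq_bigr => i _.
  by rewrite /energy; case: ifP => _; rewrite ?sqrrN; ring.
apply: (lebesgue_ae_imply (lebesgue_ae_and hp hq)) => t [tp tq] ct.
pose v r := complex.Re (heval F (real_complex R r * expi t) k 0).
pose w r := complex.Im (heval F (real_complex R r * expi t) k 0).
have H r : 0 < r < 1 -> (series (fun n => r ^+ n * trig a (fun k => - b k) n t) @ \oo --> v r) /\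
    (series (fun n => r ^+ n * trig b a n t) @ \oo --> w r).
  move=> /andP[r0 r1].
  have z1 : `|real_complex R r * expi t| < 1.
    by rewrite normr_expi gtr0_norm// -[1]/(real_complex R 1) ltcR.
  have hz := @cvg_heval R m F _ z1.
  have E : (fun x => power_series (coef F) (real_complex R r * expi t) x k 0) =
      fun n => Complex (series (fun n => r ^+ n * trig a (fun k => - b k) n t) n)
        (series (fun n => r ^+ n * trig b a n t) n).
    apply/funext => n; rewrite /power_series !seriesEord/= summxE.
    have E' j : ((real_complex R r * expi t) ^+ j *: coef F j) k 0 =
        Complex (r ^+ j * trig a (fun k => - b k) j t) (r ^+ j * trig b a j t).
      by rewrite mxE (Re_Im_power_expi _ _ (fun n => coef F n k 0)).
    rewrite (eq_bigr _ (fun (j : 'I_n) _ => E' j)).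
    by elim/big_rec3 : _ => [//|i x y z _ ->].
  have hk : Complex (series (fun n => r ^+ n * trig a (fun k => - b k) n t) n)
      (series (fun n => r ^+ n * trig b a n t) n) @[n --> \oo] -->
      heval F (real_complex R r * expi t) k 0.
    by rewrite -E; exact: (cvg_mx_filter _ _).2 hz k 0.
  exact: (cvg_Re_Im hk).
have vp := tp ct v (fun r r01 => (H r r01).1).
have wq := tq ct w (fun r r01 => (H r r01).2).
have E : (fun r => heval F (real_complex R r * expi t) k 0) =
    (fun r => Complex (v r) (w r)).
  by apply/funext => r; rewrite /v /w; case: (heval _ _ k 0).
by rewrite E; exact: cvg_Complex_filter.
Qed.

(** Integrability is asked of a representative that agrees almost everywhere: boundary values take
    the default of [lim] where no limit exists, so their own measurability is not at hand. *)
Definition circle_cintegrable (R : realType) (f : R -> R[i]) : Prop :=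
  exists p q : R -> R, [/\ circle_integrable p, circle_integrable q &
    {ae @lebesgue_measure R, forall t, circle t -> f t = Complex (p t) (q t)}].

Lemma ae_eq_mean (R : realType) (f g : R -> R[i]) :
  {ae @lebesgue_measure R, forall t, circle t -> f t = g t} -> mean f = mean g.
Proof.
move=> fg; rewrite /mean; congr (_ * Complex _ _); apply: ae_eq_Rintegral;
  by apply: (lebesgue_ae_imply fg) => t h /h ->.
Qed.

Lemma meanE (R : realType) (f : R -> R[i]) (p q : R -> R) :
  {ae @lebesgue_measure R, forall t, circle t -> f t = Complex (p t) (q t)} ->
  mean f = real_complex R (2 * pi)^-1 * Complex (circle_int p) (circle_int q).
Proof. by move=> h; rewrite (ae_eq_mean h). Qed.

Lemma circle_cintegrableP (R : realType) (c : R[i]) (f g : R -> R[i]) :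
  circle_cintegrable f -> circle_cintegrable g ->
  circle_cintegrable (fun t => c * f t + g t) /\
  mean (fun t => c * f t + g t) = c * mean f + mean g.
Proof.
move=> [p [q [ip iq fE]]] [p' [q' [ip' iq' gE]]]; case: c => a b.
have h : {ae @lebesgue_measure R, forall t, circle t -> Complex a b * f t + g t =
    Complex (a * p t + (- b * q t + p' t)) (a * q t + (b * p t + q' t))}.
  apply: (lebesgue_ae_imply (lebesgue_ae_and fE gE)) => t [h1 h2] ct.
  rewrite h1// h2//; apply/eqP; rewrite eq_complex/=.
  by apply/andP; split; apply/eqP; ring.
have i1 : circle_integrable (fun t => - b * q t + p' t).
  by apply: circle_integrableD => //; exact: circle_integrableZ.
have i2 : circle_integrable (fun t => b * p t + q' t).
  by apply: circle_integrableD => //; exact: circle_integrableZ.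
split.
  exists (fun t => a * p t + (- b * q t + p' t)), (fun t => a * q t + (b * p t + q' t)).
  by split => //; apply: circle_integrableD => //; exact: circle_integrableZ.
rewrite (meanE h) (meanE fE) (meanE gE) mulrCA -mulrDr; congr (_ * _).
rewrite !circle_intD ?circle_intZ//; do ?exact: circle_integrableZ.
by apply/eqP; rewrite eq_complex/=; apply/andP; split; apply/eqP; ring.
Qed.

Lemma circle_cintegrable0 (R : realType) : @circle_cintegrable R (fun=> 0) /\ mean (fun=> 0 : R[i]) = 0.
Proof.
have ic : circle_integrable (fun=> 0 : R).
  exact: (continuous_circle_integrable (fun=> cvg_cst _)).
have h : {ae @lebesgue_measure R, forall t, circle t -> 0 = Complex 0 0 :> R[i]}.
  exact: aeW.
split; first by exists (fun=> 0), (fun=> 0).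
by rewrite (meanE (p := fun=> 0) (q := fun=> 0) h) !circle_int_cst !mulr0.
Qed.

Lemma circle_cintegrable_sum (R : realType) (I : Type) (s : seq I) (f : I -> R -> R[i]) :
  (forall i, circle_cintegrable (f i)) ->
  circle_cintegrable (fun t => \sum_(i <- s) f i t) /\
  mean (fun t => \sum_(i <- s) f i t) = \sum_(i <- s) mean (f i).
Proof.
move=> h; elim: s => [|i s [IH1 IH2]].
  by under eq_fun do rewrite big_nil; rewrite big_nil; exact: circle_cintegrable0.
under eq_fun do rewrite big_cons -[f i _]mul1r.
have [h1 h2] := circle_cintegrableP 1 (h i) IH1.
by rewrite big_cons h2 mul1r IH2.
Qed.

Lemma mean_conj (R : realType) (f : R -> R[i]) :
  circle_cintegrable f -> mean (fun t => (f t)^*) = (mean f)^*.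
Proof.
move=> [p [q [ip iq fE]]].
have h : {ae @lebesgue_measure R, forall t, circle t -> (f t)^* = Complex (p t) (- 1 * q t)}.
  by apply: (lebesgue_ae_imply fE) => t ht ct; rewrite ht// mulN1r.
rewrite (meanE h) (meanE fE) circle_intZ// mulN1r rmorphM; congr (_ * _).
by apply/eqP; rewrite eq_complex/= oppr0 !eqxx.
Qed.

Lemma circle_integrable_mul (R : realType) (p q : R -> R) :
  circle_integrable p -> circle_integrable q ->
  circle_integrable (fun t => p t ^+ 2) -> circle_integrable (fun t => q t ^+ 2) ->
  circle_integrable (fun t => p t * q t).
Proof.
move=> ip iq ip2 iq2.
have mc := @measurable_circle R.
apply: (le_integrable mc _ _ (circle_integrableD ip2 iq2)).
  apply/measurable_EFinP; apply: measurable_funM; apply/measurable_EFinP.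
    exact: (measurable_int _ ip).
  exact: (measurable_int _ iq).
move=> t _; rewrite /= lee_fin [leRHS]ger0_norm ?addr_ge0 ?sqr_ge0//.
rewrite -(real_normK (num_real (p t))) -(real_normK (num_real (q t))) normrM.
have := sqr_ge0 (`|p t| - `|q t|); have : 0 <= `|p t| * `|q t| by rewrite mulr_ge0.
by rewrite sqrrB; lra.
Qed.

Lemma lebesgue_ae_forall (R : realType) (m : nat) (P : 'I_m -> R -> Prop) :
  (forall k, {ae @lebesgue_measure R, forall t, P k t}) ->
  {ae @lebesgue_measure R, forall t, forall k, P k t}.
Proof.
elim: m P => [|m IH] P h.
  by exists set0; split => // t /= nt; exfalso; apply: nt => -[].
have h0 := IH (fun k t => P (lift ord0 k) t) (fun k => h (lift ord0 k)).
apply: (lebesgue_ae_imply (lebesgue_ae_and (h ord0) h0)) => t [p0 p1] k.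
by case: (unliftP ord0 k) => [j ->|->].
Qed.

(** Turns the [lim] inside [hboundary] into a genuine limit by collecting the finitely many null
    sets of the coordinates. *)
Lemma hboundaryP (R : realType) (m : nat) (F : hardy R m) :
  {ae @lebesgue_measure R, forall t, circle t ->
    heval F (real_complex R r * expi t) @[r --> (1 : R)^'-] --> hboundary F t}.
Proof.
have H k : {ae @lebesgue_measure R, forall t, circle t -> exists l : R[i],
    heval F (real_complex R r * expi t) k 0 @[r --> (1 : R)^'-] --> l}.
  have [p [q [_ _ h]]] := boundary_entry F k.
  by apply: (lebesgue_ae_imply h) => t ht ct; exists (Complex (p t) (q t)); exact: ht.
apply: (lebesgue_ae_imply (lebesgue_ae_forall H)) => t ht ct.
have /choice[l hl] := fun k => ht k ct.
have cl : heval F (real_complex R r * expi t) @[r --> (1 : R)^'-] --> \col_k l k.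
  by apply/cvg_mx_filter => i j; rewrite (ord1 j) mxE; exact: hl.
rewrite /hboundary /radial_limit.
by apply: cvgP cl.
Qed.

Lemma hboundary_entryP (R : realType) (m : nat) (F : hardy R m) (k : 'I_m) :
  exists p q : R -> R,
  [/\ [/\ circle_integrable p, circle_integrable q,
      circle_integrable (fun t => p t ^+ 2) & circle_integrable (fun t => q t ^+ 2)],
      circle_int (fun t => p t ^+ 2) + circle_int (fun t => q t ^+ 2) =
        2 * pi * limn (series (fun n =>
          complex.Re (coef F n k 0) ^+ 2 + complex.Im (coef F n k 0) ^+ 2)) &
      {ae @lebesgue_measure R, forall t, circle t -> hboundary F t k 0 = Complex (p t) (q t)}].
Proof.
have [p [q [h1 h2 h]]] := boundary_entry F k; exists p, q; split => //.
apply: (lebesgue_ae_imply (lebesgue_ae_and h (hboundaryP F))) => t [t1 t2] ct.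
have c1 : heval F (real_complex R r * expi t) k 0 @[r --> (1 : R)^'-] --> hboundary F t k 0.
  exact: (cvg_mx_filter _ _).2 (t2 ct) k 0.
exact: (cvg_unique (@norm_hausdorff _ _) c1 (t1 ct)).
Qed.

Lemma hboundaryZD (R : realType) (m : nat) (c : R[i]) (F G : hardy R m) :
  {ae @lebesgue_measure R, forall t, circle t ->
    hboundary (c *: F + G) t = c *: hboundary F t + hboundary G t}.
Proof.
apply: (lebesgue_ae_imply (lebesgue_ae_and (hboundaryP F) (hboundaryP G))) => t [hF hG] ct.
apply: cvg_lim; first exact: norm_hausdorff.
have h : c *: heval F (real_complex R r * expi t) + heval G (real_complex R r * expi t)
    @[r --> (1 : R)^'-] --> c *: hboundary F t + hboundary G t.
  by apply: cvgD; [apply: cvgZ; [exact: cvg_cst|exact: hF]|exact: hG].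
apply: cvg_trans h; apply: near_eq_cvg; near=> r.
rewrite hevalP// normr_expi gtr0_norm -1?[1]/(real_complex R 1) ?ltcR; near: r.
  exact: nbhs_left_lt.
exact: nbhs_left_gt.
Unshelve. all: by end_near. Qed.

Lemma cintegrable_entry (R : realType) (m : nat) (F G : hardy R m) (k : 'I_m) :
  circle_cintegrable (fun t => hboundary F t k 0 * (hboundary G t k 0)^*).
Proof.
have [p [q [[ip iq ip2 iq2] _ h]]] := hboundary_entryP F k.
have [p' [q' [[ip' iq' ip2' iq2'] _ h']]] := hboundary_entryP G k.
exists (fun t => p t * p' t + q t * q' t), (fun t => q t * p' t + -1 * (p t * q' t)); split.
- by apply: circle_integrableD; exact: circle_integrable_mul.
- by apply: circle_integrableD; do ?apply: circle_integrableZ; exact: circle_integrable_mul.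
apply: (lebesgue_ae_imply (lebesgue_ae_and h h')) => t [t1 t2] ct.
rewrite t1// t2//; apply/eqP; rewrite eq_complex/=.
by apply/andP; split; apply/eqP; ring.
Qed.

Lemma cintegrable_dotv (R : realType) (m : nat) (F G : hardy R m) :
  circle_cintegrable (fun t => dotv (hboundary F t) (hboundary G t)).
Proof. exact: (circle_cintegrable_sum _ (cintegrable_entry F G)).1. Qed.

Definition sqnorm (R : realType) (m : nat) (F : hardy R m) : R :=
  limn (series (fun n => normsqv (coef F n))).

Lemma hdotxx (R : realType) (m : nat) (F : hardy R m) :
  hdot F F = real_complex R (sqnorm F).
Proof.
rewrite /hdot /L2dot /dotv (circle_cintegrable_sum _ (cintegrable_entry F F)).2.
have E k : mean (fun t => hboundary F t k 0 * (hboundary F t k 0)^*) =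
    real_complex R (limn (series (fun n =>
          complex.Re (coef F n k 0) ^+ 2 + complex.Im (coef F n k 0) ^+ 2))).
  have [p [q [[ip iq ip2 iq2] pq h]]] := hboundary_entryP F k.
  rewrite (meanE (p := fun t => p t ^+ 2 + q t ^+ 2) (q := fun=> 0)); last first.
    apply: (lebesgue_ae_imply h) => t t1 ct; rewrite t1//.
    by apply/eqP; rewrite eq_complex/=; apply/andP; split; apply/eqP; ring.
  rewrite circle_intD// pq circle_int_cst mulr0 -[Complex _ 0]/(real_complex R _) -rmorphM.
  by rewrite mulrA mulVf ?mul1r// gt_eqF// pi2_gt0.
rewrite (eq_bigr _ (fun k _ => E k)) -rmorph_sum; congr (real_complex R _).
have c : series (fun n => normsqv (coef F n)) @ \oo --> \sum_k limn (series (fun n =>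
          complex.Re (coef F n k 0) ^+ 2 + complex.Im (coef F n k 0) ^+ 2)).
  rewrite (_ : series _ = fun N => \sum_k series (fun n =>
          complex.Re (coef F n k 0) ^+ 2 + complex.Im (coef F n k 0) ^+ 2) N); last first.
    apply/funext => N; rewrite !seriesEord/=; under [RHS]eq_bigr do rewrite seriesEord/=.
    by rewrite exchange_big/=; apply: eq_bigr => n _; rewrite normsqvE.
  elim: (index_enum _) => [|k s IH].
    by rewrite big_nil; under eq_fun do rewrite big_nil; exact: cvg_cst.
  rewrite big_cons; under eq_fun do rewrite big_cons.
  by apply: cvgD => //; exact: square_summable_entry.
by rewrite /sqnorm (cvg_lim _ c).
Qed.

(** * Sesquilinearity, polarization and Taylor coefficients *)

Lemma dotvDl (R : realType) (m : nat) (c : R[i]) (u v w : 'cV[R[i]]_m) :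
  dotv (c *: u + v) w = c * dotv u w + dotv v w.
Proof.
rewrite /dotv mulr_sumr -big_split/=; apply: eq_bigr => k _.
by rewrite !mxE mulrDl mulrA.
Qed.

Lemma dotvC (R : realType) (m : nat) (u v : 'cV[R[i]]_m) : dotv u v = (dotv v u)^*.
Proof.
rewrite /dotv rmorph_sum; apply: eq_bigr => k _ /=.
by rewrite rmorphM /= conjCK mulrC.
Qed.

Lemma hdotDl (R : realType) (m : nat) (c : R[i]) (F G K : hardy R m) :
  hdot (c *: F + G) K = c * hdot F K + hdot G K.
Proof.
rewrite /hdot /L2dot -(circle_cintegrableP c (cintegrable_dotv F K) (cintegrable_dotv G K)).2.
apply: ae_eq_mean; apply: (lebesgue_ae_imply (hboundaryZD c F G)) => t h ct.
by rewrite h// dotvDl.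
Qed.

Lemma hdotC (R : realType) (m : nat) (F G : hardy R m) : hdot F G = (hdot G F)^*.
Proof.
rewrite /hdot /L2dot -mean_conj; last exact: cintegrable_dotv.
by congr mean; apply/funext => t; exact: dotvC.
Qed.

(** Reduces identities between Hermitian forms to their diagonals. All four vectors are written c y
    + x so that the linearity hypothesis applies to each of them verbatim. *)
Lemma polarization (R : realType) (V : lmodType R[i]) (h : V -> V -> R[i]) :
  (forall c x y z, h (c *: x + y) z = c * h x z + h y z) ->
  (forall x y, h x y = (h y x)^*) ->
  forall x y, h x y = 4^-1 * (h (1 *: y + x) (1 *: y + x) - h (-1 *: y + x) (-1 *: y + x)
    + 'i * (h ('i *: y + x) ('i *: y + x) - h (- 'i *: y + x) (- 'i *: y + x))).
Proof.
move=> hD hC x y.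
have hr c u v w : h w (c *: u + v) = c^* * h w u + h w v.
  by rewrite hC hD rmorphD rmorphM /= -!hC.
rewrite !hD !hr !rmorphN /= !conjC1 !conjCi.
have i2 : 'i * 'i = -1 :> R[i] by rewrite -expr2 sqrCi.
set a := h x y; set b := h y x; set p := h x x; set q := h y y; set i := 'i in i2 *.
rewrite [X in 4^-1 * X](_ : _ = 2 * a + 2 * b - 2 * (i * i) * a + 2 * (i * i) * b); last by ring.
by rewrite i2; field.
Qed.

(** The diagonal case is Parseval's identity [hdotxx]; polarizing the partial sums and the limit by
    the same formula gives the general case. Pairings with monomials, shifts and kernels are
    computed on coefficients from this. *)
Lemma hdot_series (R : realType) (m : nat) (F G : hardy R m) :
  series (fun n => dotv (coef F n) (coef G n)) @ \oo --> hdot F G.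
Proof.
have H (K : hardy R m) : series (fun n => dotv (coef K n) (coef K n)) @ \oo --> hdot K K.
  rewrite hdotxx (_ : series _ = fun n => real_complex R (series (fun n => normsqv (coef K n)) n)).
    by apply: cvg_real_complex; have /asboolP := coefP K.
  apply/funext => n; rewrite !seriesEord/= rmorph_sum; apply: eq_bigr => i _.
  have := dotvC (coef K i) (coef K i); rewrite /normsqv; case: (dotv _ _) => a b [] b0.
  have {b0} -> : b = 0 by lra.
  by [].
pose d (K : hardy R m) n := \sum_(k < n) dotv (coef K k) (coef K k).
have {}H (K : hardy R m) : d K n @[n --> \oo] --> hdot K K.
  by have := H K; rewrite seriesEord.
rewrite (polarization (@hdotDl R m) (@hdotC R m)) seriesEord.
have E n : \sum_(k < n) dotv (coef F k) (coef G k) =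
    4^-1 * (d (1 *: G + F) n - d (-1 *: G + F) n
    + 'i * (d ('i *: G + F) n - d (- 'i *: G + F) n)).
  have E (i : 'I_n) : true -> dotv (coef F i) (coef G i) = _ :=
    fun _ => polarization (@dotvDl R m) (@dotvC R m) (coef F i) (coef G i).
  rewrite (eq_bigr _ E) -mulr_sumr; congr (_ * _); rewrite big_split; congr (_ + _).
    by rewrite sumrB.
  by rewrite -mulr_sumr; congr (_ * _); rewrite sumrB.
rewrite (funext E).
apply: cvgM; first exact: cvg_cst.
apply: cvgD; first by apply: cvgB; exact: H.
by apply: cvgM; [exact: cvg_cst|apply: cvgB; exact: H].
Qed.

Lemma hdotE (R : realType) (m : nat) (F G : hardy R m) :
  hdot F G = L2dot (hboundary F) (hboundary G).
Proof. by []. Qed.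

(* Unification against products and conjugates must not unfold integrals. *)
#[local] Opaque hdot.

(** * Hilbert space calculus in H^2 *)

Lemma hardy_ext (R : realType) (m : nat) (F G : hardy R m) :
  (forall n, coef F n = coef G n) -> F = G.
Proof. by move=> h; apply: val_inj; apply/funext => n; exact: h. Qed.

Lemma coefD (R : realType) (m : nat) (F G : hardy R m) n :
  coef (F + G) n = coef F n + coef G n.
Proof. by []. Qed.

Lemma coefZ (R : realType) (m : nat) (c : R[i]) (F : hardy R m) n :
  coef (c *: F) n = c *: coef F n.
Proof. by []. Qed.

Lemma coef0 (R : realType) (m : nat) n : coef (0 : hardy R m) n = 0.
Proof. by []. Qed.

Lemma coef_sum (R : realType) (m : nat) (I : Type) (s : seq I) (F : I -> hardy R m) n :
  coef (\sum_(i <- s) F i) n = \sum_(i <- s) coef (F i) n.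
Proof. by elim: s => [|i s IH]; rewrite ?big_nil// !big_cons coefD IH. Qed.

Lemma conjcM (R : realType) (x y : R[i]) : (x * y)^* = x^* * y^*.
Proof. exact: rmorphM. Qed.

Lemma conjcD (R : realType) (x y : R[i]) : (x + y)^* = x^* + y^*.
Proof. exact: rmorphD. Qed.

Lemma conjc_lin (R : realType) (c x y : R[i]) : (c * x + y)^* = c^* * x^* + y^*.
Proof. by rewrite conjcD conjcM. Qed.

Lemma conjcN (R : realType) (x : R[i]) : (- x)^* = - x^*.
Proof. exact: rmorphN. Qed.

Lemma conjcV (R : realType) (x : R[i]) : (x^-1)^* = (x^*)^-1.
Proof. exact: fmorphV. Qed.

Lemma conjc0 (R : realType) : (0 : R[i])^* = 0.
Proof. exact: rmorph0. Qed.

(** Scalar content of the Cauchy-Schwarz inequality: for a = <F, F>, x = <F, G>, N = <G, G> the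
    hypothesis is the expansion of 0 <= <F + dG, F + dG> at the minimizing d = -x / N. *)
Lemma cauchy_schwarz_step (R : realType) (a x N : R[i]) : 0 < N -> N^* = N ->
  let d := - (x / N) in 0 <= d * (d^* * N + x^* ) + (d^* * x + a) ->
  `|x| ^+ 2 <= a * N.
Proof.
move=> N0 NR /=; rewrite conjcN conjcM conjcV NR normCK => h.
have N1 : N != 0 by rewrite gt_eqF.
rewrite -(ler_pM2l (x := N^-1)) ?invr_gt0// [leRHS]mulrCA mulVf// mulr1.
move: h; rewrite (_ : _ + _ = a - N^-1 * (x * x^*)) ?subr_ge0//.
by field.
Qed.

Section inner_product.
Context {R : realType} {m : nat}.
Implicit Types F G K : hardy R m.

Lemma hdotDr (c : R[i]) F G K : hdot K (c *: F + G) = c^* * hdot K F + hdot K G.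
Proof. by rewrite hdotC hdotDl conjc_lin (hdotC K F) (hdotC K G). Qed.

Lemma hdot0l K : hdot 0 K = 0.
Proof.
have := hdotDl 1 0 0 K; rewrite scaler0 addr0 mul1r => /eqP.
by rewrite -subr_eq subrr eq_sym => /eqP.
Qed.

Lemma hdot0r K : hdot K 0 = 0.
Proof. by rewrite hdotC hdot0l conjc0. Qed.

Lemma hdotZl c F K : hdot (c *: F) K = c * hdot F K.
Proof. by have := hdotDl c F 0 K; rewrite hdot0l !addr0. Qed.

Lemma hdotAl F G K : hdot (F + G) K = hdot F K + hdot G K.
Proof. by have := hdotDl 1 F G K; rewrite scale1r mul1r. Qed.

Lemma hdotNl F K : hdot (- F) K = - hdot F K.
Proof. by rewrite -scaleN1r hdotZl mulN1r. Qed.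

Lemma hdotBl F G K : hdot (F - G) K = hdot F K - hdot G K.
Proof. by rewrite hdotAl hdotNl. Qed.

Lemma hdotZr c F K : hdot K (c *: F) = c^* * hdot K F.
Proof. by have := hdotDr c F 0 K; rewrite hdot0r !addr0. Qed.

Lemma hdotAr F G K : hdot K (F + G) = hdot K F + hdot K G.
Proof. by have := hdotDr 1 F G K; rewrite scale1r conjC1 mul1r. Qed.

Lemma hdotNr F K : hdot K (- F) = - hdot K F.
Proof. by rewrite -scaleN1r hdotZr conjcN conjC1 mulN1r. Qed.

Lemma hdotBr F G K : hdot K (F - G) = hdot K F - hdot K G.
Proof. by rewrite hdotAr hdotNr. Qed.

Lemma hdot_suml (I : Type) (s : seq I) (F : I -> hardy R m) K :
  hdot (\sum_(i <- s) F i) K = \sum_(i <- s) hdot (F i) K.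
Proof. by elim: s => [|i s IH]; rewrite ?big_nil ?hdot0l// !big_cons hdotAl IH. Qed.

Lemma hdot_sumr (I : Type) (s : seq I) (F : I -> hardy R m) K :
  hdot K (\sum_(i <- s) F i) = \sum_(i <- s) hdot K (F i).
Proof. by elim: s => [|i s IH]; rewrite ?big_nil ?hdot0r// !big_cons hdotAr IH. Qed.

Lemma sqnorm_le_partial F n : \sum_(k < n) normsqv (coef F k) <= sqnorm F.
Proof.
have /asboolP h := coefP F.
have nd : nondecreasing_seq (series (fun n => normsqv (coef F n))).
  by apply/nondecreasing_seqP => k; rewrite !seriesEnat/= big_nat_recr//= lerDl normsqv_ge0.
rewrite (_ : \sum_(k < n) _ = series (fun n => normsqv (coef F n)) n).
  exact: (nondecreasing_cvgn_le nd h n).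
by rewrite seriesEord.
Qed.

Lemma sqnorm_le F (B : R) :
  (forall n, \sum_(k < n) normsqv (coef F k) <= B) -> sqnorm F <= B.
Proof.
move=> hB; have /asboolP h := coefP F; apply: limr_le => //.
by near=> n; rewrite seriesEord; exact: hB.
Unshelve. all: by end_near. Qed.

Lemma sqnorm_ge0 F : 0 <= sqnorm F.
Proof. by apply: le_trans (sqnorm_le_partial F 0); rewrite big_ord0. Qed.

Lemma hdotxx_ge0 F : 0 <= hdot F F.
Proof. by rewrite hdotxx -[0]/(real_complex R 0) lecR sqnorm_ge0. Qed.

Lemma normsqv_eq0 (u : 'cV[R[i]]_m) : normsqv u = 0 -> u = 0.
Proof.
rewrite normsqvE => /eqP; rewrite psumr_eq0; last first.
  by move=> k _; rewrite addr_ge0 ?sqr_ge0.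
move=> /allP h; apply/matrixP => i j; rewrite (ord1 j) mxE.
have := h i (mem_index_enum _); rewrite paddr_eq0 ?sqr_ge0// !sqrf_eq0.
by case: (u i 0) => x y /= /andP[/eqP-> /eqP->].
Qed.

Lemma hdotxx_eq0 F : hdot F F = 0 -> F = 0.
Proof.
rewrite hdotxx => /eqP; rewrite -[0]/(real_complex R 0) => /eqP [s0].
apply: hardy_ext => n; rewrite coef0; apply: normsqv_eq0.
apply/eqP; rewrite eq_le normsqv_ge0 andbT -s0.
apply: le_trans (sqnorm_le_partial F n.+1); rewrite big_ord_recr/= lerDr.
by rewrite sumr_ge0// => k _; exact: normsqv_ge0.
Qed.

Lemma hdot_nondegenerate F : (forall K, hdot F K = 0) -> F = 0.
Proof. by move=> h; exact: hdotxx_eq0. Qed.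

Lemma hdot_cauchy_schwarz F G : `|hdot F G| ^+ 2 <= hdot F F * hdot G G.
Proof.
have [G0|G0] := eqVneq (hdot G G) 0.
  by rewrite (hdotxx_eq0 G0) !hdot0r normr0 expr0n mulr0.
have Gp : 0 < hdot G G by rewrite lt_neqAle eq_sym G0 hdotxx_ge0.
set N := hdot G G in G0 Gp *.
have NR : N^* = N by rewrite /N -hdotC.
apply: cauchy_schwarz_step => //.
have := hdotxx_ge0 (- (hdot F G / N) *: G + F).
by rewrite hdotDl !hdotDr (hdotC G F).
Qed.

End inner_product.

(** If F and G agree in the disc, the radial limits of F - G vanish, hence so does its norm. *)
Lemma heval_inj (R : realType) (m : nat) (F G : hardy R m) :
  (forall z, `|z| < 1 -> heval F z = heval G z) -> F = G.
Proof.
move=> h; apply/eqP; rewrite -subr_eq0; apply/eqP; apply: hdotxx_eq0.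
have b0 t : hboundary (F - G) t = 0.
  apply: cvg_lim; first exact: norm_hausdorff.
  have h0 : (0 : 'cV[R[i]]_m) @[r --> (1 : R)^'-] --> (0 : 'cV[R[i]]_m) by exact: cvg_cst.
  apply: cvg_trans h0; apply: near_eq_cvg; near=> r.
  have z1 : `|real_complex R r * expi t| < 1.
    rewrite normr_expi gtr0_norm -1?[1]/(real_complex R 1) ?ltcR; near: r.
      exact: nbhs_left_lt.
    exact: nbhs_left_gt.
  by rewrite addrC -scaleN1r hevalP// scaleN1r h// addNr.
rewrite hdotE /L2dot (_ : (fun t => _) = fun=> 0) ?(circle_cintegrable0 R).2//.
by apply/funext => t; rewrite b0 /dotv big1// => k _; rewrite mxE mul0r.
Unshelve. all: by end_near. Qed.

Lemma heval0 (R : realType) (m : nat) z : heval (0 : hardy R m) z = 0.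
Proof.
apply: heval_eq; rewrite (_ : power_series _ _ = fun=> 0); first exact: cvg_cst.
apply/funext => n; rewrite /power_series seriesEord/= big1// => i _.
exact: scaler0.
Qed.

Lemma heval_sum (R : realType) (m : nat) (I : Type) (s : seq I) (F : I -> hardy R m) z :
  `|z| < 1 -> heval (\sum_(i <- s) F i) z = \sum_(i <- s) heval (F i) z.
Proof.
move=> z1; elim: s => [|i s IH]; first by rewrite !big_nil heval0.
by rewrite !big_cons -[F i]scale1r hevalP// scale1r IH scale1r.
Qed.

Lemma heval_scale (R : realType) (m : nat) c (F : hardy R m) z :
  `|z| < 1 -> heval (c *: F) z = c *: heval F z.
Proof. by move=> z1; rewrite -[c *: F]addr0 hevalP// heval0 addr0. Qed.

(** * Shifts, monomials and reproducing kernels *)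

Lemma l2seq_fshift (R : realType) (m : nat) (F : hardy R m) :
  (fun n => if n is k.+1 then coef F k else 0) \in @l2seq R m.
Proof.
have /asboolP hF := coefP F; apply/asboolP; rewrite /square_summable.
have n0 : normsqv (0 : 'cV[R[i]]_m) = 0.
  by rewrite normsqvE big1// => k _; rewrite mxE/= expr0n addr0.
apply/cvg_ex; exists (sqnorm F); rewrite -(cvg_shiftS (series _)).
rewrite (_ : [sequence _]_n = series (fun n => normsqv (coef F n))); first exact: hF.
by apply/funext => n; rewrite !seriesEord/= big_ord_recl/= n0 add0r.
Qed.

Definition fshift (R : realType) (m : nat) (F : hardy R m) : hardy R m :=
  Hardy (l2seq_fshift F).

Lemma l2seq_hmono (R : realType) (m : nat) (k : nat) (v : 'cV[R[i]]_m) :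
  (fun n => if n == k then v else 0) \in @l2seq R m.
Proof.
apply/asboolP; rewrite /square_summable; apply/cvg_ex; exists (normsqv v).
apply: cvg_near_cst; exists k.+1 => // n /= kn.
rewrite seriesEord/= (bigD1 (Ordinal kn))//= eqxx big1 ?addr0// => i.
rewrite -val_eqE/= => /negPf ->.
by rewrite normsqvE big1// => j _; rewrite mxE/= expr0n addr0.
Qed.

Definition hmono (R : realType) (m : nat) (k : nat) (v : 'cV[R[i]]_m) : hardy R m :=
  Hardy (l2seq_hmono k v).

Lemma dotv0r (R : realType) (m : nat) (u : 'cV[R[i]]_m) : dotv u 0 = 0.
Proof. by rewrite /dotv big1// => k _; rewrite mxE rmorph0 mulr0. Qed.

Lemma hdot_limP (R : realType) (m : nat) (F G : hardy R m) (l : R[i]) :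
  \sum_(k < n) dotv (coef F k) (coef G k) @[n --> \oo] --> l -> hdot F G = l.
Proof.
move=> h; have := @hdot_series R m F G; rewrite seriesEord => h2.
exact: (cvg_unique (@norm_hausdorff _ _) h2 h).
Qed.

Lemma hdot_hmono (R : realType) (m : nat) (F : hardy R m) k (v : 'cV[R[i]]_m) :
  hdot F (hmono k v) = dotv (coef F k) v.
Proof.
apply: hdot_limP; apply: cvg_near_cst; exists k.+1 => // n /= kn.
rewrite (bigD1 (Ordinal kn))//= eqxx big1 ?addr0// => i.
by rewrite -val_eqE/= => /negPf ->; rewrite dotv0r.
Qed.

Lemma hdot_bshift (R : realType) (m : nat) (F K : hardy R m) :
  hdot (bshift F) K = hdot F (fshift K).
Proof.
apply: hdot_limP; have := @hdot_series R m F (fshift K).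
rewrite seriesEord -(cvg_shiftS (fun n => \sum_(k < n) dotv (coef F k) (coef (fshift K) k))).
rewrite (_ : [sequence _]_n = fun n => \sum_(k < n) dotv (coef (bshift F) k) (coef K k))//.
by apply/funext => n; rewrite /= big_ord_recl/= dotv0r add0r.
Qed.

Lemma heval_fshift (R : realType) (m : nat) (F : hardy R m) z :
  `|z| < 1 -> heval (fshift F) z = z *: heval F z.
Proof.
move=> z1; apply: heval_eq.
rewrite -(cvg_shiftS (power_series _ _)).
rewrite (_ : [sequence _]_n = fun n => z *: power_series (coef F) z n).
  by apply: cvgZ; [exact: cvg_cst|exact: cvg_heval].
apply/funext => n; rewrite /power_series !seriesEord/= big_ord_recl/= scaler0 add0r scaler_sumr.
by apply: eq_bigr => i _; rewrite scalerA -exprS.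
Qed.

Lemma heval_hmono (R : realType) (m : nat) k (v : 'cV[R[i]]_m) z :
  heval (hmono k v) z = z ^+ k *: v.
Proof.
apply: heval_eq; apply: cvg_near_cst; exists k.+1 => // n /= kn.
rewrite /power_series seriesEord/= (bigD1 (Ordinal kn))//= eqxx big1 ?addr0// => i.
by rewrite -val_eqE/= => /negPf ->; rewrite scaler0.
Qed.

Lemma normsqv_delta (R : realType) (m : nat) (c : R[i]) (k : 'I_m) :
  normsqv (c *: delta_mx k 0 : 'cV[R[i]]_m) = complex.Re c ^+ 2 + complex.Im c ^+ 2.
Proof.
rewrite normsqvE (bigD1 k)//= big1 ?addr0.
  by rewrite !mxE !eqxx mulr1.
by move=> j jk; rewrite !mxE (negPf jk) mulr0/= expr0n addr0.
Qed.

Lemma l2seq_kernel (R : realType) (m : nat) (z : R[i]) (k : 'I_m) (z1 : `|z| < 1) :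
  (fun n => (z^* ^+ n) *: (delta_mx k 0 : 'cV[R[i]]_m)) \in @l2seq R m.
Proof.
apply/asboolP; rewrite /square_summable.
pose q := complex.Re z ^+ 2 + complex.Im z ^+ 2.
have q0 : 0 <= q by rewrite addr_ge0 ?sqr_ge0.
have q1 : q < 1.
  have : Num.sqrt q < Num.sqrt 1.
    by move: z1; rewrite normc_def -[1]/(real_complex R 1) ltcR sqrtr1.
  by rewrite ltr_sqrt.
have E n : normsqv ((z^* ^+ n) *: (delta_mx k 0 : 'cV[R[i]]_m)) = q ^+ n.
  rewrite normsqv_delta; elim: n => [|n IH]; first by rewrite !expr0/= expr1n expr0n addr0.
  rewrite !exprS -IH /q; case: (z) (z^* ^+ n) => x y [a b] /=; ring.
rewrite (funext E); have := @is_cvg_geometric_series R 1 q.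
rewrite ger0_norm// => /(_ q1).
by rewrite (_ : geometric 1 q = fun n => q ^+ n)//; apply/funext => n; rewrite /= mul1r.
Qed.

(** Reproducing kernel for the k-th coordinate of evaluation at z, through which evaluation is
    bounded by the norm. The proof of |z| < 1 is an argument because it makes the coefficients
    square summable. *)
Definition szego (R : realType) (m : nat) (z : R[i]) (k : 'I_m) (z1 : `|z| < 1) :
  hardy R m := Hardy (l2seq_kernel k z1).

Lemma hdot_szego (R : realType) (m : nat) (F : hardy R m) (z : R[i]) (k : 'I_m)
    (z1 : `|z| < 1) : hdot F (szego k z1) = heval F z k 0.
Proof.
apply: hdot_limP.
have h : power_series (coef F) z n k 0 @[n --> \oo] --> heval F z k 0.
  by apply: (cvg_mx_filter _ _).2; exact: cvg_heval.
rewrite (_ : (fun n => _) = fun n => power_series (coef F) z n k 0)//.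
apply/funext => n; rewrite /power_series seriesEord summxE; apply: eq_bigr => j _.
rewrite mxE /dotv (bigD1 k)//= big1 ?addr0; last first.
  by move=> i ik; rewrite !mxE (negPf ik) mulr0 rmorph0 mulr0.
by rewrite !mxE !eqxx mulr1 rmorphXn /= conjCK mulrC.
Qed.

(** * Multiplication by a bounded analytic function *)

(** The norm of [R[i]] takes its values in [R[i]]; this is the modulus as an element of R, to which
    real limits and integrals apply. *)
Definition cabs (R : realType) (z : R[i]) : R := complex.Re `|z|.

Lemma cabsE (R : realType) (z : R[i]) : `|z| = real_complex R (cabs z).
Proof. by rewrite /cabs normc_def. Qed.

Lemma cabs_ge0 (R : realType) (z : R[i]) : 0 <= cabs z.
Proof. by rewrite /cabs normc_def sqrtr_ge0. Qed.

Lemma cabs_le0_eq0 (R : realType) (z : R[i]) : cabs z <= 0 -> z = 0.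
Proof.
move=> h; have c0 : cabs z = 0 by apply/eqP; rewrite eq_le h cabs_ge0.
by apply: normr0_eq0; rewrite cabsE c0.
Qed.

Lemma sqr_cabs (R : realType) (z : R[i]) :
  cabs z ^+ 2 = complex.Re z ^+ 2 + complex.Im z ^+ 2.
Proof. by rewrite /cabs normc_def/= sqr_sqrtr// addr_ge0 ?sqr_ge0. Qed.

Lemma cabs_triangle (R : realType) (z w : R[i]) : cabs (z + w) <= cabs z + cabs w.
Proof. by rewrite -lecR rmorphD -!cabsE ler_normD. Qed.

Lemma cabsM (R : realType) (z w : R[i]) : cabs (z * w) = cabs z * cabs w.
Proof. by apply: (@complexI R); rewrite rmorphM -!cabsE normrM. Qed.

Lemma cabsX (R : realType) (z : R[i]) n : cabs (z ^+ n) = cabs z ^+ n.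
Proof. by apply: (@complexI R); rewrite rmorphXn -!cabsE normrX. Qed.

Lemma cabs_real (R : realType) (x : R) : cabs (real_complex R x) = `|x|.
Proof. by rewrite /cabs normc_def/= expr0n addr0 sqrtr_sqr. Qed.

Lemma cvg_cabs (R : realType) (u : nat -> R[i]) (l : R[i]) :
  u @ \oo --> l -> cabs (u n) @[n --> \oo] --> cabs l.
Proof.
move=> ul; have h : `|u n| @[n --> \oo] --> `|l| by exact: cvg_norm.
exact: (cvg_Re_Im h).1.
Qed.

Lemma parseval_power_sum (R : realType) (c : nat -> R[i]) (r : R) M :
  circle_int (fun t => cabs (\sum_(n < M) (real_complex R r * expi t) ^+ n * c n) ^+ 2) =
  2 * pi * \sum_(n < M) r ^+ n ^+ 2 * cabs (c n) ^+ 2 /\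
  circle_integrable (fun t => cabs (\sum_(n < M) (real_complex R r * expi t) ^+ n * c n) ^+ 2).
Proof.
pose a n := r ^+ n * complex.Re (c n); pose b n := r ^+ n * complex.Im (c n).
have E t : cabs (\sum_(n < M) (real_complex R r * expi t) ^+ n * c n) ^+ 2 =
    trig_sum a (fun n => - b n) M t ^+ 2 + trig_sum b a M t ^+ 2.
  rewrite sqr_cabs (_ : \sum_(n < M) _ = Complex (trig_sum a (fun n => - b n) M t) (trig_sum b a M t)).
    by [].
  rewrite /trig_sum; under eq_bigr do rewrite Re_Im_power_expi.
  elim: M => [|M IH]; first by rewrite !big_ord0.
  rewrite !big_ord_recr/= IH /trig /a /b; apply/eqP; rewrite eq_complex/=.
  by apply/andP; split; apply/eqP; ring.
have ci x y : circle_integrable (fun t => trig_sum x y M t ^+ 2).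
  apply: continuous_circle_integrable => t.
  by apply: (@continuousM _ _ (trig_sum x y M) (trig_sum x y M)); exact: continuous_trig_sum.
under eq_fun do rewrite E.
split; last exact: circle_integrableD.
rewrite circle_intD// !circle_int_sqr_trig_sum -mulrDr -big_split/=.
rewrite -[RHS]mulrA mulrCA; congr (_ * _); rewrite mulr_sumr; apply: eq_bigr => n _.
by rewrite sqr_cabs /energy /a /b; case: ifP => _; ring.
Qed.

(** Parseval's identity on the circle of radius r bounds the sum of r^{2n} |c_n|^2 by B^2, and r
    tends to 1. The identity is applied to the partial sums, which exceed B by at most a geometric
    tail. *)
Lemma bounded_analytic_sqsum (R : realType) (c : nat -> R[i]) (f : R[i] -> R[i]) (B : R) :
  0 <= B ->
  (forall z, `|z| < 1 -> \sum_(k < n) z ^+ k * c k @[n --> \oo] --> f z) ->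
  (forall z, `|z| < 1 -> cabs (f z) <= B) ->
  forall N, \sum_(n < N) cabs (c n) ^+ 2 <= B ^+ 2.
Proof.
move=> B0 cf fB N.
have H r : 0 < r < 1 -> \sum_(n < N) r ^+ n ^+ 2 * cabs (c n) ^+ 2 <= B ^+ 2.
  (* An intermediate radius between r and 1: convergence at rho gives |c_n| rho^n <= 1 eventually,
     hence |c_n| r^n <= q^n with q = r / rho < 1. *)
  move=> /andP[r0 r1]; pose rho := (1 + r) / 2.
  have rho1 : 0 < rho < 1 by rewrite /rho; lra.
  have /andP[rho0 rhol1] := rho1.
  have z1 (x : R) : 0 < x < 1 -> `|real_complex R x| < 1.
    by move=> /andP[x0 x1]; rewrite cabsE cabs_real gtr0_norm// -[1]/(real_complex R 1) ltcR.
  have c0 : cabs (real_complex R rho ^+ n * c n) @[n --> \oo] --> (0 : R).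
    rewrite -(_ : cabs (0 : R[i]) = 0); last by rewrite /cabs normr0.
    apply: cvg_cabs; have h := cf _ (z1 _ rho1).
    have h2 : \sum_(k < n.+1) real_complex R rho ^+ k * c k -
        \sum_(k < n) real_complex R rho ^+ k * c k @[n --> \oo] --> f (real_complex R rho) - f (real_complex R rho).
      apply: cvgB; last exact: h.
      by rewrite (cvg_shiftS (fun n => \sum_(k < n) real_complex R rho ^+ k * c k)).
    rewrite subrr in h2; apply: cvg_trans h2; apply: near_eq_cvg; near=> n.
    by rewrite big_ord_recr/= addrAC subrr add0r.
  move/cvgrPdist_le : c0 => /(_ 1 ltr01)[N0 _ hN0].
  pose q := r / rho.
  have q0 : 0 <= q by rewrite divr_ge0 ?ltW.
  have q1 : q < 1 by rewrite ltr_pdivrMr// mul1r /rho; lra.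
  have term n z : (N0 <= n)%N -> cabs z = r -> cabs (z ^+ n * c n) <= q ^+ n.
    move=> Nn zr; rewrite cabsM cabsX zr.
    have := hN0 n Nn; rewrite sub0r normrN ger0_norm ?cabs_ge0// cabsM cabsX cabs_real (gtr0_norm rho0) => h.
    rewrite /q exprMn exprVn ler_pdivlMr ?exprn_gt0// -mulrA ler_piMr ?exprn_ge0 ?(ltW r0)//.
    by rewrite mulrC.
  pose tau M := q ^+ M / (1 - q).
  have tau0 M : 0 <= tau M by rewrite divr_ge0 ?exprn_ge0// subr_ge0 ltW.
  (* The limit has modulus at most B, and the terms from M on add up to at most q^M / (1 - q). *)
  have SM M t : (N0 <= M)%N ->
      cabs (\sum_(n < M) (real_complex R r * expi t) ^+ n * c n) <= B + tau M.
    move=> NM; set z := real_complex R r * expi t.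
    have zr : cabs z = r.
      by apply: (@complexI R); rewrite -cabsE normr_expi gtr0_norm.
    have zl1 : `|z| < 1 by rewrite cabsE zr -[1]/(real_complex R 1) ltcR.
    have cz := cvg_cabs (cf z zl1).
    have hM' M' : (M <= M')%N -> cabs (\sum_(n < M) z ^+ n * c n) - tau M <=
        cabs (\sum_(n < M') z ^+ n * c n).
      move=> MM'; rewrite lerBlDr.
      have -> : \sum_(n < M) z ^+ n * c n = \sum_(n < M') z ^+ n * c n
          + - 1 * \sum_(M <= n < M') z ^+ n * c n.
        rewrite -!(big_mkord xpredT (fun n => z ^+ n * c n)) (big_cat_nat (n := M) (p := M'))//=.
        by ring.
      apply: le_trans (cabs_triangle _ _) _; rewrite lerD2l cabsM.
      have -> : cabs (-1 : R[i]) = 1 by rewrite /cabs normrN1.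
      rewrite mul1r; apply: (@le_trans _ _ (\sum_(M <= n < M') q ^+ n)).
        rewrite !big_nat; elim/big_ind2 : _ => [|x1 x2 y1 y2 h1 h2|n /andP[Mn _]].
        - by rewrite /cabs normr0.
        - exact: le_trans (cabs_triangle _ _) (lerD h1 h2).
        - by apply: term => //; exact: leq_trans Mn.
      have -> : \sum_(M <= n < M') q ^+ n = (q ^+ M - q ^+ M') / (1 - q).
        have q1' : 1 - q != 0 by rewrite subr_eq0 eq_sym lt_eqF.
        rewrite -(subnKC MM'); elim: (M' - M)%N => [|k IH].
          by rewrite addn0 big_geq// subrr mul0r.
        by rewrite addnS big_nat_recr ?leq_addr//= IH exprS; field.
      by rewrite ler_wpM2r ?invr_ge0 ?subr_ge0 ?(ltW q1)// gerBl exprn_ge0.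
    rewrite -lerBlDr; apply: le_trans (fB z zl1).
    by apply: (cvgr_to_ge cz); exists M => // M' /= MM'; exact: hM'.
  have bound M : (maxn N N0 <= M)%N ->
      \sum_(n < N) r ^+ n ^+ 2 * cabs (c n) ^+ 2 <= (B + tau M) ^+ 2.
    rewrite geq_max => /andP[NM N0M].
    have [IE ci] := parseval_power_sum c r M.
    apply: (@le_trans _ _ (\sum_(n < M) r ^+ n ^+ 2 * cabs (c n) ^+ 2)).
      rewrite -!(big_mkord xpredT (fun n => r ^+ n ^+ 2 * cabs (c n) ^+ 2)).
      rewrite (big_cat_nat (n := N) (p := M))//= lerDl sumr_ge0// => i _.
      by rewrite mulr_ge0// sqr_ge0.
    rewrite -(ler_pM2l (pi2_gt0 R)) -IE -circle_int_cst.
    apply: le_circle_int => //.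
      exact: (continuous_circle_integrable (fun=> cvg_cst _)).
    by move=> t _; rewrite lerXn2r ?nnegrE ?cabs_ge0 ?addr_ge0// SM.
  have ctau : (B + tau M) ^+ 2 @[M --> \oo] --> B ^+ 2.
    have h : B + tau M @[M --> \oo] --> B.
      rewrite -[X in _ --> X]addr0; apply: cvgD; first exact: cvg_cst.
      rewrite -[X in _ --> X](mul0r (1 - q)^-1); apply: cvgM; last exact: cvg_cst.
      by apply: cvg_expr; rewrite ger0_norm.
    by under eq_fun do rewrite expr2; rewrite expr2; exact: cvgM.
  by apply: (cvgr_to_ge ctau); exists (maxn N N0) => // M /= hM; exact: bound.
have cl : \sum_(n < N) r ^+ n ^+ 2 * cabs (c n) ^+ 2 @[r --> (1 : R)^'-] -->
    \sum_(n < N) cabs (c n) ^+ 2.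
  apply: cvg_at_left_filter; elim: N {H} => [|K IH].
    by rewrite big_ord0; under eq_fun do rewrite big_ord0; exact: cvg_cst.
  rewrite big_ord_recr/=; under eq_fun do rewrite big_ord_recr/=.
  apply: cvgD => //; rewrite -[X in _ --> X]mul1r; apply: cvgM; last exact: cvg_cst.
  have h : (fun x : R => x ^+ K ^+ 2) = (fun x => x ^+ (K * 2)).
    by apply/funext => x; rewrite exprM.
  have := @exprn_continuous R (K * 2) 1.
  by rewrite /continuous_at expr1n h.
apply: (cvgr_to_le cl); near=> r; apply: H; apply/andP; split; near: r.
  exact: nbhs_left_gt.
exact: nbhs_left_lt.
Unshelve. all: by end_near. Qed.

Lemma normr_entry_le (R : realType) (m n : nat) (A : 'M[R[i]]_(m, n)) i j :
  `|A i j| <= `|A|.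
Proof.
suff : `|A i j| <= mx_norm A by [].
by rewrite mx_normE -[leLHS]nngE num_le; exact: (le_bigmax _ _ (i, j)).
Qed.

Lemma cvg_big_sum (R : realType) (T I : Type) (F : set_system T) {FF : Filter F}
    (s : seq I) (u : I -> T -> R[i]) (l : I -> R[i]) :
  (forall i, u i x @[x --> F] --> l i) ->
  \sum_(i <- s) u i x @[x --> F] --> \sum_(i <- s) l i.
Proof.
move=> h; elim: s => [|i s IH].
  by rewrite big_nil; under eq_fun do rewrite big_nil; exact: cvg_cst.
by rewrite big_cons; under eq_fun do rewrite big_cons; exact: (cvgD (h i) IH).
Qed.

(** A bounded analytic matrix function has its columns in H^2. This gives Theta its radial limits
    almost everywhere, and Theta times a polynomial is a finite combination of shifted columns. *)
Lemma Hinfty_cols (R : realType) (m : nat) (Theta : R[i] -> 'M[R[i]]_m) :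
  Hinfty Theta ->
  exists C : 'I_m -> hardy R m,
    forall z j, `|z| < 1 -> heval (C j) z = col j (Theta z).
Proof.
move=> [[A hA] [B hB]].
have cA i j z : `|z| < 1 -> \sum_(k < n) z ^+ k * A k i j @[n --> \oo] --> Theta z i j.
  move=> z1; have h : power_series A z n i j @[n --> \oo] --> Theta z i j.
    exact: (cvg_mx_filter _ _).2 (hA z z1) i j.
  apply: cvg_trans h; apply: near_eq_cvg; near=> n.
  by rewrite /power_series seriesEord summxE; apply: eq_bigr => k _; rewrite mxE.
pose B1 := `|complex.Re B|.
have bA i j z : `|z| < 1 -> cabs (Theta z i j) <= B1.
  move=> z1; apply: le_trans (ler_norm _).
  have := le_trans (normr_entry_le (Theta z) i j) (hB z z1).
  by rewrite cabsE lecE/= => /andP[].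
have sA i j := @bounded_analytic_sqsum R (fun n => A n i j) (fun z => Theta z i j) B1
  (normr_ge0 _) (cA i j) (bA i j).
have lA j : (fun n => col j (A n)) \in @l2seq R m.
  apply/asboolP; apply: nondecreasing_is_cvgn.
    by apply/nondecreasing_seqP => n; rewrite !seriesEnat/= big_nat_recr//= lerDl normsqv_ge0.
  exists (\sum_(i < m) B1 ^+ 2) => _ [n _ <-]; rewrite seriesEord/=.
  under eq_bigr do rewrite normsqvE.
  rewrite exchange_big/=; apply: ler_sum => i _; apply: le_trans (sA i j n).
  by apply: ler_sum => k _; rewrite sqr_cabs mxE.
exists (fun j => Hardy (lA j)) => z j z1; apply: heval_eq; apply/cvg_mx_filter => i k.
rewrite mxE; apply: cvg_trans (cA i j z z1); apply: near_eq_cvg; near=> n.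
rewrite -(big_mkord xpredT (fun k => z ^+ k * A k i j)) summxE.
by apply: eq_bigr => l _; rewrite !mxE.
Unshelve. all: by end_near. Qed.

Lemma radial_limitP (R : realType) (m : nat) (Theta : R[i] -> 'M[R[i]]_m) :
  Hinfty Theta ->
  {ae @lebesgue_measure R, forall t, circle t ->
    Theta (real_complex R r * expi t) @[r --> (1 : R)^'-] --> radial_limit Theta t}.
Proof.
move=> /Hinfty_cols[C hC].
have H j : {ae @lebesgue_measure R, forall t, circle t ->
    heval (C j) (real_complex R r * expi t) @[r --> (1 : R)^'-] --> hboundary (C j) t}.
  exact: hboundaryP.
apply: (lebesgue_ae_imply (lebesgue_ae_forall H)) => t ht ct.
have cl : Theta (real_complex R r * expi t) @[r --> (1 : R)^'-] -->
    \matrix_(i, j) hboundary (C j) t i 0.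
  apply/cvg_mx_filter => i j; rewrite mxE.
  have h : heval (C j) (real_complex R r * expi t) i 0 @[r --> (1 : R)^'-] -->
      hboundary (C j) t i 0.
    exact: (cvg_mx_filter _ _).2 (ht j ct) i 0.
  apply: cvg_trans h; apply: near_eq_cvg; near=> r.
  rewrite hC ?mxE// normr_expi gtr0_norm -1?[1]/(real_complex R 1) ?ltcR; near: r.
    exact: nbhs_left_lt.
  exact: nbhs_left_gt.
by apply: cvgP cl.
Unshelve. all: by end_near. Qed.

Lemma hboundary_mult (R : realType) (m : nat) (Theta : R[i] -> 'M[R[i]]_m)
    (F G : hardy R m) : Hinfty Theta -> is_mult Theta F G ->
  {ae @lebesgue_measure R, forall t, circle t ->
    hboundary G t = radial_limit Theta t *m hboundary F t}.
Proof.
move=> hT FG; have hTr := radial_limitP hT.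
apply: (lebesgue_ae_imply (lebesgue_ae_and (hboundaryP F) hTr)) => t [hF hTh] ct.
apply: cvg_lim; first exact: norm_hausdorff.
apply/cvg_mx_filter => i j.
have h : \sum_k Theta (real_complex R r * expi t) i k * heval F (real_complex R r * expi t) k j
    @[r --> (1 : R)^'-] --> \sum_k radial_limit Theta t i k * hboundary F t k j.
  apply: cvg_big_sum => k; apply: cvgM.
    exact: (cvg_mx_filter _ _).2 (hTh ct) i k.
  exact: (cvg_mx_filter _ _).2 (hF ct) k j.
rewrite mxE; apply: cvg_trans h; apply: near_eq_cvg; near=> r.
rewrite FG ?mxE// normr_expi gtr0_norm -1?[1]/(real_complex R 1) ?ltcR; near: r.
  exact: nbhs_left_lt.
exact: nbhs_left_gt.
Unshelve. all: by end_near. Qed.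

Lemma dotvv (R : realType) (m : nat) (u : 'cV[R[i]]_m) :
  dotv u u = real_complex R (normsqv u).
Proof.
have := dotvC u u; rewrite /normsqv; case: (dotv _ _) => a b [] b0.
by have -> : b = 0 by lra.
Qed.

Lemma sesquilinear_eq (R : realType) (V : lmodType R[i]) (h h' : V -> V -> R[i]) :
  (forall c x y z, h (c *: x + y) z = c * h x z + h y z) ->
  (forall x y, h x y = (h y x)^* ) ->
  (forall c x y z, h' (c *: x + y) z = c * h' x z + h' y z) ->
  (forall x y, h' x y = (h' y x)^* ) ->
  (forall x, h x x = h' x x) -> forall x y, h x y = h' x y.
Proof.
move=> hD hC hD' hC' hh x y.
by rewrite [LHS](polarization hD hC) [RHS](polarization hD' hC') !hh.
Qed.

Lemma dotv_isometry (R : realType) (m : nat) (A : 'M[R[i]]_m) (u v : 'cV[R[i]]_m) :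
  is_isometry A -> dotv (A *m u) (A *m v) = dotv u v.
Proof.
move=> hA; pose h u v := dotv (A *m u) (A *m v).
have hD c x y z : h (c *: x + y) z = c * h x z + h y z.
  by rewrite /h mulmxDr -scalemxAr dotvDl.
have hC x y : h x y = (h y x)^* by exact: dotvC.
have hh x : h x x = dotv x x by rewrite /h !dotvv hA.
exact: (sesquilinear_eq hD hC (@dotvDl R m) (@dotvC R m) hh).
Qed.

Lemma dotv_adjoint (R : realType) (m : nat) (A : 'M[R[i]]_m) (u v : 'cV[R[i]]_m) :
  dotv ((map_mx Num.conj A)^T *m u) v = dotv u (A *m v).
Proof.
rewrite /dotv; under eq_bigr do rewrite mxE mulr_suml.
under [RHS]eq_bigr do rewrite mxE rmorph_sum mulr_sumr.
rewrite exchange_big/=; apply: eq_bigr => i _; apply: eq_bigr => j _.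
by rewrite !mxE rmorphM /=; ring.
Qed.

(** The boundary values of Theta F are those of Theta times those of F, and Theta preserves the
    inner product of C^m at almost every boundary point. *)
Lemma hdot_mult (R : realType) (m : nat) (Theta : R[i] -> 'M[R[i]]_m)
    (F G F' G' : hardy R m) : inner_multiplier Theta ->
  is_mult Theta F G -> is_mult Theta F' G' -> hdot G G' = hdot F F'.
Proof.
move=> [hT hi] FG FG'; rewrite !hdotE /L2dot; apply: ae_eq_mean.
have h := lebesgue_ae_and (hboundary_mult hT FG) (hboundary_mult hT FG').
apply: (lebesgue_ae_imply (lebesgue_ae_and hi h)) => t [h0 [h1 h2]] ct.
by rewrite h1// h2// dotv_isometry//; exact: h0.
Qed.

Definition htrunc (R : realType) (m : nat) (F : hardy R m) (N : nat) : hardy R m :=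
  \sum_(j < N) hmono j (coef F j).

Lemma coef_htrunc (R : realType) (m : nat) (F : hardy R m) N n :
  coef (htrunc F N) n = if (n < N)%N then coef F n else 0.
Proof.
rewrite coef_sum; have [nN|Nn] := ltnP n N.
  rewrite (bigD1 (Ordinal nN))//= eqxx big1 ?addr0// => i.
  by rewrite -val_eqE/= eq_sym => /negPf ->.
rewrite big1// => i _ /=; rewrite (_ : n == i = false)//.
by apply/eqP => ni; move: (ltn_ord i); rewrite -ni ltnNge Nn.
Qed.

Lemma sqnorm_htrunc (R : realType) (m : nat) (F : hardy R m) N :
  sqnorm (htrunc F N) <= sqnorm F.
Proof.
apply: sqnorm_le => n; apply: le_trans (sqnorm_le_partial F n).
apply: ler_sum => k _; rewrite coef_htrunc; case: ifP => // _.
rewrite [leLHS](_ : _ = 0) ?normsqv_ge0//.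
by rewrite normsqvE big1// => j _; rewrite mxE/= expr0n addr0.
Qed.

Lemma coef_iter_fshift (R : realType) (m : nat) (F : hardy R m) j n :
  coef (iter j (@fshift R m) F) n = if (n < j)%N then 0 else coef F (n - j).
Proof.
elim: j n => [|j IH] n; first by rewrite /= subn0.
by case: n => [//|n]; rewrite /= IH ltnS subSS.
Qed.

Lemma heval_iter_fshift (R : realType) (m : nat) (F : hardy R m) j z :
  `|z| < 1 -> heval (iter j (@fshift R m) F) z = z ^+ j *: heval F z.
Proof.
move=> z1; elim: j => [|j IH]; first by rewrite expr0 scale1r.
by rewrite iterS heval_fshift// IH scalerA -exprS.
Qed.

Lemma mulmx_col_sum (R : realType) (m n : nat) (A : 'M[R[i]]_(m, n)) (v : 'cV[R[i]]_n) :
  A *m v = \sum_k v k 0 *: col k A.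
Proof.
apply/matrixP => i j; rewrite (ord1 j) mxE summxE; apply: eq_bigr => k _.
by rewrite !mxE mulrC.
Qed.

Lemma heval_at0 (R : realType) (m : nat) (F : hardy R m) : heval F 0 = coef F 0%N.
Proof.
apply: heval_eq; apply: cvg_near_cst; exists 1%N => // -[//|n] _.
rewrite /power_series seriesEord/= big_ord_recl/= expr0 scale1r big1 ?addr0// => i _.
by rewrite expr0n/= scale0r.
Qed.

(** The products [P X N] of Theta with Taylor polynomials of X are bounded by the norm of X because
    Theta is isometric on the boundary, and each of their coefficients is eventually constant. The
    stable coefficients therefore define an element [M X] of H^2. That it has the right values is
    obtained from a recursion under the backward shift, not from an exchange of limits. *)
Lemma exists_mult (R : realType) (m : nat) (Theta : R[i] -> 'M[R[i]]_m)
    (F : hardy R m) : inner_multiplier Theta -> exists G, is_mult Theta F G.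
Proof.
move=> hT; have [C hC] := Hinfty_cols hT.1.
pose col0 (X : hardy R m) n := \sum_k coef X n k 0 *: C k.
have heval_col0 (X : hardy R m) n z : `|z| < 1 ->
    heval (col0 X n) z = Theta z *m coef X n.
  move=> z1; rewrite heval_sum// mulmx_col_sum; apply: eq_bigr => k _.
  by rewrite heval_scale// hC.
pose P (X : hardy R m) N := \sum_(j < N) iter j (@fshift R m) (col0 X j).
have PM (X : hardy R m) N : is_mult Theta (htrunc X N) (P X N).
  move=> z z1; rewrite !heval_sum// mulmx_sumr; apply: eq_bigr => j _.
  by rewrite heval_iter_fshift// heval_col0// heval_hmono scalemxAr.
have Pnorm (X : hardy R m) N : sqnorm (P X N) <= sqnorm X.
  apply: le_trans (sqnorm_htrunc X N); rewrite le_eqVlt; apply/orP; left; apply/eqP.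
  apply: (@complexI R); rewrite -!hdotxx; exact: hdot_mult hT (PM X N) (PM X N).
have PE (X : hardy R m) N n :
    coef (P X N) n = \sum_(j < N) coef (iter j (@fshift R m) (col0 X j)) n.
  exact: coef_sum.
(* A column shifted j times has no coefficient below j, so the n-th coefficient is settled once N
   exceeds n. *)
have coefP' (X : hardy R m) N n : (n < N)%N -> coef (P X N) n = coef (P X n.+1) n.
  move=> nN; rewrite !PE.
  rewrite -!(big_mkord xpredT (fun j => coef (iter j (@fshift R m) (col0 X j)) n)).
  rewrite (big_cat_nat (n := n.+1))//= [X in _ + X]big1_seq ?addr0// => j.
  rewrite mem_index_iota => /andP[_ /andP[nj _]].
  by rewrite coef_iter_fshift nj.
have lM (X : hardy R m) : (fun n => coef (P X n.+1) n) \in @l2seq R m.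
  apply/asboolP; apply: nondecreasing_is_cvgn.
    by apply/nondecreasing_seqP => n; rewrite !seriesEnat/= big_nat_recr//= lerDl normsqv_ge0.
  exists (sqnorm X) => _ [n _ <-]; rewrite seriesEord/=.
  apply: le_trans (Pnorm X n); apply: le_trans (sqnorm_le_partial _ n).
  by apply: ler_sum => k _; rewrite coefP'.
pose M X := Hardy (lM X).
have Mnorm (X : hardy R m) : sqnorm (M X) <= sqnorm X.
  apply: sqnorm_le => n; apply: le_trans (Pnorm X n).
  apply: le_trans (sqnorm_le_partial _ n).
  by apply: ler_sum => k _; rewrite [coef (P X n) k]coefP'.
have Mrec (X : hardy R m) : M X = col0 X 0%N + fshift (M (bshift X)).
  apply: hardy_ext => -[|n].
    by rewrite coefD -[LHS]/(coef (P X 1) 0) PE big_ord1 addr0.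
  rewrite coefD -[LHS]/(coef (P X n.+2) n.+1) -[coef (fshift _) n.+1]/(coef (P (bshift X) n.+1) n).
  rewrite !PE big_ord_recl; congr (_ + _); exact: eq_bigr.
exists (M F) => z z1.
(* The error at z satisfies E X = z E(S^*X), hence E F is z^N times the error of the N-th backward
   shift of F. Those shifts have norm at most that of F, so their errors are bounded by a constant L
   and |z|^N L tends to 0. *)
pose E (X : hardy R m) := heval (M X) z - Theta z *m heval X z.
have Erec (X : hardy R m) : E X = z *: E (bshift X).
  have hF : heval X z = coef X 0%N + z *: heval (bshift X) z.
    by rewrite heval_bshift// heval_at0 addrC subrK.
  rewrite /E Mrec -[col0 X 0%N]scale1r hevalP// heval_fshift// scale1r heval_col0//.
  by rewrite hF mulmxDr -scalemxAr scalerBr opprD addrACA subrr add0r.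
have iterE (E' : hardy R m -> 'cV[R[i]]_m) N : (forall X, E' X = z *: E' (bshift X)) ->
    E' F = z ^+ N *: E' (iter N (@bshift R m) F).
  move=> h; elim: N => [|N IH]; first by rewrite expr0 scale1r.
  by rewrite IH h scalerA -exprSr.
have Eiter N : E F = z ^+ N *: E (iter N (@bshift R m) F) := iterE E N Erec.
have bnorm (G : hardy R m) : sqnorm (bshift G) <= sqnorm G.
  apply: sqnorm_le => n; apply: le_trans (sqnorm_le_partial G n.+1).
  by rewrite big_ord_recl lerDr normsqv_ge0.
have itnorm N : sqnorm (iter N (@bshift R m) F) <= sqnorm F.
  by elim: N => [//|N IH]; exact: le_trans (bnorm _) IH.
(* Cauchy-Schwarz against the reproducing kernel; x <= 1 + x^2 spares the square root, since any
   bound uniform in G will do. *)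
have ev (G : hardy R m) k : sqnorm G <= sqnorm F ->
    cabs (heval G z k 0) <= 1 + sqnorm F * sqnorm (szego k z1).
  move=> GF; rewrite -hdot_szego.
  have := hdot_cauchy_schwarz G (szego k z1).
  rewrite !hdotxx -rmorphM cabsE -rmorphXn lecR => h.
  apply: (@le_trans _ _ (1 + cabs (hdot G (szego k z1)) ^+ 2)).
    have := sqr_ge0 (cabs (hdot G (szego k z1)) - 2^-1).
    by set x := cabs _; nra.
  by rewrite lerD2l; apply: le_trans h _; rewrite ler_wpM2r// sqnorm_ge0.
apply/eqP; rewrite -subr_eq0; apply/eqP; rewrite -/(E F).
apply/matrixP => k j; rewrite (ord1 j) [RHS]mxE.
pose K (i : 'I_m) := 1 + sqnorm F * sqnorm (szego i z1).
pose L := K k + \sum_i cabs (Theta z k i) * K i.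
have bound N : cabs (E F k 0) <= cabs z ^+ N * L.
  rewrite (Eiter N) mxE cabsM cabsX ler_wpM2l ?exprn_ge0 ?cabs_ge0//.
  set G := iter N _ F; have GF : sqnorm G <= sqnorm F by exact: itnorm.
  rewrite /E 2!mxE; apply: le_trans (cabs_triangle _ _) _; apply: lerD.
    by apply: ev; exact: le_trans (Mnorm G) GF.
  have -> : cabs (- (Theta z *m heval G z) k 0) = cabs ((Theta z *m heval G z) k 0).
    by rewrite /cabs normrN.
  rewrite mxE; elim/big_ind2 : _ => [|x1 x2 y1 y2 h1 h2|i _].
  - by rewrite /cabs normr0.
  - exact: le_trans (cabs_triangle _ _) (lerD h1 h2).
  - by rewrite cabsM ler_wpM2l ?cabs_ge0//; exact: ev.
have zz : cabs z < 1 by have := z1; rewrite cabsE -[1]/(real_complex R 1) ltcR.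
have c0 : cabs z ^+ N * L @[N --> \oo] --> (0 : R).
  rewrite -[X in _ --> X](mul0r L); apply: cvgM; last exact: cvg_cst.
  by apply: cvg_expr; rewrite ger0_norm ?cabs_ge0.
have e0 : cabs (E F k 0) <= 0 by apply: (cvgr_to_ge c0); near=> N; exact: bound.
exact: cabs_le0_eq0.
Unshelve. all: by end_near. Qed.

(** * Inner multipliers, Toeplitz operators and model spaces *)

Lemma hmultP (R : realType) (m : nat) (Theta : R[i] -> 'M[R[i]]_m) (F : hardy R m) :
  inner_multiplier Theta -> is_mult Theta F (hmult Theta F).
Proof. by move=> hT; have [G hG] := exists_mult F hT; exact: (xgetPex 0 (ex_intro _ G hG)). Qed.

Lemma L2dot_sub_hboundary (R : realType) (m : nat) (f : R -> 'cV[R[i]]_m)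
    (G K : hardy R m) :
  circle_cintegrable (fun t => dotv (f t) (hboundary K t)) ->
  L2dot (f \- hboundary G) (hboundary K) = L2dot f (hboundary K) - hdot G K.
Proof.
move=> hf; rewrite hdotE /L2dot.
have := (circle_cintegrableP (-1) (cintegrable_dotv G K) hf).2.
rewrite mulN1r addrC => <-; congr mean; apply/funext => t.
by rewrite -dotvDl scaleN1r addrC.
Qed.

(** Two candidates differ by a member of M that is orthogonal to itself. Integrability of the
    pairings of f with M is what allows the difference in [oproj] to be split. *)
Lemma oproj_unique (R : realType) (m : nat) (M : set (hardy R m))
    (f : R -> 'cV[R[i]]_m) (G : hardy R m) :
  linear_subspace M ->
  (forall K, M K -> circle_cintegrable (fun t => dotv (f t) (hboundary K t))) ->
  M G -> (forall K, M K -> L2dot f (hboundary K) = hdot G K) ->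
  oproj M f = G.
Proof.
move=> [M0 ML] hf MG hG.
have GP : M G /\ forall K, M K -> L2dot (f \- hboundary G) (hboundary K) = 0.
  by split => // K MK; rewrite L2dot_sub_hboundary ?hG ?subrr//; exact: hf.
have ex : exists G', [set G | M G /\
    forall K, M K -> L2dot (f \- hboundary G) (hboundary K) = 0] G' by exists G.
have [] := xgetPex 0 ex; rewrite -/(oproj M f).
set G' := oproj M f => MG' hG'.
apply/eqP; rewrite -subr_eq0; apply/eqP; apply: hdotxx_eq0.
have MD : M (G' - G) by rewrite addrC -scaleN1r; exact: ML.
rewrite hdotBl -(hG _ MD); have := hG' _ MD; rewrite L2dot_sub_hboundary; last exact: hf.
by move=> /eqP; rewrite subr_eq0 => /eqP ->; rewrite subrr.
Qed.

#[local] Opaque hmult oproj.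

Lemma is_mult_hmult (R : realType) (m : nat) (Theta : R[i] -> 'M[R[i]]_m) (F G : hardy R m) :
  inner_multiplier Theta -> is_mult Theta F G -> G = hmult Theta F.
Proof.
move=> hT FG; apply: heval_inj => z z1.
by rewrite FG//; have := hmultP F hT; move=> ->.
Qed.

Lemma hmult_fshift (R : realType) (m : nat) (Theta : R[i] -> 'M[R[i]]_m) (F : hardy R m) :
  inner_multiplier Theta -> hmult Theta (fshift F) = fshift (hmult Theta F).
Proof.
move=> hT; apply/esym; apply: is_mult_hmult => // z z1.
by rewrite !heval_fshift// (hmultP F hT z1) scalemxAr.
Qed.

Lemma hmultZD (R : realType) (m : nat) (Theta : R[i] -> 'M[R[i]]_m) c (F G : hardy R m) :
  inner_multiplier Theta -> hmult Theta (c *: F + G) = c *: hmult Theta F + hmult Theta G.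
Proof.
move=> hT; apply/esym; apply: is_mult_hmult => // z z1.
by rewrite !hevalP// (hmultP F hT z1) (hmultP G hT z1) mulmxDr scalemxAr.
Qed.

Lemma hdot_hmult (R : realType) (m : nat) (Theta : R[i] -> 'M[R[i]]_m) (F G : hardy R m) :
  inner_multiplier Theta -> hdot (hmult Theta F) (hmult Theta G) = hdot F G.
Proof. by move=> hT; exact: (hdot_mult hT (hmultP F hT) (hmultP G hT)). Qed.

Lemma hmult0 (R : realType) (m : nat) (Theta : R[i] -> 'M[R[i]]_m) :
  inner_multiplier Theta -> hmult Theta (0 : hardy R m) = 0.
Proof. by move=> hT; apply: hdotxx_eq0; rewrite hdot_hmult// hdot0l. Qed.

Lemma hmult_sum (R : realType) (m : nat) (Theta : R[i] -> 'M[R[i]]_m) (I : Type)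
    (s : seq I) (F : I -> hardy R m) : inner_multiplier Theta ->
  hmult Theta (\sum_(i <- s) F i) = \sum_(i <- s) hmult Theta (F i).
Proof.
move=> hT; elim: s => [|i s IH]; first by rewrite !big_nil hmult0.
by rewrite !big_cons -[F i in LHS]scale1r hmultZD// scale1r IH.
Qed.

Lemma sqnorm_sub_htrunc (R : realType) (m : nat) (K : hardy R m) N :
  sqnorm (K - htrunc K N) <= sqnorm K - \sum_(n < N) normsqv (coef K n).
Proof.
apply: sqnorm_le => n; rewrite lerBrDr.
have c k : normsqv (coef (K - htrunc K N) k) = if (k < N)%N then 0 else normsqv (coef K k).
  rewrite coefD -[coef (- _) k]/(- coef (htrunc K N) k) coef_htrunc; case: ifP => _.
    by rewrite subrr normsqvE big1// => j _; rewrite mxE/= expr0n addr0.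
  by rewrite subr0.
apply: le_trans (sqnorm_le_partial K (maxn n N)).
rewrite -!(big_mkord xpredT (fun k => normsqv (coef K k))).
rewrite -(big_mkord xpredT (fun k => normsqv (coef (K - htrunc K N) k))).
rewrite [leRHS](big_cat_nat (n := N)) ?leq_maxr//= addrC; apply: lerD => //.
have [nN|Nn] := leqP n N.
  rewrite big1_seq ?sumr_ge0// => [k _|k]; first exact: normsqv_ge0.
  by rewrite mem_index_iota c => /andP[_ /andP[_ kn]]; rewrite (leq_trans kn nN).
rewrite (big_cat_nat (n := N)) ?(ltnW Nn)//=.
rewrite [X in X + _ <= _]big1_seq ?add0r => [|k].
  by apply: ler_sum_nat => k /andP[Nk _]; rewrite c ltnNge Nk.
by rewrite mem_index_iota c => /andP[_ /andP[_ ->]].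
Qed.

Lemma sqrrD_le (R : realType) (a b : R) : (a + b) ^+ 2 <= 2 * (a ^+ 2 + b ^+ 2).
Proof. by have := sqr_ge0 (a - b); nra. Qed.

(* Riesz representation of K |-> <F, Theta K>, by Bessel's inequality for the
   orthonormal system Theta z^n e_k. *)
Lemma exists_adjoint (R : realType) (m : nat) (Theta : R[i] -> 'M[R[i]]_m)
    (F : hardy R m) : inner_multiplier Theta ->
  exists G, forall K, hdot G K = hdot F (hmult Theta K).
Proof.
move=> hT.
pose g n : 'cV[R[i]]_m := \col_k hdot F (hmult Theta (hmono n (delta_mx k 0))).
have gE n v : hdot F (hmult Theta (hmono n v)) = dotv (g n) v.
  have -> : hmono n v = \sum_k v k 0 *: hmono n (delta_mx k 0).
    apply: hardy_ext => j; rewrite coef_sum.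
    under eq_bigr do rewrite coefZ.
    rewrite /hmono /=; case: ifP => _; last by rewrite big1// => k _; rewrite scaler0.
    apply/matrixP => i j'; rewrite (ord1 j') summxE (bigD1 i)//= big1 ?addr0.
      by rewrite !mxE !eqxx mulr1.
    by move=> k ki; rewrite !mxE eq_sym (negPf ki) mulr0.
  rewrite hmult_sum// hdot_sumr /dotv; apply: eq_bigr => k _.
  rewrite -[v k 0 *: hmono _ _]addr0 hmultZD// hmult0// addr0 hdotZr mulrC.
  by rewrite mxE.
pose p N := \sum_(n < N) hmono n (g n).
have pK N (K : hardy R m) : hdot K (p N) = \sum_(n < N) dotv (coef K n) (g n).
  by rewrite hdot_sumr; apply: eq_bigr => n _; rewrite hdot_hmono.
have coefp N n : coef (p N) n = if (n < N)%N then g n else 0.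
  rewrite coef_sum; have [nN|Nn] := ltnP n N.
    rewrite (bigD1 (Ordinal nN))//= eqxx big1 ?addr0// => i.
    by rewrite -val_eqE/= eq_sym => /negPf ->.
  rewrite big1// => i _ /=; rewrite (_ : n == i = false)//.
  by apply/eqP => ni; move: (ltn_ord i); rewrite -ni ltnNge Nn.
pose s N : R := \sum_(n < N) normsqv (g n).
have pp N : hdot (p N) (p N) = real_complex R (s N).
  rewrite pK /s rmorph_sum; apply: eq_bigr => n _.
  by rewrite coefp ltn_ord dotvv.
have Fp N : hdot F (hmult Theta (p N)) = real_complex R (s N).
  rewrite hmult_sum// hdot_sumr /s rmorph_sum; apply: eq_bigr => n _.
  by rewrite gE dotvv.
(* Bessel's inequality: with Q = Theta p_N both <F, Q> and <Q, Q> equal s N, so 0 <= <F - Q, F - Q>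
   is the norm squared of F minus s N. *)
have sF N : s N <= sqnorm F.
  pose Q := hmult Theta (p N).
  have QQ : hdot Q Q = real_complex R (s N) by rewrite /Q hdot_hmult.
  have QF : hdot Q F = real_complex R (s N).
    by rewrite (hdotC Q F) Fp; exact: conjc_real.
  have E : hdot (F - Q) (F - Q) = real_complex R (sqnorm F - s N).
    rewrite (hdotBl F Q) (hdotBr F Q F) (hdotBr F Q Q) QF QQ (Fp N) hdotxx.
    by rewrite rmorphB subrr subr0.
  have := sqnorm_ge0 (F - Q).
  by rewrite (complexI (etrans (esym (hdotxx _)) E)) subr_ge0.
have lg : g \in @l2seq R m.
  apply/asboolP; apply: nondecreasing_is_cvgn.
    by apply/nondecreasing_seqP => n; rewrite !seriesEnat/= big_nat_recr//= lerDl normsqv_ge0.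
  by exists (sqnorm F) => _ [n _ <-]; rewrite seriesEord/=; exact: sF.
pose G := Hardy lg; exists G => K.
have GF N : hdot G (htrunc K N) = hdot F (hmult Theta (htrunc K N)).
  rewrite hdot_sumr hmult_sum// hdot_sumr; apply: eq_bigr => n _.
  by rewrite hdot_hmono gE.
(* The two functionals agree on polynomials, so their difference d at K is unchanged when K is
   replaced by its tail [X N]; both are bounded and the tails tend to 0 in norm. *)
pose d := hdot G K - hdot F (hmult Theta K).
pose X N := K - htrunc K N.
have dX N : d = hdot G (X N) - hdot F (hmult Theta (X N)).
  have -> : hdot G (X N) = hdot G K - hdot G (htrunc K N) := hdotBr K (htrunc K N) G.
  have -> : hmult Theta (X N) = hmult Theta K - hmult Theta (htrunc K N).
    have -> : X N = (- 1) *: htrunc K N + K by rewrite scaleN1r addrC.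
    by rewrite (hmultZD (- 1) (htrunc K N) K hT) scaleN1r addrC.
  rewrite (hdotBr (hmult Theta K) (hmult Theta (htrunc K N)) F) (GF N) /d.
  by rewrite opprB addrA subrK.
have cs (Y Z : hardy R m) : cabs (hdot Y Z) ^+ 2 <= sqnorm Y * sqnorm Z.
  by have := hdot_cauchy_schwarz Y Z; rewrite !hdotxx -rmorphM cabsE -rmorphXn lecR.
have db N : cabs d ^+ 2 <= 2 * (sqnorm G + sqnorm F) * sqnorm (X N).
  have h1 := cs G (X N).
  have h2 : cabs (hdot F (hmult Theta (X N))) ^+ 2 <= sqnorm F * sqnorm (X N).
    apply: le_trans (cs _ _) _.
    have -> : sqnorm (hmult Theta (X N)) = sqnorm (X N).
      by apply: (@complexI R); rewrite -!hdotxx hdot_hmult.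
    by [].
  rewrite (dX N); set x := hdot G _ in h1 *; set y := hdot F _ in h2 *.
  have h3 : cabs (x - y) <= cabs x + cabs y.
    apply: le_trans (cabs_triangle _ _) _.
    by rewrite (_ : cabs (- y) = cabs y)// /cabs normrN.
  apply: (@le_trans _ _ ((cabs x + cabs y) ^+ 2)).
    by rewrite lerXn2r ?nnegrE ?addr_ge0 ?cabs_ge0.
  apply: le_trans (sqrrD_le _ _) _.
  by rewrite -mulrA ler_wpM2l// mulrDl lerD.
have c0 : 2 * (sqnorm G + sqnorm F) * (sqnorm K - \sum_(n < N) normsqv (coef K n))
    @[N --> \oo] --> (0 : R).
  rewrite -[X in _ --> X](mulr0 (2 * (sqnorm G + sqnorm F))); apply: cvgM; first exact: cvg_cst.
  rewrite -[X in _ --> X](subrr (sqnorm K)); apply: cvgB; first exact: cvg_cst.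
  rewrite (_ : (fun N => _) = series (fun n => normsqv (coef K n))); last by rewrite seriesEord.
  by have /asboolP := coefP K.
have d0 : cabs d ^+ 2 <= 0.
  apply: (cvgr_to_ge c0); near=> N; apply: le_trans (db N) _.
  rewrite ler_wpM2l ?sqnorm_sub_htrunc//.
  by rewrite mulr_ge0// addr_ge0 ?sqnorm_ge0.
apply/eqP; rewrite -subr_eq0; apply/eqP; apply: cabs_le0_eq0; rewrite -/d.
by rewrite le_eqVlt -sqrf_eq0 eq_le d0 sqr_ge0.
Unshelve. all: by end_near. Qed.

(** The projection in [toeplitz] is a choice from a set that must be shown inhabited. The vector
    given by [exists_adjoint] belongs to it, because the pointwise adjoint moves Theta to the other
    side at almost every boundary point. *)
Lemma hdot_toeplitz_adjoint (R : realType) (m : nat) (Theta : R[i] -> 'M[R[i]]_m)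
    (F K : hardy R m) : inner_multiplier Theta ->
  hdot (toeplitz (boundary_adjoint Theta) F) K = hdot F (hmult Theta K).
Proof.
move=> hT; have [G hG] := exists_adjoint F hT.
have ae (L : hardy R m) : {ae @lebesgue_measure R, forall t, circle t ->
    dotv (boundary_adjoint Theta t *m hboundary F t) (hboundary L t) =
    dotv (hboundary F t) (hboundary (hmult Theta L) t)}.
  apply: (lebesgue_ae_imply (hboundary_mult hT.1 (hmultP L hT))) => t h ct.
  by rewrite dotv_adjoint h.
rewrite -hG; congr (hdot _ K); apply: oproj_unique; [by []| |by []|].
- move=> L _; have [p [q [ip iq h]]] := cintegrable_dotv F (hmult Theta L).
  exists p, q; split; [exact: ip|exact: iq|].
  by apply: (lebesgue_ae_imply (lebesgue_ae_and (ae L) h)) => t [e1 e2] ct; rewrite (e1 ct) (e2 ct).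
- by move=> L _; rewrite hG hdotE /L2dot; exact: ae_eq_mean.
Qed.

Lemma model_space_linear (R : realType) (m : nat) (Theta : R[i] -> 'M[R[i]]_m) :
  linear_subspace (@model_space R m Theta).
Proof.
split=> [G _|c F G hF hG K hK]; first by rewrite hdot0l.
by rewrite hdotDl hF// hG// mulr0 addr0.
Qed.

(** On H^2 the projection onto the model space is G - Theta T_{Theta^*} G, by the adjoint relation
    and the isometry of multiplication by Theta. *)
Lemma oproj_model_space (R : realType) (m : nat) (Theta : R[i] -> 'M[R[i]]_m)
    (G : hardy R m) : inner_multiplier Theta ->
  model_space Theta (oproj (model_space Theta) (hboundary G)) /\
  forall F, model_space Theta F ->
    hdot F (oproj (model_space Theta) (hboundary G)) = hdot F G.
Proof.
move=> hT; pose P := G - hmult Theta (toeplitz (boundary_adjoint Theta) G).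
have MP : model_space Theta P.
  move=> _ [Y /(is_mult_hmult hT) ->].
  by rewrite hdotBl hdot_hmult// hdot_toeplitz_adjoint// subrr.
have FP F : model_space Theta F -> hdot F P = hdot F G.
  set T := toeplitz _ G in P MP * => hF.
  rewrite (hdotBr G (hmult Theta T) F) (hF (hmult Theta T)) ?subr0//.
  by exists T; exact: hmultP.
have -> : oproj (model_space Theta) (hboundary G) = P; last by split.
apply: oproj_unique.
- exact: model_space_linear.
- by move=> K _; exact: cintegrable_dotv.
- exact: MP.
- by move=> K MK; rewrite -hdotE hdotC [RHS]hdotC FP.
Qed.

(** Gram-Schmidt along the list. Membership of X in the span is expressed as membership in every
    subspace S containing the list, so that one X can be placed in several subspaces. *)
Lemma exists_finite_projection (R : realType) (m : nat) (s : seq (hardy R m))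
    (F : hardy R m) :
  exists X, (forall S, linear_subspace S -> (forall v, v \in s -> S v) -> S X) /\
    (forall v, v \in s -> hdot (F - X) v = 0).
Proof.
elim: s F => [|v s IH] F.
  by exists 0; split => // S [].
have [X [XS XF]] := IH F; have [Y [YS YF]] := IH v.
pose v' := v - Y; pose F' := F - X.
have orthS (Z : hardy R m) : (forall w, w \in s -> hdot Z w = 0) -> hdot Z Y = 0.
  move=> hZ; apply: (YS [set w | hdot Z w = 0]); last exact: hZ.
  split => [|c A B hA hB].
    exact: hdot0r.
  by rewrite /mkset (hdotDr c A B Z) hA hB mulr0 addr0.
have vE : v = v' + Y by rewrite /v' subrK.
(* If v already depends on the rest of the list then v' = 0 and the quotient is 0 by convention; the
   new orthogonality condition is then trivial. *)
pose al := hdot F' v' / hdot v' v'.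
exists (al *: v' + X); split => [S lS hS|w].
  have Ss w : w \in s -> S w by move=> ws; apply: hS; rewrite inE ws orbT.
  apply: lS.2; last by apply: XS; [exact: lS|exact: Ss].
  rewrite /v' addrC -scaleN1r; apply: lS.2; first by apply: YS; [exact: lS|exact: Ss].
  by apply: hS; rewrite inE eqxx.
have -> : F - (al *: v' + X) = (- al) *: v' + F'.
  by rewrite /F' opprD scaleNr addrCA.
have orth w' : w' \in s -> hdot ((- al) *: v' + F') w' = 0.
  by move=> ws; rewrite hdotDl YF// XF// mulr0 addr0.
rewrite inE => /predU1P[->|]; last exact: orth.
rewrite vE hdotAr (orthS _ orth) addr0 hdotDl.
have [v0|v0] := eqVneq (hdot v' v') 0; last by rewrite mulNr /al divfK// addNr.
by rewrite (hdotxx_eq0 v0) !hdot0r mulr0 addr0.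
Qed.

(** * Closed orthogonal complements and linear spans *)

Lemma orthogonal_closed (R : realType) (m : nat) (I : Type) (W : I -> hardy R m) :
  closed_subspace [set F | forall i, hdot F (W i) = 0].
Proof.
split.
  split=> [i|c F G hF hG i]; first by rewrite hdot0l.
  by rewrite hdotDl hF hG mulr0 addr0.
move=> F_ F hF cF i.
have cs k : cabs (hdot F (W i)) <= hnorm (F_ k - F) * Num.sqrt (sqnorm (W i)).
  have -> : cabs (hdot F (W i)) = cabs (hdot (F_ k - F) (W i)).
    by rewrite hdotBl hF sub0r /cabs normrN.
  rewrite /hnorm hdotxx -sqrtrM ?sqnorm_ge0// -(ger0_norm (cabs_ge0 _)) -sqrtr_sqr.
  rewrite ler_wsqrtr//.
  by have := hdot_cauchy_schwarz (F_ k - F) (W i); rewrite !hdotxx -rmorphM cabsE -rmorphXn lecR.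
have c0 : hnorm (F_ k - F) * Num.sqrt (sqnorm (W i)) @[k --> \oo] --> (0 : R).
  by rewrite -[X in _ --> X](mul0r (Num.sqrt (sqnorm (W i)))); apply: cvgM => //; exact: cvg_cst.
have e0 : cabs (hdot F (W i)) <= 0 by apply: (cvgr_to_ge c0); near=> k; exact: cs.
exact: cabs_le0_eq0.
Unshelve. all: by end_near. Qed.

Lemma lspan_linear (R : realType) (m : nat) (A : set (hardy R m)) :
  linear_subspace (lspan A).
Proof.
split.
  by exists 0%N, (fun=> 0), (fun=> 0); split => [[]//|]; rewrite big_ord0.
move=> c F G [k [a [V [AV ->]]]] [k' [a' [V' [AV' ->]]]].
exists (k + k')%N,
  (fun i : 'I_(k + k')%N => match fintype.split i with inl j => c * a j | inr j => a' j end),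
  (fun i : 'I_(k + k')%N => match fintype.split i with inl j => V j | inr j => V' j end); split.
  by move=> i; case: (fintype.split i).
rewrite big_split_ord/= scaler_sumr; congr (_ + _); apply: eq_bigr => i _.
  by case: splitP => j /= ij; [rewrite scalerA (ord_inj ij)|
    have := ltn_ord i; rewrite ij ltnNge leq_addr].
case: splitP => j /= ij; last by rewrite (ord_inj (addnI ij)).
by have := ltn_ord j; rewrite -ij ltnNge leq_addr.
Qed.

Lemma lspan_incl (R : realType) (m : nat) (A : set (hardy R m)) F : A F -> lspan A F.
Proof.
move=> AF; exists 1%N, (fun=> 1), (fun=> F); split => //.
by rewrite big_ord1 scale1r.
Qed.

Lemma linear_subspace_sum (R : realType) (m : nat) (S : set (hardy R m)) (I : Type)
    (s : seq I) (c : I -> R[i]) (V : I -> hardy R m) :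
  linear_subspace S -> (forall i, S (V i)) -> S (\sum_(i <- s) c i *: V i).
Proof.
move=> [S0 SL] hV; elim: s => [|i s IH]; first by rewrite big_nil.
by rewrite big_cons; exact: SL.
Qed.

Lemma hdot_suml_eq (R : realType) (m : nat) (I : Type) (s : seq I) (F : I -> hardy R m)
    (c : I -> R[i]) (K : hardy R m) :
  (forall i, hdot (F i) K = c i) -> hdot (\sum_(i <- s) F i) K = \sum_(i <- s) c i.
Proof. by move=> h; rewrite hdot_suml; congr bigop; apply/funext => i; rewrite h. Qed.

Lemma hdot_sumr_eq (R : realType) (m : nat) (I : Type) (s : seq I) (F : I -> hardy R m)
    (c : I -> R[i]) (K : hardy R m) :
  (forall i, hdot K (F i) = c i) -> hdot K (\sum_(i <- s) F i) = \sum_(i <- s) c i.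
Proof. by move=> h; rewrite hdot_sumr; congr bigop; apply/funext => i; rewrite h. Qed.

(** * The kernel of the perturbed operator *)

Lemma hdot_perturbed (R : realType) (m n : nat) (Theta : R[i] -> 'M[R[i]]_m)
    (G H : 'I_n -> hardy R m) (F K : hardy R m) : inner_multiplier Theta ->
  hdot (perturbed Theta G H F) K =
  hdot F (hmult Theta K + \sum_i (hdot (H i) K)^* *: G i).
Proof.
move=> hT; rewrite /perturbed hdotAl hdot_toeplitz_adjoint// hdotAr.
have e1 (i : 'I_n) : hdot (hdot F (G i) *: H i) K = hdot F (G i) * hdot (H i) K.
  exact: hdotZl.
have e2 (i : 'I_n) : hdot F ((hdot (H i) K)^* *: G i) = hdot F (G i) * hdot (H i) K.
  by rewrite hdotZr conjCK; exact: mulrC.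
by rewrite (hdot_suml_eq _ e1) (hdot_sumr_eq _ e2).
Qed.

(** The kernel is the orthogonal complement of the range of the adjoint operator, whose values are
    the vectors Theta K + sum_i <K, H_i> G_i. *)
Lemma kernel_perturbed_closed (R : realType) (m n : nat) (Theta : R[i] -> 'M[R[i]]_m)
    (G H : 'I_n -> hardy R m) : inner_multiplier Theta ->
  closed_subspace (kernel_set (perturbed Theta G H)).
Proof.
move=> hT; rewrite (_ : kernel_set _ = [set F | forall K : hardy R m,
    hdot F (hmult Theta K + \sum_i (hdot (H i) K)^* *: G i) = 0]).
  exact: orthogonal_closed.
apply/seteqP; split => [F /= hF K|F /= hF].
  by rewrite -hdot_perturbed// hF hdot0l.
by apply: hdot_nondegenerate => K; rewrite hdot_perturbed.
Qed.

(** The predicate J marks the indices whose G_j may lie outside Theta H^2, so that both cases of the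
    theorem are instances. An unmarked G_j is orthogonal to the model space and requires no
    correction. *)
Lemma perturbed_kernel_decomposition (R : realType) (m n : nat)
    (Theta : R[i] -> 'M[R[i]]_m) (G H : 'I_n -> hardy R m) (J : pred 'I_n) :
  inner_multiplier Theta -> (forall j, ~~ J j -> mult_range Theta (G j)) ->
  forall F, kernel_set (perturbed Theta G H) F -> exists F1 F2,
    [/\ kernel_set (perturbed Theta G H) F1,
        lspan ([set hmult Theta (bshift (H i)) | i in [set: 'I_n]] `|`
          [set oproj (model_space Theta) (hboundary (G j)) | j in [set j | J j]]) F2 &
        bshift F = F1 + F2].
Proof.
move=> hT hG F hF; set A := _ `|` _.
have lA := lspan_linear A.
pose P j := oproj (model_space Theta) (hboundary (G j)).
pose Q := \sum_i hdot F (G i) *: hmult Theta (bshift (H i)).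
pose F0 := bshift F + Q.
have F0M : model_space Theta F0.
  move=> _ [K /(is_mult_hmult hT) ->].
  have e1 (i : 'I_n) : hdot (hdot F (G i) *: hmult Theta (bshift (H i))) (hmult Theta K) =
      hdot F (G i) * hdot (H i) (fshift K).
    exact: etrans (hdotZl _ _ _) (congr1 ( *%R _)
      (etrans (hdot_hmult _ _ hT) (hdot_bshift _ _))).
  have e2 (i : 'I_n) : hdot F ((hdot (H i) (fshift K))^* *: G i) =
      hdot F (G i) * hdot (H i) (fshift K).
    by rewrite hdotZr conjCK; exact: mulrC.
  rewrite hdotAl hdot_bshift -hmult_fshift// (hdot_suml_eq _ e1).
  have := hdot_perturbed G H F (fshift K) hT.
  by rewrite hF hdot0l hdotAr (hdot_sumr_eq _ e2).
(* X is placed in two subspaces: in the model space, which keeps F0 - X there, and in the defect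
   space, which takes X up. *)
have [X [XS XF]] := exists_finite_projection [seq P j | j <- enum J] F0.
have Ps w : w \in [seq P j | j <- enum J] -> exists2 j, J j & w = P j.
  by move=> /mapP[j]; rewrite mem_enum => Jj ->; exists j.
have XM : model_space Theta X.
  apply: XS; first exact: model_space_linear.
  by move=> w /Ps[j _ ->]; exact: (oproj_model_space (G j) hT).1.
have lX : lspan A X.
  apply: XS => // w /Ps[j Jj ->]; apply: lspan_incl; right; exists j => //.
have lQ : lspan A Q.
  by apply: linear_subspace_sum => // i; apply: lspan_incl; left; exists i.
have F1M : model_space Theta (F0 - X).
  by rewrite addrC -scaleN1r; apply: (model_space_linear Theta).2.
exists (F0 - X), (- 1 *: Q + X); split.
- apply: hdot_nondegenerate => K; rewrite hdot_perturbed// hdotAr.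
  rewrite F1M ?add0r; last by exists K; exact: hmultP.
  rewrite hdot_sumr big1// => i _; rewrite hdotZr.
  have -> : hdot (F0 - X) (G i) = 0; last by rewrite mulr0.
  (* For a marked index, G_i may be replaced by its projection because F0 - X lies in the model
     space; for an unmarked one, G_i lies in Theta H^2. *)
  have [Ji|Ji] := boolP (J i); last by apply: F1M; exact: hG.
  rewrite -(oproj_model_space (G i) hT).2//; apply: XF.
  by apply/mapP; exists i; rewrite ?mem_enum.
- by apply: lA.2.
- by rewrite scaleN1r (addrC (- Q)) addrA subrK addrK.
Qed.

Theorem theorem5p1 (R : realType) (m n : nat) (hm : (1 <= m)%N) (hn : (1 <= n)%N)
    (Theta : R[i] -> 'M[R[i]]_m) (hTheta : inner_multiplier Theta)
    (G H : 'I_n -> hardy R m)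
    (hG : orthonormal_family G) (hH : orthonormal_family H) :
  ((forall j, mult_range Theta (G j)) ->
    nearly_invariant (kernel_set (perturbed Theta G H))
      (lspan [set hmult Theta (bshift (H j)) | j in [set: 'I_n]]) n)
  /\
  (forall l : nat, (1 <= l)%N -> (l <= n)%N ->
    (forall j : 'I_n, (j < l)%N -> ~ mult_range Theta (G j)) ->
    (forall j : 'I_n, (l <= j)%N -> mult_range Theta (G j)) ->
    nearly_invariant (kernel_set (perturbed Theta G H))
      (lspan
        ([set hmult Theta (bshift (H i)) | i in [set: 'I_n]] `|`
         [set oproj (model_space Theta) (hboundary (G j)) |
           j in [set j : 'I_n | (j < l)%N]]))
      (n + l)%N).
Proof.
have lem (A : set (hardy R m)) (k : nat) (V : 'I_k -> hardy R m) : A = range V ->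
    dim_at_most (lspan A) k by move=> ->; exists V.
split=> [hr|l l1 ln _ hr].
  split; [exact: kernel_perturbed_closed|exact: lspan_linear|exact: lem|].
  (* With no index marked, only the generators Theta S^*H_j remain. *)
  move=> F hF _; have [|F1 [F2 [h1 h2 h3]]] := @perturbed_kernel_decomposition R m n Theta G H pred0 hTheta _ F hF.
    by move=> j _; exact: hr.
  exists F1, F2; split; [exact: h1| |exact: h3].
  move: h2; rewrite (_ : [set _ | j in [set j | pred0 j]] = set0) ?setU0//.
  by apply/seteqP; split => // ? [].
split; [exact: kernel_perturbed_closed|exact: lspan_linear| |].
  (* One ordinal lists all generators: the first n indices give the Theta S^*H_i, the last l the
     projections of the G_j with j < l. *)
  apply: (lem _ (n + l)%N (fun i : 'I_(n + l)%N => match fintype.split i with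
    | inl i => hmult Theta (bshift (H i))
    | inr j => oproj (model_space Theta) (hboundary (G (widen_ord ln j))) end)).
  apply/seteqP; split => [_ [[i _ <-]|[j jl <-]]|_ [i _ <-]].
  - by exists (lshift l i) => //; rewrite (unsplitK (inl i)).
  - exists (rshift n (Ordinal jl)) => //; rewrite (unsplitK (inr (Ordinal jl))).
    by congr (oproj _ (hboundary (G _))); exact: val_inj.
  - case: (fintype.split i) => [j|j]; first by left; exists j.
    by right; exists (widen_ord ln j) => //=.
move=> F hF _; apply: (@perturbed_kernel_decomposition R m n Theta G H (fun j => (j < l)%N) hTheta _ F hF).
by move=> j; rewrite -leqNgt; exact: hr.
Qed.
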